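(* Given a strictly odd nilpotent in a simple Lie algebra $\mathfrak g$ of type $\mathrm B$, $\mathrm C$ or $\mathrm D$, there is an abelian subspace of half dimension in $\mathfrak g_1$ (i.e. of dimension $\frac12\dim\mathfrak g_1$) if and only if the partition corresponding to the nilpotent satisfies one of the following conditions: \begin{itemize} \item the largest part $\mu$ of the partition is even and there are no other even parts; moreover if $\mathfrak g$ is of type $\mathrm B$ then $\mu$ has multiplicity $2$; \item the largest part $\mu$ of the partition is odd, and either there are no other odd parts, or $\mathfrak g$ is not of type $\mathrm C$ and the only other parts are $\mu-1$ with multiplicity $2$ and $1$ (with any multiplicity). \end{itemize} In other words, abelian subspaces of half dimension in $\mathfrak g_1$ occur precisely for those strictly odd nilpotents which correspond to partitions of the following kind: \begin{itemize} \item type $\mathrm C$: $\left[1^{2\nu_1}3^{2\nu_3}\cdots(2k-1)^{2\nu_{2k-1}}(2k)^{\nu}\right]$ with $\nu_{2k-1}\nu\ne0$, or $\left[2^{\nu_2}4^{\nu_4}\cdots(2k)^{\nu_{2k}}(2k+1)^{2\nu}\right]$ with $\nu_{2k}\nu\ne0$; \item type $\mathrm B$ or $\mathrm D$: $\left[2^{2\nu_2}4^{2\nu_4}\cdots(2k)^{2\nu_{2k}}(2k+1)^{\nu}\right]$ with $\nu_{2k}\nu\ne0$, or $\left[1^{\nu_1}(2k)^2(2k+1)^{\nu}\right]$ with $\nu\ne0$; \item type $\mathrm B$: $\left[1^{\nu_1}3^{\nu_3}\cdots(2k-1)^{\nu_{2k-1}}(2k)^2\right]$ with $\nu_{2k-1}\ne0$;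 \item type $\mathrm D$: $\left[1^{\nu_1}3^{\nu_3}\cdots(2k-1)^{\nu_{2k-1}}(2k)^{2\nu}\right]$ with $\nu_{2k-1}\nu\ne0$. \end{itemize}
   Context: The base field is $\mathbb C$. For a nilpotent $e\in\mathfrak g$ choose an $\mathfrak{sl}_2$-triple $(e,h,f)$, i.e. $[e,f]=h$, $[h,e]=2e$, $[h,f]=-2f$, and let $\mathfrak g_j=\{x\in\mathfrak g:[h,x]=jx\}$. The weighted Dynkin diagram of $e$ is the Dynkin diagram of $\mathfrak g$ with node $i$ labelled by $\alpha_i(h)\in\{0,1,2\}$, where the simple roots $\alpha_i$ (for a Cartan subalgebra containing $h$) are chosen with $\alpha_i(h)\ge0$. A nilpotent is even if no weight equals $1$, odd if it is not even, and strictly odd if it is odd and no weight equals $2$. An abelian subspace is a linear subspace any two elements of which commute. For $\mathfrak g$ of type B, C, D, i.e. $\mathfrak{so}_{2r+1}$, $\mathfrak{sp}_{2r}$, $\mathfrak{so}_{2r}$, the partition corresponding to $e$ consists of the sizes of the Jordan blocks of $e$ acting on the standard representation. In types B and D all even parts have even multiplicity; in type C all odd parts have even multiplicity. The notation $[a^{m_a}b^{m_b}\cdots]$ means the partition with parts $a$ of multiplicity $m_a$, $b$ of multiplicity $m_b$, and so on. In the lists $k\ge1$ is an integer, and the $\nu$'s are nonnegative integers subject to the stated nonvanishing conditions. *)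

(* Defs.v *)
From HB Require Import structures.
From mathcomp Require Import all_boot all_order all_algebra.

Set Implicit Arguments.
Unset Strict Implicit.
Unset Printing Implicit Defensive.

Import Order.TTheory GRing.Theory Num.Theory.
Local Open Scope ring_scope.

(* Lie algebras are linear: subspaces of 'M_n under the matrix commutator.    *)

Section LinearLie.
Variables (F : fieldType) (n : nat).
Implicit Types (g t U : {vspace 'M[F]_n}) (e h f x y : 'M[F]_n).

Definition lie x y := x *m y - y *m x.

Definition ad x : 'End('M[F]_n) := linfun (mulmx x) - linfun (mulmxr x).

Lemma adE x y : ad x y = lie x y.
Proof. by rewrite /ad add_lfunE opp_lfunE !lfunE. Qed.

Definition lie_ideal g U :=
  (U <= g)%VS /\ {in g & U, forall x y, lie x y \in U}.

Definition simple_lie g :=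
  (exists2 x, x \in g & exists2 y, y \in g & lie x y != 0) /\
  (forall U, lie_ideal g U -> U = 0%VS \/ U = g).

Definition lie_nilpotent g e :=
  e \in g /\ exists k, {in g, forall x, iter k (ad e) x = 0}.

Definition sl2_triple g e h f :=
  [/\ [/\ e \in g, h \in g & f \in g],
      lie e f = h, lie h e = 2 *: e & lie h f = - 2 *: f].

Definition grading g h (j : int) : {vspace 'M[F]_n} :=
  (g :&: passmx.leigenspace (ad h) j%:~R)%VS.

Lemma mem_grading g h j x :
  (x \in grading g h j) = (x \in g) && (lie h x == j%:~R *: x).
Proof.
rewrite memv_cap; congr (_ && _).
by rewrite memv_ker add_lfunE opp_lfunE scale_lfunE id_lfunE adE subr_eq0.
Qed.

Definition abelian_subspace U := {in U &, forall x y, lie x y = 0}.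

Definition has_half_abelian g h :=
  exists U : {vspace 'M[F]_n},
    [/\ (U <= grading g h 1)%VS, abelian_subspace U &
        (2 * \dim U = \dim (grading g h 1))%N].

(* Cartan subalgebra of a semisimple linear Lie algebra: commuting semisimple *)
(* elements, and self-centralizing.                                           *)
Definition cartan g t :=
  [/\ (t <= g)%VS, {in t, forall x, diagonalizable x} &
      {in g, forall x, x \in t <-> {in t, forall y, lie x y = 0}}].

End LinearLie.

Section Roots.
Variables (F : fieldType) (n : nat) (g t : {vspace 'M[F]_n}).

Definition dual := 'Hom(subvs_of t, F^o).

Definition is_root (alpha : dual) :=
  alpha != 0 /\
  exists x, [/\ x \in g, x != 0 &
    forall y : subvs_of t, lie (vsval y) x = (alpha y : F) *: x].

Definition root_base (m : nat) (Delta : m.-tuple dual) :=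
  [/\ basis_of fullv Delta, forall i, is_root (tnth Delta i) &
      forall beta, is_root beta -> exists c : 'I_m -> nat,
        beta = \sum_i tnth Delta i *+ c i \/
        beta = - \sum_i tnth Delta i *+ c i].

End Roots.

Section WeightedDynkin.
Variables (F : numFieldType) (n : nat).
Implicit Types (g : {vspace 'M[F]_n}) (h : 'M[F]_n).

(* The node labels w_i = alpha_i(h); the edges play no role below.            *)
Definition weighted_dynkin g h (m : nat) (w : 'I_m -> F) :=
  exists (t : {vspace 'M[F]_n}) (Delta : m.-tuple (dual t)),
    [/\ cartan g t, h \in t, root_base g Delta &
        forall i, 0 <= w i /\ tnth Delta i (vsproj t h) = w i].

Definition even_labels (m : nat) (w : 'I_m -> F) := forall i, w i <> 1.

Definition strictly_odd_labels (m : nat) (w : 'I_m -> F) :=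
  ~ even_labels w /\ forall i, w i <> 2.

Definition strictly_odd g h :=
  exists (m : nat) (w : 'I_m -> F),
    weighted_dynkin g h w /\ strictly_odd_labels w.

End WeightedDynkin.

Section Classical.
Variable F : fieldType.

Inductive classical_type := TypeB | TypeC | TypeD.

Definition std_dim (T : classical_type) (r : nat) : nat :=
  match T with TypeB => r.*2.+1 | TypeC | TypeD => r.*2 end.

(* Gram matrices of the forms preserved in type T: any nondegenerate form,    *)
(* symmetric in types B and D, skew-symmetric in type C.                      *)
Definition classical_form (T : classical_type) n (J : 'M[F]_n) :=
  J \in unitmx /\ J^T = (if T is TypeC then - J else J).

Definition form_lie n (J : 'M[F]_n) : {vspace 'M[F]_n} :=
  lker (linfun (mulmxr J \o trmx) + linfun (mulmx J)).

Lemma mem_form_lie n (J x : 'M[F]_n) :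
  (x \in form_lie J) = (x^T *m J + J *m x == 0).
Proof. by rewrite memv_ker add_lfunE !lfunE. Qed.

Definition jordan_block m : 'M[F]_m := \matrix_(i, j) (i.+1 == j :> nat)%:R.

Definition jordan_nilp (s : seq nat) : 'M[F]_(\sum_(i < size s) nth 0%N s i) :=
  \mxdiag_(i < size s) jordan_block (nth 0%N s i).

(* P is an invertible matrix, rectangular only in its type: this avoids a     *)
(* cast along n = \sum_i s_i.                                                 *)
Definition jordan_partition n (e : 'M[F]_n) (s : seq nat) :=
  [/\ sorted geq s, all (leq 1) s &
      exists P : 'M[F]_(\sum_(i < size s) nth 0%N s i, n),
        [/\ row_free P, row_full P & P *m e = jordan_nilp s *m P]].

End Classical.

Section Partitions.
Local Open Scope nat_scope.
Implicit Types (T : classical_type) (s : seq nat).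

Definition largest s := \max_(p <- s) p.

Definition half_cond_even T s :=
  let mu := largest s in
  [/\ ~~ odd mu, {in s, forall p, ~~ odd p -> p = mu} &
      T = TypeB -> count_mem mu s = 2].

Definition half_cond_odd T s :=
  let mu := largest s in
  odd mu /\
  ({in s, forall p, odd p -> p = mu} \/
   [/\ T <> TypeC, count_mem mu.-1 s = 2 &
       {in s, forall p, p \in [:: mu; mu.-1; 1]}]).

(* [1^(c nu_1) 3^(c nu_3) ... (2k-1)^(c nu_(2k-1))] *)
Definition odd_parts c (nu : nat -> nat) k :=
  flatten [seq nseq (c * nu (2 * j - 1)) (2 * j - 1) | j <- iota 1 k].

(* [2^(c nu_2) 4^(c nu_4) ... (2k)^(c nu_(2k))] *)
Definition even_parts c (nu : nat -> nat) k :=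
  flatten [seq nseq (c * nu (2 * j)) (2 * j) | j <- iota 1 k].

Definition half_list T s :=
  exists (k : nat) (nu : nat -> nat) (m : nat), 1 <= k /\
  match T with
  | TypeC =>
      nu (2 * k - 1) * m != 0 /\
        perm_eq s (odd_parts 2 nu k ++ nseq m (2 * k))
      \/
      nu (2 * k) * m != 0 /\
        perm_eq s (even_parts 1 nu k ++ nseq (2 * m) (2 * k + 1))
  | TypeB | TypeD =>
      [\/ nu (2 * k) * m != 0 /\
            perm_eq s (even_parts 2 nu k ++ nseq m (2 * k + 1)),
          m != 0 /\
            perm_eq s (nseq (nu 1) 1 ++ nseq 2 (2 * k) ++ nseq m (2 * k + 1)),
          [/\ T = TypeB, nu (2 * k - 1) != 0 &
            perm_eq s (odd_parts 1 nu k ++ nseq 2 (2 * k))] |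
          [/\ T = TypeD, nu (2 * k - 1) * m != 0 &
            perm_eq s (odd_parts 1 nu k ++ nseq (2 * m) (2 * k))]]
  end.

End Partitions.

(* Main.v *)
From HB Require Import structures.
Require Import Defs.
From mathcomp Require Import all_boot all_order all_algebra.
From mathcomp Require Import ring lra zify.
From mathcomp Require Import reals complex.

Set Implicit Arguments.
Unset Strict Implicit.
Unset Printing Implicit Defensive.

Local Open Scope ring_scope.

Import Order.TTheory GRing.Theory Num.Theory.

(** Let [V_j] be the eigenspace of [h] for the eigenvalue [j] in the standard
    representation. The form pairs [V_j] with [V_(-j)], so an element of [g_1]
    amounts to maps [V_j -> V_(j+1)] for all [j >= 0], and [dim g_1] is the sum of
    the products [dim V_j * dim V_(j+1)].

    Two facts relate these dimensions to the data. By [sl_2]-theory [k+1] occurs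
    [dim V_k - dim V_(k+2)] times as a part ([weight_mult_count]). And for a
    strictly odd nilpotent no weight below the largest one, [mu], is skipped
    ([strictly_odd_no_gap]): if [j] were skipped, the matrix acting by [1] on the
    weights above [j], by [-1] on those below [-j] and by [0] in between would lie
    in the Cartan subalgebra, and all simple roots, having labels [0] or [1], would
    vanish on it. So the largest part is [mu + 1], and [mu] is a part as well.

    The problem then becomes combinatorial. In a basis of eigenvectors of [h] in
    which the form pairs each vector with its mirror image only
    ([sl2_normal_form]), the leading positions of an abelian subspace for a suitable
    order on matrix entries are again the support of an abelian subspace
    ([positions_of_half_abelian], [half_abelian_of_positions]). One has to choose
    half of the arrows [a -> p], with [a] a basis vector of [V_j] and [p] one of
    [V_(j+1)], in such a way that no chosen arrow starts where another one ends;
    in addition two arrows starting at mirror images in [V_0] can be chosen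
    together only if they have the same end and the form is symmetric.

    Let [u_j] be the proportion of chosen arrows among all those from [V_j] to
    [V_(j+1)]. Basis vectors where arrows end do not start any, which gives
    [u_j + u_(j+1) <= 1], and the condition on mirror images gives [u_0 <= 1/2]. As
    the numbers [dim V_j * dim V_(j+1)] do not increase with [j], Abel summation
    bounds the overall proportion by one half and describes the case of equality
    ([level_count_odd], [level_count_even]): every second level is used completely,
    and [dim V_k = dim V_(k+2)] at every second [k], which means that the parts of
    one parity other than the largest are absent. The exception
    [[1^nu_1 (2k)^2 (2k+1)^nu]] comes from [dim V_1 = 2], where one basis vector of
    [V_1] can receive half of the arrows from [V_0]. Conversely these patterns are
    realized by explicit choices ([half_positions_of_weights]). *)

(** * Modules over sl_2 *)

Section Sl2.
Variables (F : numFieldType) (V : lmodType F) (E L H : {linear V -> V}).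
Hypothesis commEL : forall v, E (L v) - L (E v) = H v.
Hypothesis commHE : forall v, H (E v) = E (H v) + 2 *: E v.
Hypothesis commHL : forall v, H (L v) = L (H v) - 2 *: L v.

Let doubleS_natr k : k.+1.*2%:R = k.*2%:R + 2 :> F.
Proof. by rewrite doubleS -[_.+2]addn2 natrD. Qed.

Lemma weight_raise v a k :
  H v = a *: v -> H (iter k E v) = (a + k.*2%:R) *: iter k E v.
Proof.
move=> Hv; elim: k => [|k IHk] /=; first by rewrite addr0.
by rewrite commHE IHk linearZ /= -scalerDl (doubleS_natr k) -addrA.
Qed.

Lemma weight_lower v a k :
  H v = a *: v -> H (iter k L v) = (a - k.*2%:R) *: iter k L v.
Proof.
move=> Hv; elim: k => [|k IHk] /=; first by rewrite subr0.
rewrite commHL IHk linearZ /= -scalerBl (doubleS_natr k).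
by congr (_ *: _); ring.
Qed.

(** On the kernel of [L] the operator [L E^(k+1)] is [-(k+1) E^k (H + k)]: this
    single identity yields both the possible lowest weights and the scalars by
    which [L^k E^k] acts. *)
Lemma lower_raise v k : L v = 0 ->
  L (iter k.+1 E v) = - k.+1%:R *: iter k E (H v + k%:R *: v).
Proof.
move=> Lv.
have HEk u j : H (iter j E u) = iter j E (H u) + j.*2%:R *: iter j E u.
  elim: j => [|j IHj] /=; first by rewrite scale0r addr0.
  by rewrite commHE IHj linearD linearZ /= -addrA -scalerDl (doubleS_natr j).
have iterD u w j : iter j E (u + w) = iter j E u + iter j E w.
  by elim: j => //= j ->; rewrite linearD.
have iterZ b u j : iter j E (b *: u) = b *: iter j E u.
  by elim: j => //= j ->; rewrite linearZ.
have LE u : L (E u) = E (L u) - H u.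
  by rewrite -(commEL u) opprB addrC subrK.
elim: k => [|k IHk].
  by rewrite /= LE Lv linear0 sub0r scale0r addr0 scaleN1r.
rewrite [iter k.+2 _ _]iterS LE IHk HEk linearZ /= !iterD !iterZ.
have ED x y : E (x + y) = E x + E y by rewrite linearD.
have EZ b x : E (b *: x) = b *: E x by rewrite linearZ.
rewrite !(EZ, ED) -[- (_ + _)]scaleN1r !scalerDr !scalerA.
rewrite addrACA -!scalerDl (doubleS_natr k) -addnn.
by congr (_ *: _ + _ *: _); rewrite -?natr1 ?natrD; ring.
Qed.

(** The first vanishing power of [E] on [v] forces [H + k] to vanish there. *)
Lemma lowest_weight v a N : L v = 0 -> H v = a *: v -> v != 0 ->
  iter N E v = 0 -> exists k : nat, a = - k%:R.
Proof.
move=> Lv Hv v0 EN.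
have [k Ek Ek1] : exists2 k, iter k E v != 0 & iter k.+1 E v = 0.
  elim: N EN => [/= /eqP|N IHN EN]; first by rewrite (negPf v0).
  by have [/eqP/IHN//|nz] := boolP (iter N E v == 0); exists N.
have := lower_raise k Lv; rewrite Ek1 linear0 Hv -scalerDl.
have -> : iter k E ((a + k%:R) *: v) = (a + k%:R) *: iter k E v.
  by elim: (k) (a + k%:R) => //= j IHj b; rewrite IHj linearZ.
move=> /esym/eqP; rewrite scalerA scaler_eq0 (negPf Ek) orbF mulf_eq0.
rewrite oppr_eq0 pnatr_eq0 /= addr_eq0 => /eqP ->.
by exists k.
Qed.

(** Descending from [v] by [L] ends at a lowest weight vector, whose weight is an
    integer and differs from that of [v] by an even one. *)
Lemma weight_int v a N M : H v = a *: v -> v != 0 ->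
  (forall u, iter N E u = 0) -> (forall u, iter M L u = 0) ->
  exists z : int, a = z%:~R.
Proof.
move=> Hv v0 EN LM.
have [k Lk Lk1] : exists2 k, iter k L v != 0 & iter k.+1 L v = 0.
  have : iter M L v = 0 by [].
  elim: M {LM} => [/= /eqP|M IHM LM]; first by rewrite (negPf v0).
  by have [/eqP/IHM//|nz] := boolP (iter M L v == 0); exists M.
have [j aj] := lowest_weight Lk1 (weight_lower k Hv) Lk (EN _).
exists (k.*2%:Z - j%:Z); rewrite rmorphB /= -!pmulrn -aj.
by rewrite subrKC.
Qed.

End Sl2.

(** * Lie algebras of a bilinear form *)

Section FormLie.
Variables (F : fieldType) (n : nat).
Implicit Types (J P x y h : 'M[F]_n).

Lemma form_lieP J x : reflect (x^T *m J = - (J *m x)) (x \in form_lie J).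
Proof. by rewrite mem_form_lie addr_eq0; apply: eqP. Qed.

Lemma form_lie_lie J x y :
  x \in form_lie J -> y \in form_lie J -> lie x y \in form_lie J.
Proof.
move=> /form_lieP Jx /form_lieP Jy; apply/form_lieP.
rewrite /lie linearB /= !trmx_mul mulmxBl mulmxBr -!mulmxA Jx Jy.
by rewrite !mulmxN !mulmxA Jx Jy !mulNmx !opprK opprB addrC.
Qed.

Definition conj_end P : 'End('M[F]_n) :=
  linfun (mulmx P \o mulmxr (invmx P)).

Lemma conj_endE P x : conj_end P x = P *m x *m invmx P.
Proof. by rewrite lfunE /= mulmxA. Qed.

Lemma conj_endK P : P \in unitmx -> cancel (conj_end P) (conj_end (invmx P)).
Proof.
move=> Pu x; rewrite !conj_endE invmxK !mulmxA mulVmx // mul1mx.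
by rewrite -mulmxA mulVmx // mulmx1.
Qed.

Lemma conj_end_lie P x y : P \in unitmx ->
  conj_end P (lie x y) = lie (conj_end P x) (conj_end P y).
Proof.
move=> Pu; rewrite !conj_endE /lie mulmxBr mulmxBl !mulmxA.
by rewrite !(mulmxKV Pu).
Qed.

Definition conj_form P J := (invmx P)^T *m J *m invmx P.

Lemma conj_formK P J : P \in unitmx ->
  conj_form (invmx P) (conj_form P J) = J.
Proof.
move=> Pu; rewrite /conj_form invmxK !mulmxA -trmx_mul mulVmx // trmx1 mul1mx.
by rewrite -mulmxA mulVmx // mulmx1.
Qed.

Lemma conj_form_lie P J x : P \in unitmx ->
  x \in form_lie J -> conj_end P x \in form_lie (conj_form P J).
Proof.
move=> Pu /form_lieP Jx; apply/form_lieP; rewrite conj_endE /conj_form.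
rewrite !trmx_mul !mulmxA -[_ *m P^T *m _]mulmxA -[P^T *m _]trmx_mul mulVmx //
  trmx1.
rewrite mulmx1 -[_ *m x^T *m J]mulmxA Jx mulmxN mulNmx.
by rewrite !mulmxA (mulmxKV Pu).
Qed.

Lemma conj_grading P J h (j : int) x : P \in unitmx ->
  x \in grading (form_lie J) h j ->
  conj_end P x \in grading (form_lie (conj_form P J)) (conj_end P h) j.
Proof.
move=> Pu; rewrite !mem_grading => /andP[xJ /eqP hx].
by rewrite conj_form_lie // -conj_end_lie // hx linearZ /= eqxx.
Qed.

Lemma conj_grading_img P J h (j : int) : P \in unitmx ->
  (conj_end P @: grading (form_lie J) h j)%VS =
    grading (form_lie (conj_form P J)) (conj_end P h) j.
Proof.
move=> Pu; have Pu' : invmx P \in unitmx by rewrite unitmx_inv.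
apply/vspaceP => y; apply/memv_imgP/idP => [[x xg ->]|yg].
  exact: conj_grading.
have := conj_grading Pu' yg; rewrite conj_formK // conj_endK // => yg'.
exists (conj_end (invmx P) y) => //.
by rewrite -{1}(invmxK P) conj_endK.
Qed.

Lemma has_half_abelian_conj P J h : P \in unitmx ->
  has_half_abelian (form_lie J) h ->
  has_half_abelian (form_lie (conj_form P J)) (conj_end P h).
Proof.
move=> Pu [U [Ug Uab dimU]]; exists (conj_end P @: U)%VS.
have injP : lker (conj_end P) == 0%VS.
  by apply/lker0P; apply: can_inj (conj_endK Pu).
rewrite -conj_grading_img // !limg_dim_eq ?(eqP injP) ?capv0 //.
split=> //; first exact: limgS.
move=> _ _ /memv_imgP[x xU ->] /memv_imgP[y yU ->].
by rewrite -conj_end_lie // Uab // linear0.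
Qed.

(** A change of basis lets the form and [h] be put into a normal form. *)
Lemma has_half_abelian_conjE P J h : P \in unitmx ->
  has_half_abelian (form_lie J) h <->
  has_half_abelian (form_lie (conj_form P J)) (conj_end P h).
Proof.
move=> Pu; split; first exact: has_half_abelian_conj.
have Pu' : invmx P \in unitmx by rewrite unitmx_inv.
by move/(has_half_abelian_conj Pu'); rewrite conj_formK // conj_endK.
Qed.

End FormLie.

(** * Hyperbolic bases of eigenvectors *)

(** The matrices with nonzero entries exactly on the antidiagonal: the form then
    pairs each basis vector with its mirror image only, so reversal of indices is
    the involution that negates the weights. *)
Definition antidiagonal (F : nmodType) n (A : 'M[F]_n) :=
  forall i j, (A i j != 0) = (j == rev_ord i).

Lemma antidiagonal_unit (F : fieldType) n (A : 'M[F]_n) :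
  antidiagonal A -> A \in unitmx.
Proof.
move=> Aanti; pose B := \matrix_(i, j) ((j == rev_ord i)%:R / A j i).
suff /mulmx1_unit[] : A *m B = 1%:M by [].
apply/matrixP => i j; rewrite !mxE (bigD1 (rev_ord i)) //= big1 => [|l li].
  rewrite mxE rev_ordK addr0 eq_sym; have [->|_] := eqVneq i j.
    by rewrite mul1r divff // Aanti.
  by rewrite mul0r mulr0.
have /eqP-> : A i l == 0 by rewrite -[_ == _]negbK Aanti.
by rewrite mul0r.
Qed.

Lemma antidiagonal_inv (F : fieldType) n (A : 'M[F]_n) :
  antidiagonal A -> antidiagonal (invmx A).
Proof.
move=> Aanti; have Au := antidiagonal_unit Aanti.
have entry i j : invmx A i j * A j (rev_ord j) = (i == rev_ord j)%:R.
  have := congr1 (fun B : 'M_n => B i (rev_ord j)) (mulVmx Au).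
  rewrite !mxE (bigD1 j) //= big1 ?addr0 // => l lj.
  have /eqP-> : A l (rev_ord j) == 0; last by rewrite mulr0.
  by rewrite -[_ == _]negbK Aanti (inj_eq rev_ord_inj) eq_sym.
move=> i j; have Aj : A j (rev_ord j) != 0 by rewrite Aanti.
have -> : (invmx A i j != 0) = (invmx A i j * A j (rev_ord j) != 0).
  by rewrite mulf_eq0 (negPf Aj) orbF.
rewrite entry -[j == _](inj_eq rev_ord_inj) rev_ordK [i == _]eq_sym.
by case: (rev_ord j == i); rewrite ?oner_eq0 ?eqxx.
Qed.

Section HyperbolicBasis.
Variables (F : numClosedFieldType) (n : nat) (K h : 'M[F]_n) (eps : F).
Hypothesis Ku : K \in unitmx.
Hypothesis eps2 : eps * eps = 1.
Hypothesis Ksym : K^T = eps *: K.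
Hypothesis Kh : h *m K = - (K *m h^T).
Variables (P0 : 'M[F]_n) (d : 'I_n -> F).
Hypothesis P0u : P0 \in unitmx.
Hypothesis P0h : forall i, row i P0 *m h = d i *: row i P0.
Implicit Types u x y : 'rV[F]_n.

Let b u x : F := (u *m K *m x^T) 0 0.

Let bDl u x y : b (u + x) y = b u y + b x y.
Proof. by rewrite /b !mulmxDl mxE. Qed.

Let bZl a x y : b (a *: x) y = a * b x y.
Proof. by rewrite /b -!scalemxAl mxE. Qed.

Let bC u x : b x u = eps * b u x.
Proof.
have -> : b x u = (u *m K^T *m x^T)^T 0 0 by rewrite !trmx_mul !trmxK mulmxA.
by rewrite mxE Ksym -scalemxAr -scalemxAl mxE.
Qed.

Let bDr u x y : b u (x + y) = b u x + b u y.
Proof. by rewrite !(bC _ u) bDl mulrDr. Qed.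

Let bZr a x y : b x (a *: y) = a * b x y.
Proof. by rewrite !(bC _ x) bZl mulrCA. Qed.

Let bh x y : b (x *m h) y = - b x (y *m h).
Proof.
by rewrite /b trmx_mul -[x *m h *m K]mulmxA Kh mulmxN mulNmx mxE !mulmxA.
Qed.

Let b_weights x y a c : x *m h = a *: x -> y *m h = c *: y -> b x y != 0 ->
  a = - c.
Proof.
move=> xh yh nz; apply/eqP; rewrite -addr_eq0.
have := bh x y; rewrite xh yh bZl bZr => /eqP; rewrite -addr_eq0 -mulrDl.
by rewrite mulf_eq0 (negPf nz) orbF.
Qed.

(** Hyperbolic planes spanned by eigenvectors of opposite weights. Growing such a
    family inside a fixed space, instead of inducting on the dimension, avoids
    restricting [K] and [h] to the orthogonal complement. *)
Definition hyp_planes k (v w : nat -> 'rV[F]_n) (c : nat -> F) :=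
  [/\ forall i, (i < k)%N -> v i *m h = c i *: v i /\ w i *m h = - c i *: w i,
      forall i j, (i < k)%N -> (j < k)%N -> b (v i) (v j) = 0 /\
        b (w i) (w j) = 0
    & forall i j, (i < k)%N -> (j < k)%N -> b (v i) (w j) = (i == j)%:R].

Section Complement.
Variables (k : nat) (v w : nat -> 'rV[F]_n) (c : nat -> F).
Hypothesis hp : hyp_planes k v w c.

(* [Q] projects onto the span of the planes and [Pi] onto its complement. *)
Let Q : 'M[F]_n :=
  \sum_(i < k) (K *m (w i)^T *m v i + eps *: (K *m (v i)^T *m w i)).

Let Pi : 'M[F]_n := 1%:M - Q.

Let uQ u : u *m Q = \sum_(i < k) (b u (w i) *: v i + (eps * b u (v i)) *: w i).
Proof.
rewrite mulmx_sumr; apply: eq_bigr => i _.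
rewrite mulmxDr -scalemxAr -scalerA !mulmxA.
by rewrite [u *m K *m (w i)^T]mx11_scalar [u *m K *m (v i)^T]mx11_scalar
  !mul_scalar_mx.
Qed.

Let b_suml (I : finType) (f : I -> 'rV[F]_n) y :
  b (\sum_i f i) y = \sum_i b (f i) y.
Proof.
apply: (big_morph (fun x => b x y)) => [x z|]; first exact: bDl.
by rewrite /b !mul0mx mxE.
Qed.

Let b_complement u j : (j < k)%N -> b (u *m Pi) (v j) = 0 /\
  b (u *m Pi) (w j) = 0.
Proof.
case: hp => _ iso dualvw lt_jk.
rewrite mulmxBr mulmx1 uQ -scaleN1r !bDl !bZl !b_suml; split.
  rewrite (bigD1 (Ordinal lt_jk)) //= big1 => [|i ne_ij].
    rewrite bDl !bZl (iso j j lt_jk lt_jk).1 mulr0 add0r addr0.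
    by rewrite (bC (v j) (w j)) dualvw // eqxx mulr1 mulrAC eps2; ring.
  rewrite bDl !bZl (iso i j _ lt_jk).1 // mulr0 add0r.
  rewrite (bC (v j) (w i)) dualvw // -val_eqE eq_sym /= in ne_ij *.
  by rewrite (negPf ne_ij) !mulr0.
rewrite (bigD1 (Ordinal lt_jk)) //= big1 => [|i ne_ij].
  rewrite bDl !bZl (iso j j lt_jk lt_jk).2 mulr0 !addr0.
  by rewrite dualvw // eqxx mulr1; ring.
rewrite bDl !bZl (iso i j _ lt_jk).2 // mulr0 addr0.
rewrite dualvw // -val_eqE /= in ne_ij *.
by rewrite (negPf ne_ij) !mulr0.
Qed.

Let b_Pi u y : b (u *m Pi) (y *m Pi) = b (u *m Pi) y.
Proof.
rewrite [y *m Pi]mulmxBr mulmx1 -scaleN1r bDr bZr.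
rewrite uQ [b _ (\sum_(_ < _) _)]bC b_suml big1 ?mulr0 ?addr0 // => i _.
have [bv bw] := b_complement u (ltn_ord i).
by rewrite bDl !bZl -[b (v i) _]mulr1 -[b (w i) _]mulr1 -eps2 ![_ * (eps *
  eps)]mulrA ![b _ (u *m Pi) * eps]mulrC -!bC bv bw !(mul0r, mulr0) addr0.
Qed.

Let Pi_nondeg u : u *m Pi != 0 -> exists j, b (u *m Pi) (row j P0 *m Pi) != 0.
Proof.
move=> nz; apply/existsP; apply: contraNT nz; rewrite negb_exists => /forallP z.
suff: u *m Pi *m K *m P0^T == 0.
  by rewrite mulmx_free_eq0 ?row_free_unit ?unitmx_tr // mulmx_free_eq0
    ?row_free_unit.
apply/eqP/rowP => j; rewrite [RHS]mxE.
have := z j; rewrite negbK b_Pi => /eqP; rewrite /b => <-.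
by rewrite tr_row !mxE; apply: eq_bigr => l _; rewrite !mxE.
Qed.

Let Pi_weight u a : u *m h = a *: u -> (u *m Pi) *m h = a *: (u *m Pi).
Proof.
case: hp => wt _ _ uh.
rewrite mulmxBr mulmx1 mulmxBl uh scalerBr; congr (_ - _).
rewrite uQ mulmx_suml scaler_sumr; apply: eq_bigr => i _.
have [vh wh] := wt i (ltn_ord i).
rewrite mulmxDl -!scalemxAl vh wh scalerDr !scalerA.
have bw : a * b u (w i) = b u (w i) * c i.
  by rewrite -bZl -uh bh wh bZr; ring.
have bv : a * b u (v i) = - (b u (v i) * c i).
  by rewrite -bZl -uh bh vh bZr; ring.
by congr (_ *: _ + _ *: _); [rewrite bw | rewrite mulrCA bv; ring].
Qed.

Let rank_Pi : (n - k.*2 <= \rank Pi)%N.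
Proof.
have rkQ : (\rank Q <= k.*2)%N.
  have -> : k.*2 = (\sum_(i < k) 2)%N by rewrite sum_nat_const card_ord muln2.
  apply: (big_ind2 (fun (M : 'M[F]_n) r => \rank M <= r)%N) =>
    [|M r N t Mr Nt|i _].
  - by rewrite mxrank0.
  - by rewrite (leq_trans (mxrank_add _ _)) // leq_add.
  - rewrite (leq_trans (mxrank_add _ _)) // -[2%N]/(1 + 1)%N leq_add //.
      exact: leq_trans (mxrankM_maxr _ _) (rank_leq_row _).
    rewrite scalemxAr; exact: leq_trans (mxrankM_maxr _ _) (rank_leq_row _).
have := mxrank_add Pi Q; rewrite subrK mxrank1 => rk.
by rewrite leq_subLR (leq_trans rk) // addnC leq_add2r.
Qed.

Let hyp_extend x y a : b (x *m Pi) (x *m Pi) = 0 -> b (y *m Pi) (y *m Pi) = 0 ->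
  b (x *m Pi) (y *m Pi) != 0 ->
  x *m Pi *m h = a *: (x *m Pi) -> y *m Pi *m h = - a *: (y *m Pi) ->
  exists v' w' c', hyp_planes k.+1 v' w' c'.
Proof.
move=> xx yy xy xh yh.
pose y' := (b (x *m Pi) (y *m Pi))^-1 *: y.
have Ey' : y' *m Pi = (b (x *m Pi) (y *m Pi))^-1 *: (y *m Pi) by rewrite
  -scalemxAl.
pose upd T (g : nat -> T) z i := if (i < k)%N then g i else z.
exists (upd _ v (x *m Pi)), (upd _ w (y' *m Pi)), (upd _ c a); rewrite /upd.
have [wt iso dualvw] := hp.
have b0 z i : (i < k)%N -> [/\ b (z *m Pi) (v i) = 0, b (z *m Pi) (w i) = 0,
    b (v i) (z *m Pi) = 0 & b (w i) (z *m Pi) = 0].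
  move=> ik; have [zv zw] := b_complement z ik.
  by rewrite zv zw (bC _ (v i)) (bC _ (w i)) zv zw mulr0.
split=> [i|i j|i j]; rewrite ltnS leq_eqVlt.
- case/orP=> [/eqP->|ik]; last by rewrite ik; apply: wt.
  by rewrite ltnn xh Ey' -scalemxAl yh scalerA mulrC -scalerA.
- case/orP=> [/eqP->|ik]; rewrite ltnS leq_eqVlt; case/orP=> [/eqP->|jk];
    rewrite ?ltnn ?ik ?jk.
  + by rewrite xx Ey' bZl bZr yy !mulr0.
  + by have [-> _ _ _] := b0 x j jk; have [_ -> _ _] := b0 y' j jk.
  + by have [_ _ -> _] := b0 x i ik; have [_ _ _ ->] := b0 y' i ik.
  + exact: iso.
- case/orP=> [/eqP->|ik]; rewrite ltnS leq_eqVlt; case/orP=> [/eqP->|jk];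
    rewrite ?ltnn ?ik ?jk.
  + by rewrite Ey' bZr mulVf // eqxx.
  + by have [_ -> _ _] := b0 x j jk; rewrite gtn_eqF.
  + by have [_ _ -> _] := b0 y' i ik; rewrite ltn_eqF.
  + exact: dualvw.
Qed.

Let P0_weight i : row i P0 *m Pi *m h = d i *: (row i P0 *m Pi).
Proof. exact: Pi_weight. Qed.

Let isotropic_weight i : d i != 0 ->
  b (row i P0 *m Pi) (row i P0 *m Pi) = 0.
Proof.
move=> di; apply/eqP; apply: contraNT di => nz.
have /eqP := b_weights (P0_weight i) (P0_weight i) nz.
by rewrite -addr_eq0 -mulr2n mulrn_eq0.
Qed.

(** Either two isotropic eigenvectors of the orthogonal complement pair
    nontrivially, or [h] kills the complement, since an eigenvector of nonzero
    weight is isotropic and pairs only with the opposite weight. *)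
Let hyp_dichotomy :
  (exists v' w' c', hyp_planes k.+1 v' w' c') \/
  (forall i j, b (row i P0 *m Pi) (row j P0 *m Pi) != 0 ->
     b (row i P0 *m Pi) (row i P0 *m Pi) != 0 \/
     b (row j P0 *m Pi) (row j P0 *m Pi) != 0) /\ Pi *m h = 0.
Proof.
have [/existsP[i /existsP[j /and3P[nz /eqP ii /eqP jj]]]|none] := boolP
  [exists i, [exists j, [&& b (row i P0 *m Pi) (row j P0 *m Pi) != 0,
     b (row i P0 *m Pi) (row i P0 *m Pi) == 0 &
     b (row j P0 *m Pi) (row j P0 *m Pi) == 0]]].
  left; apply: (hyp_extend ii jj nz (P0_weight i)).
  by rewrite P0_weight (b_weights (P0_weight i) (P0_weight j) nz) opprK.
right; have noneP i j : b (row i P0 *m Pi) (row j P0 *m Pi) != 0 ->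
     b (row i P0 *m Pi) (row i P0 *m Pi) != 0 \/
     b (row j P0 *m Pi) (row j P0 *m Pi) != 0.
  move=> nz; apply/orP; apply: contraR none; rewrite negb_or !negbK =>
    /andP[ii jj].
  by apply/existsP; exists i; apply/existsP; exists j; rewrite nz ii jj.
split=> //; apply/eqP.
have -> : (Pi *m h == 0) = (P0 *m (Pi *m h) == 0).
  apply/eqP/eqP => [->|P0z]; first by rewrite mulmx0.
  by rewrite -(mulKmx P0u (Pi *m h)) P0z mulmx0.
apply/eqP/row_matrixP => i; rewrite row0 !mulmxA row_mul row_mul P0_weight.
have [->|nz] := eqVneq (row i P0 *m Pi) 0; first by rewrite scaler0.
have [j bij] := Pi_nondeg nz.
have di := b_weights (P0_weight i) (P0_weight j) bij.
have [->|di0] := eqVneq (d i) 0; first by rewrite scale0r.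
have dj0 : d j != 0 by apply: contraNneq di0 => dj; rewrite di dj oppr0.
by have [] := noneP i j bij; rewrite isotropic_weight ?eqxx.
Qed.

(** When [h] kills the complement, of dimension at least two, all its vectors are
    eigenvectors of weight [0]; an isotropic one comes from a quadratic equation
    on a line, and a suitable multiple of it corrects any dual vector to an
    isotropic one. *)
Lemma hyp_step : (k.+1.*2 <= n)%N -> exists v' w' c', hyp_planes k.+1 v' w' c'.
Proof.
move=> kn; have [//|[_ Pih]] := hyp_dichotomy.
have rk2 : (1 < \rank Pi)%N by apply: leq_trans rank_Pi; rewrite doubleS in kn;
  lia.
have [i xnz] : exists i, row i Pi != 0.
  apply/existsP; apply: contraLR rk2; rewrite negb_exists => /forallP z.
  suff -> : Pi = 0 by rewrite mxrank0.
  by apply/row_matrixP => i; apply/eqP; rewrite row0 -[_ == _]negbK.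
have /row_subPn[j ynx] : ~~ (Pi <= row i Pi)%MS.
  apply: contraL rk2 => /mxrankS le; rewrite -leqNgt (leq_trans le) //.
  exact: rank_leq_row.
have [u unz uu] : exists2 u, u *m Pi != 0 & b (u *m Pi) (u *m Pi) = 0.
  pose x := delta_mx 0 i : 'rV[F]_n; pose y := delta_mx 0 j : 'rV[F]_n.
  rewrite (rowE i) in xnz ynx; rewrite (rowE j) in ynx.
  have [xx|xx] := eqVneq (b (x *m Pi) (x *m Pi)) 0; first by exists x.
  set A := b _ _ in xx; pose B := b (x *m Pi) (y *m Pi) + b (y *m Pi) (x *m Pi).
  pose C := b (y *m Pi) (y *m Pi).
  (* A root of the quadratic polynomial [b (y + t x) (y + t x)] in [t]. *)
  pose t := (- B + sqrtC (B ^+ 2 - 4 * A * C)) / (2 * A).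
  exists (y + t *: x).
    apply: contraNneq ynx; rewrite mulmxDl -scalemxAl => /eqP.
    by rewrite addr_eq0 -scaleNr => /eqP->; rewrite scalemx_sub.
  rewrite mulmxDl -scalemxAl !(bDl, bDr, bZl, bZr) -/A -/C.
  transitivity (A * t ^+ 2 + B * t + C); first by rewrite /B; ring.
  have sq := sqrtCK (B ^+ 2 - 4 * A * C); move: sq; rewrite /t.
  set r := sqrtC _ => sq.
  transitivity ((r ^+ 2 - (B ^+ 2 - 4 * A * C)) / (4 * A)).
    by field.
  by rewrite sq subrr mul0r.
have [l bul] := Pi_nondeg unz.
have hz x : x *m Pi *m h = 0 by rewrite -mulmxA Pih mulmx0.
set z := row l P0 in bul.
have eps1 : b (u *m Pi) (z *m Pi) + b (z *m Pi) (u *m Pi) =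
    (1 + eps) * b (u *m Pi) (z *m Pi).
  by rewrite (bC (u *m Pi) (z *m Pi)); ring.
pose y := z - (b (z *m Pi) (z *m Pi) / (2 * b (u *m Pi) (z *m Pi))) *: u.
have zz : eps * b (z *m Pi) (z *m Pi) = b (z *m Pi) (z *m Pi).
  by rewrite -bC.
have Ey : y *m Pi = z *m Pi +
    (- (b (z *m Pi) (z *m Pi) / (2 * b (u *m Pi) (z *m Pi)))) *: (u *m Pi).
  by rewrite mulmxBl -scalemxAl scaleNr.
apply: (@hyp_extend u y 0) => //; last 2 first.
- by rewrite hz scale0r.
- by rewrite hz oppr0 scale0r.
- rewrite Ey !(bDl, bDr, bZl, bZr) uu (bC (u *m Pi) (z *m Pi)).
  move: bul zz; set p := b (u *m Pi) _; set q := b (z *m Pi) _ => p0 zz.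
  transitivity ((q - eps * q) / 2); first by field; rewrite p0.
  by rewrite zz subrr mul0r.
- by rewrite Ey bDr bZr uu mulr0 addr0.
Qed.

Lemma hyp_middle : (k.*2 < n)%N ->
  (forall v' w' c', ~ hyp_planes k.+1 v' w' c') ->
  exists x, [/\ x *m h = 0, b x x != 0 &
    forall i, (i < k)%N -> b x (v i) = 0 /\ b x (w i) = 0].
Proof.
move=> kn nomore; have [[v' [w' [c' /nomore//]]]|[ne Pih]] := hyp_dichotomy.
have [i nz] : exists i, row i P0 *m Pi != 0.
  have rk : (0 < \rank Pi)%N by apply: leq_trans rank_Pi; lia.
  apply/existsP; apply: contraLR rk; rewrite negb_exists => /forallP z.
  suff -> : Pi = 0 by rewrite mxrank0.
  rewrite -(mulKmx P0u Pi); suff -> : P0 *m Pi = 0 by rewrite mulmx0.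
  by apply/row_matrixP => i; rewrite row_mul row0; apply/eqP;
    rewrite -[_ == _]negbK.
have [j bij] := Pi_nondeg nz.
have hz x : x *m Pi *m h = 0 by rewrite -mulmxA Pih mulmx0.
by have [bb|bb] := ne i j bij;
  [exists (row i P0 *m Pi)|exists (row j P0 *m Pi)];
  split=> // ? ?; apply: b_complement.
Qed.

End Complement.

Let gramE m m' (A : 'M[F]_(m, n)) (B : 'M[F]_(m', n)) i j :
  (A *m K *m B^T) i j = b (row i A) (row j B).
Proof.
rewrite /b -row_mul tr_row !mxE; apply: eq_bigr => l _.
by rewrite !mxE.
Qed.

(* The planes have an invertible Gram matrix, so they are independent. *)
Let hyp_leq k v w c : hyp_planes k v w c -> (k.*2 <= n)%N.
Proof.
move=> [_ iso dualvw].
pose V := \matrix_(i < k) v i; pose W := \matrix_(i < k) w i.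
pose A := col_mx V W.
have VV : V *m K *m V^T = 0.
  by apply/matrixP => i j; rewrite gramE !rowK mxE (iso i j _ _).1.
have WW : W *m K *m W^T = 0.
  by apply/matrixP => i j; rewrite gramE !rowK mxE (iso i j _ _).2.
have VW : V *m K *m W^T = 1%:M.
  by apply/matrixP => i j; rewrite gramE !rowK mxE dualvw.
have WV : W *m K *m V^T = eps%:M.
  apply/matrixP => i j; rewrite gramE !rowK mxE (bC (v j)) dualvw // eq_sym.
  by rewrite mulr_natr.
have AA : A *m K *m A^T = block_mx 0 1%:M eps%:M 0.
  by rewrite /A tr_col_mx mul_col_mx mul_col_row VV WW VW WV.
have Au : A *m K *m A^T \in unitmx.
  suff /mulmx1_unit[] : A *m K *m A^T *m block_mx 0 eps%:M 1%:M 0 = 1%:M by [].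
  rewrite AA mulmx_block !(mul0mx, mulmx0, mul1mx, mulmx1, add0r, addr0).
  by rewrite -scalar_mxM eps2 -scalar_mx_block.
rewrite -addnn; have := mxrank_unit Au => <-.
by apply: leq_trans (mxrankM_maxr _ _) _; exact: rank_leq_row.
Qed.

Let hyp_planes_exist k : (k.*2 <= n)%N -> exists v w c, hyp_planes k v w c.
Proof.
elim: k => [_|k IHk kn]; first by exists (fun=> 0), (fun=> 0), (fun=> 0); split.
have [|v [w [c hp]]] := IHk; first by rewrite doubleS in kn; lia.
exact: hyp_step hp kn.
Qed.

(** List the [v i] in order, then in odd dimension a vector orthogonal to all the
    planes, then the [w i] backwards. *)
Lemma hyperbolic_eigenbasis : exists (P : 'M[F]_n) (c : 'I_n -> F),
  (forall i, row i P *m h = c i *: row i P) /\ antidiagonal (P *m K *m P^T).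
Proof.
pose k := n./2.
have [|v [w [c hp]]] := @hyp_planes_exist k; first by rewrite /k; lia.
have [x xP] : exists x, odd n -> [/\ x *m h = 0, b x x != 0 &
    forall i, (i < k)%N -> b x (v i) = 0 /\ b x (w i) = 0].
  have [on|_] := boolP (odd n); last by exists 0.
  have [||x xP] := hyp_middle hp; [by rewrite /k; lia| |by exists x].
  by move=> v' w' c' /hyp_leq; rewrite /k; lia.
have [wt iso dualvw] := hp.
pose r i := if (i < k)%N then v i else if (n - i.+1 < k)%N then w (n - i.+1)%N
  else x.
pose ev i := if (i < k)%N then c i else
  if (n - i.+1 < k)%N then - c (n - i.+1)%N else 0.
have mid i : (i < n)%N -> ~~ (i < k)%N -> ~~ (n - i.+1 < k)%N -> odd n /\ i = k.
  by rewrite /k; lia.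
exists (\matrix_(i < n) r i), (fun i => ev i); split.
  move=> i; rewrite !rowK /r /ev; case: ifPn => ik; first exact: (wt i ik).1.
  case: ifPn => ik'; first exact: (wt _ ik').2.
  have [on _] := mid i (ltn_ord i) ik ik'.
  by have [-> _ _] := xP on; rewrite scale0r.
have bw i j : (i < k)%N -> (j < k)%N -> b (w i) (v j) = eps * (i == j)%:R.
  by move=> ik jk; rewrite bC dualvw // eq_sym.
have eps0 : eps != 0.
  by apply/eqP => e0; move: eps2; rewrite e0 mul0r => /esym/eqP;
    rewrite oner_eq0.
move=> i j; rewrite gramE !rowK /r -val_eqE /=.
have [ik|ik] := boolP (i < k)%N; have [jk|jk] := boolP (j < k)%N.
- rewrite (iso i j ik jk).1 eqxx; rewrite /k in ik jk.
  by have := ltn_ord i; have := ltn_ord j; lia.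
- case: ifPn => jk'.
    rewrite dualvw // pnatr_eq0 eqb0 negbK.
    by have := ltn_ord i; have := ltn_ord j; lia.
  have [on jE] := mid j (ltn_ord j) jk jk'.
  have [_ _ /(_ i ik)[xv _]] := xP on; rewrite bC xv mulr0 eqxx.
  by have := ltn_ord i; have := ltn_ord j; move: ik jE; rewrite /k; lia.
- case: ifPn => ik'.
    rewrite bw // mulf_eq0 (negPf eps0) pnatr_eq0 eqb0 negbK.
    by have := ltn_ord i; have := ltn_ord j; lia.
  have [on iE] := mid i (ltn_ord i) ik ik'.
  have [_ _ /(_ j jk)[-> _]] := xP on; rewrite eqxx.
  by have := ltn_ord i; have := ltn_ord j; move: jk iE; rewrite /k; lia.
- case: ifPn => ik'; case: ifPn => jk'.
  + rewrite (iso _ _ ik' jk').2 eqxx.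
    by have := ltn_ord i; have := ltn_ord j; move: ik jk ik' jk'; rewrite /k;
      lia.
  + have [on jE] := mid j (ltn_ord j) jk jk'.
    have [_ _ /(_ _ ik')[_ xw]] := xP on; rewrite bC xw mulr0 eqxx.
    by have := ltn_ord i; have := ltn_ord j; move: ik' ik jE; rewrite /k; lia.
  + have [on iE] := mid i (ltn_ord i) ik ik'.
    have [_ _ /(_ _ jk')[_ ->]] := xP on; rewrite eqxx.
    by have := ltn_ord i; have := ltn_ord j; move: jk' jk iE; rewrite /k; lia.
  + have [on iE] := mid i (ltn_ord i) ik ik'.
    have [_ jE] := mid j (ltn_ord j) jk jk'.
    have [_ -> _] := xP on; apply/esym/eqP.
    by rewrite iE jE /k; lia.
Qed.

End HyperbolicBasis.

(** * Leading positions of a space of matrices *)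

Section Coordinates.
Variables (F : fieldType) (n : nat).
Implicit Types (A : {set 'I_n * 'I_n}) (U : {vspace 'M[F]_n}).

Definition coords A (x : 'M[F]_n) : 'rV[F]_#|A| :=
  \row_k x (enum_val k).1 (enum_val k).2.

Fact coords_is_linear A : linear (coords A).
Proof. by move=> a x y; apply/rowP => k; rewrite !mxE. Qed.

HB.instance Definition _ A :=
  GRing.isLinear.Build F 'M[F]_n 'rV[F]_#|A| _ (coords A) (coords_is_linear A).

Lemma coords0P A (x : 'M[F]_n) :
  reflect (forall p a, (p, a) \in A ->
    x p a = 0) (x \in lker (linfun (coords A))).
Proof.
rewrite memv_ker lfunE /=; apply: (iffP eqP) => [x0 p a pA|x0].
  have := congr1 (fun r : 'rV[F]_#|A| => r 0 (enum_rank_in pA (p, a))) x0.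
  by rewrite !mxE enum_rankK_in.
apply/rowP => k; rewrite !mxE; apply: x0.
by rewrite -surjective_pairing enum_valP.
Qed.

Lemma dim_coords A U :
  (forall x, x \in U -> (forall p a, (p, a) \in A -> x p a = 0) -> x = 0) ->
  (forall v : 'I_n -> 'I_n -> F, exists2 x, x \in U &
     forall p a, (p, a) \in A -> x p a = v p a) ->
  \dim U = #|A|.
Proof.
move=> inj surj; pose f : 'Hom('M[F]_n, 'rV[F]_#|A|) := linfun (coords A).
rewrite -(limg_ker_dim f U).
have -> : (U :&: lker f = 0)%VS.
  apply/eqP; rewrite -subv0; apply/subvP => x /memv_capP[xU /coords0P x0].
  by rewrite memv0; apply/eqP/inj.
rewrite dimv0 add0n; have -> : (f @: U = fullv)%VS.
  apply/eqP; rewrite eqEsubv subvf; apply/subvP => r _.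
  have [x xU xv] := surj (fun p a =>
    if [pick k | enum_val k == (p, a) :> _ * _] is Some k then r 0 k else 0).
  apply/memv_imgP; exists x => //; rewrite lfunE; apply/rowP => k; rewrite mxE.
  rewrite xv -?surjective_pairing ?enum_valP //.
  by case: pickP => [j /eqP/enum_val_inj-> //|/(_ k)]; rewrite eqxx.
by rewrite dimvf /dim /= mul1n.
Qed.

(** Gaussian elimination: a subspace has as many leading positions as its
    dimension, for any order of the coordinates given by a key. *)
Lemma leading_positions A (key : 'I_n * 'I_n -> nat) U :
  (forall x, x \in U -> (forall p a, (p, a) \in A -> x p a = 0) -> x = 0) ->
  exists S : {set 'I_n * 'I_n}, [/\ S \subset A, (\dim U <= #|S|)%N &
    forall p a, (p, a) \in S -> exists2 x, x \in U & x p a != 0 /\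
      forall q b, (q, b) \in A -> (key (p, a) < key (q, b))%N -> x q b = 0].
Proof.
move=> inj; pose leK (s t : 'I_n * 'I_n) := (key t <= key s)%N.
have leK_trans : transitive leK by move=> s t u ts su; apply: leq_trans ts.
have leK_total : total leK by move=> s t; rewrite /leK leq_total.
suff [S [Suniq Ssub dimS SP]] : exists S : seq ('I_n * 'I_n),
    [/\ uniq S, {subset S <= sort leK (enum A)}, (\dim U <= size S)%N &
     forall s, s \in S -> exists2 x, x \in U & x s.1 s.2 != 0 /\
      forall t, t \in sort leK (enum A) -> (key s < key t)%N -> x t.1 t.2 = 0].
  exists [set s in S]; split.
  - by apply/subsetP => s; rewrite inE => /Ssub; rewrite mem_sort mem_enum.
  - by rewrite cardsE (card_uniqP Suniq).
  - move=> p a; rewrite inE => /SP[x xU [xnz x0]]; exists x => //; split=>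
      // q b qA.
    by apply: (x0 (q, b)); rewrite mem_sort mem_enum.
have : uniq (sort leK (enum A)) by rewrite sort_uniq enum_uniq.
have : sorted leK (sort leK (enum A)) by apply: sort_sorted.
have {inj}: forall x, x \in U ->
    (forall s, s \in sort leK (enum A) -> x s.1 s.2 = 0) -> x = 0.
  move=> x xU x0; apply: inj => // p a pA.
  by apply: (x0 (p, a)); rewrite mem_sort mem_enum.
(* Induction on the positions from the largest key down: passing to the
   subspace where the first coordinate vanishes loses at most one dimension. *)
elim: (sort leK (enum A)) U => [|t l IHl] U /= inj.
  move=> _ _; exists [::]; split=> //; rewrite leqn0 dimv_eq0 -subv0.
  by apply/subvP => x /inj ->; rewrite ?mem0v.
move=> tl /andP[tNl luniq].
pose f : 'Hom('M[F]_n, 'rV[F]_#|[set t]|) := linfun (coords [set t]).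
have mem_ker (x : 'M[F]_n) : (x \in lker f) = (x t.1 t.2 == 0).
  apply/coords0P/eqP => [x0|x0 p a]; first by apply: x0;
    rewrite -surjective_pairing set11.
  by rewrite inE => /eqP tE; move: x0; rewrite -tE.
have [|S [Suniq Ssub dimS SP]] :=
  IHl (U :&: lker f)%VS _ (path_sorted tl) luniq.
  move=> x /memv_capP[xU]; rewrite mem_ker => /eqP xt x0.
  by apply: inj => // s; rewrite inE => /predU1P[->|/x0].
have SP' s : s \in S -> exists2 x, x \in U & x s.1 s.2 != 0 /\
    (forall t', t' \in t :: l -> (key s < key t')%N -> x t'.1 t'.2 = 0).
  move=> /SP[x /memv_capP[xU]]; rewrite mem_ker => /eqP xt [xnz x0].
  by exists x => //; split=> // t'; rewrite inE => /predU1P[->|/x0].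
have [Uf|/subvPn[x xU]] := boolP (U <= lker f)%VS.
  exists S; split=> // [s /Ssub|]; first by rewrite inE orbC => ->.
  by rewrite -(capv_idPl Uf).
rewrite mem_ker => xt; exists (t :: S); split=> /=.
- by rewrite Suniq andbT; apply: contra tNl; apply: Ssub.
- by move=> s; rewrite !inE => /predU1P[->|/Ssub ->]; rewrite ?eqxx ?orbT.
- have : (\dim (f @: U) <= 1)%N.
    by rewrite (leq_trans (dimvS (subvf _))) // dimvf /dim /= cards1.
  by move=> dim1; rewrite -(limg_ker_dim f U) -[(size S).+1]addn1 leq_add.
- move=> s; rewrite inE => /predU1P[->|/SP'//]; exists x => //; split=> // t'.
  rewrite inE => /predU1P[->|t'l]; first by rewrite ltnn.
  have := order_path_min leK_trans tl => /allP/(_ t' t'l).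
  by rewrite /leK leqNgt => /negPf->.
Qed.

End Coordinates.

(** * Abelian subspaces as sets of matrix positions *)

Definition weight_mx (F : numFieldType) n (c : 'I_n -> int) : 'M[F]_n :=
  diag_mx (\row_i (c i)%:~R).

Lemma lie_weight_mx (F : numFieldType) n (c : 'I_n -> int) (x : 'M[F]_n) i j :
  lie (weight_mx F c) x i j = (c i - c j)%:~R * x i j.
Proof.
by rewrite /lie /weight_mx mul_diag_mx mul_mx_diag !mxE rmorphB /=; ring.
Qed.

Section Positions.
Variables (n : nat) (c : 'I_n -> int) (alt : bool).

(** The form makes the entry of an element of [g_1] at [(p, a)] determine the one
    at [(rev_ord a, rev_ord p)]; since no integer [j] equals [-j-1], each such pair
    of positions has exactly one member starting at a weight [c a >= 0]. *)
Definition positions : {set 'I_n * 'I_n} :=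
  [set pa | (0 <= c pa.2) && (c pa.1 == c pa.2 + 1)].

Lemma mem_positions p a :
  ((p, a) \in positions) = (0 <= c a) && (c p == c a + 1).
Proof. by rewrite inE. Qed.

(** No sum of two roots of [S] is a root: the first clause is composability, the
    second concerns [V_(-1) -> V_0 -> V_1], where the sum of the roots at [(b, q)]
    and [(b', rev_ord q)] fails to be a root only for [b = b'] and a symmetric
    form. *)
Definition commuting_positions (S : {set 'I_n * 'I_n}) :=
  (forall p q a, (p, q) \in S -> (q, a) \in S -> False) /\
  (forall b b' q, (b, q) \in S -> (b', rev_ord q) \in S -> b = b' /\ ~~ alt).

(** A lexicographic order: the weight at which the position starts, then the row
    increasingly, then the column decreasingly. Composable positions [(p, q)] and
    [(q, a)] thus react oppositely to a change of [q]. *)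
Definition position_key (pa : 'I_n * 'I_n) : nat :=
  ((`|c pa.2|%N * n + pa.1) * n + rev_ord pa.2)%N.

Lemma position_key_degree (p a q b : 'I_n) :
  (`|c a| < `|c b|)%N -> (position_key (p, a) < position_key (q, b))%N.
Proof.
move=> ab; rewrite /position_key /=; have := ltn_ord p; have := ltn_ord a.
set A := (`|c a|)%N in ab *; set B := (`|c b|)%N in ab * => an pn.
have : (A.+1 * n <= B * n)%N by rewrite leq_mul2r ab orbT.
by move=> AB; have : ((A * n + p).+1 * n <= (B * n + q) * n)%N;
  [rewrite leq_mul2r|];
  lia.
Qed.

Lemma position_key_row (p a q b : 'I_n) :
  c a = c b -> (p < q)%N -> (position_key (p, a) < position_key (q, b))%N.
Proof.
move=> ab pq; rewrite /position_key /= ab; have := ltn_ord a => an.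
have : ((`|c b| * n + p).+1 * n <= (`|c b| * n + q) * n)%N.
  by rewrite leq_mul2r; lia.
lia.
Qed.

Lemma position_key_col (p a b : 'I_n) :
  c a = c b -> (b < a)%N -> (position_key (p, a) < position_key (p, b))%N.
Proof. by move=> ab ba; rewrite /position_key /= ab; have := ltn_ord a;
  lia. Qed.

End Positions.

Section HalfAbelianCriterion.
Variables (F : numFieldType) (n : nat) (J : 'M[F]_n) (c : 'I_n ->
  int) (alt : bool).
Hypothesis Janti : antidiagonal J.
Hypothesis Jsym : J^T = (-1) ^+ alt *: J.
Hypothesis c_rev : forall i, c (rev_ord i) = - c i.

Implicit Types x y z : 'M[F]_n.

Let kap i := J i (rev_ord i).

Let kap_neq0 i : kap i != 0.
Proof. by rewrite /kap Janti. Qed.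

Let kap_rev i : kap (rev_ord i) = (-1) ^+ alt * kap i.
Proof.
have := congr1 (fun A : 'M_n => A i (rev_ord i)) Jsym.
by rewrite !mxE /kap rev_ordK.
Qed.

Let Joff i j : j != rev_ord i -> J i j = 0.
Proof. by rewrite -Janti negbK => /eqP. Qed.

Let mem_form x : reflect
  (forall p a, x p a * kap p = - (kap a * x (rev_ord a) (rev_ord p)))
  (x \in form_lie J).
Proof.
have E1 a b : (x^T *m J) a b = x (rev_ord b) a * kap (rev_ord b).
  rewrite mxE (bigD1 (rev_ord b)) //= big1 ?addr0 => [|l lb].
    by rewrite mxE /kap rev_ordK.
  rewrite [J l b]Joff ?mulr0 //; apply: contra lb => /eqP->.
  by rewrite rev_ordK.
have E2 a b : (J *m x) a b = kap a * x (rev_ord a) b.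
  rewrite mxE (bigD1 (rev_ord a)) //= big1 ?addr0 // => l lb.
  by rewrite Joff ?mul0r.
apply: (iffP (form_lieP _ _)) => [xJ p a|xJ].
  have := congr1 (fun A : 'M_n => A a (rev_ord p)) xJ.
  by rewrite E1 [RHS]mxE E2 rev_ordK.
by apply/matrixP => a b; rewrite E1 [RHS]mxE E2 xJ rev_ordK.
Qed.

Let g1 := grading (form_lie J) (weight_mx F c) 1.

Let mem_g1 x : reflect
  (x \in form_lie J /\ forall p a, x p a != 0 -> c p = c a + 1) (x \in g1).
Proof.
rewrite mem_grading scale1r; apply: (iffP andP) => [[xJ /eqP hx]|[xJ xc]];
  split=> //.
  move=> p a nz; have := congr1 (fun A : 'M_n => A p a) hx.
  rewrite lie_weight_mx -[RHS]mul1r => /(mulIf nz)/eqP.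
  by rewrite -[1]/(1%:~R) eqr_int subr_eq addrC => /eqP.
apply/eqP/matrixP => p a; rewrite lie_weight_mx.
have [->|/xc->] := eqVneq (x p a) 0; first by rewrite mulr0.
by rewrite addrAC subrr add0r mul1r.
Qed.

Let E := positions c.

Let reflect_position p a : c p = c a + 1 ->
  ((p, a) \in E) || ((rev_ord a, rev_ord p) \in E).
Proof. by move=> pa; rewrite !mem_positions !c_rev; lia. Qed.

Let g1_eq0 x : x \in g1 -> (forall p a, (p, a) \in E -> x p a = 0) -> x = 0.
Proof.
move=> /mem_g1[/mem_form xJ xc] x0; apply/matrixP => p a; rewrite mxE.
apply/eqP; apply: contraTT isT => nz.
have /orP[/x0/eqP|/x0 z] := reflect_position (xc p a nz);
  first by rewrite (negPf nz).
have /eqP := xJ p a; rewrite z mulr0 oppr0 mulf_eq0 (negPf nz).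
by rewrite (negPf (kap_neq0 _)).
Qed.

Let coord_space (S : {set 'I_n * 'I_n}) : {vspace 'M[F]_n} :=
  (g1 :&: lker (linfun (coords (E :\: S))))%VS.

Let dim_coord_space (S : {set 'I_n * 'I_n}) : S \subset E ->
  \dim (coord_space S) = #|S|.
Proof.
move=> /subsetP SE; apply: dim_coords => [x /memv_capP[xg /coords0P x0] xS|v].
  apply: g1_eq0 xg _ => p a pE.
  have [/xS//|paS] := boolP ((p, a) \in S).
  by apply: x0; rewrite inE paS.
pose z p a := if (p, a) \in S then v p a else 0.
pose x := \matrix_(p, a) (z p a - kap a / kap p * z (rev_ord a) (rev_ord p)).
have zE p a : z p a != 0 -> (p, a) \in E.
  by rewrite /z; case: ifP => [/SE//|_]; rewrite eqxx.
have z_excl p a : (p, a) \in E -> z (rev_ord a) (rev_ord p) = 0.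
  rewrite mem_positions => /andP[a0 /eqP pa]; apply/eqP.
  apply: contraTT isT => /zE; rewrite mem_positions !c_rev.
  lia.
exists x; last first.
  by move=> p a paS; rewrite mxE (z_excl p a) ?SE // mulr0 subr0 /z paS.
apply/memv_capP; split; last first.
  apply/coords0P => p a; rewrite inE => /andP[paS paE].
  by rewrite mxE (z_excl p a) // mulr0 subr0 /z (negPf paS).
apply/mem_g1; split.
  apply/mem_form => p a; rewrite !mxE !rev_ordK !kap_rev.
  have k2 : ((-1) ^+ alt * kap p) / ((-1) ^+ alt * kap a) = kap p / kap a.
    by rewrite -mulf_div divff ?mul1r // signr_eq0.
  rewrite k2; have := kap_neq0 p; have := kap_neq0 a => ka kp.
  by field; rewrite ka kp.
move=> p a; rewrite mxE; have [->|/zE] := eqVneq (z p a) 0; last first.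
  by rewrite mem_positions => /andP[_ /eqP].
rewrite sub0r oppr_eq0 mulf_eq0 negb_or => /andP[_ /zE].
by rewrite mem_positions !c_rev => /andP[_ /eqP]; lia.
Qed.

Lemma dim_degree_one : \dim g1 = #|E|.
Proof.
rewrite -(dim_coord_space (subxx E)); congr (\dim _); apply/esym/capv_idPl.
by apply/subvP => x _; apply/coords0P => p a; rewrite setDv inE.
Qed.

Let lie_entry (x y : 'M[F]_n) p a :
  lie x y p a = \sum_q (x p q * y q a - y p q * x q a).
Proof. by rewrite /lie !mxE -sumrB. Qed.

(** The elements of [g_1] supported on [S] and its mirror image commute, because
    every product contributing to an entry of a bracket is excluded; in the case
    [b = b'] of a symmetric form the entry lies on the antidiagonal, where elements
    of the Lie algebra vanish. *)
Lemma half_abelian_of_positions (S : {set 'I_n * 'I_n}) : S \subset E ->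
  commuting_positions alt S ->
  (2 * #|S| = #|E|)%N -> has_half_abelian (form_lie J) (weight_mx F c).
Proof.
move=> SE [chain zigzag] card; exists (coord_space S); split.
- exact: capvSl.
- move=> x y /memv_capP[/mem_g1[xJ xc] /coords0P xS].
  move=> /memv_capP[/mem_g1[yJ yc] /coords0P yS].
  have inS (u : 'M[F]_n) : (forall p a, u p a != 0 -> c p = c a + 1) ->
      (forall p a, (p, a) \in E :\: S -> u p a = 0) ->
      forall p a, u p a != 0 -> 0 <= c a -> (p, a) \in S.
    move=> uc uS p a nz a0; have pa := uc p a nz; apply: contraNT nz => paS.
    by apply/eqP/uS; rewrite inE paS mem_positions a0 pa eqxx.
  have {inS} [xIn yIn] := (inS x xc xS, inS y yc yS).
  have termE (u v : 'M[F]_n) p q a : (forall p a, u p a != 0 ->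
    c p = c a + 1) ->
      (forall p a, v p a != 0 -> c p = c a + 1) -> v \in form_lie J ->
      (forall p a, u p a != 0 -> 0 <= c a -> (p, a) \in S) ->
      (forall p a, v p a != 0 -> 0 <= c a -> (p, a) \in S) ->
      u p q * v q a != 0 ->
      c p = c a + 2 /\ (-1 <= c a -> c a = -1 /\ p = rev_ord a /\ ~~ alt).
    move=> uc vc /mem_form vJ uIn vIn; rewrite mulf_eq0 negb_or => /andP[pq qa].
    have [Epq Eqa] := (uc _ _ pq, vc _ _ qa).
    split=> [|a1]; first by lia.
    have pqS : (p, q) \in S by apply: uIn => //; lia.
    have [a0|a0] := boolP (0 <= c a); first by case: (chain p q a pqS);
      apply: vIn.
    split; first by lia.
    apply: (zigzag p (rev_ord a) q pqS); apply: vIn; last by rewrite c_rev; lia.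
    have := vJ q a; apply: contra_eqN => /eqP->; rewrite mulr0 oppr0.
    by rewrite mulf_eq0 negb_or qa kap_neq0.
  have zE p a : lie x y p a != 0 ->
      c p = c a + 2 /\ (-1 <= c a -> c a = -1 /\ p = rev_ord a /\ ~~ alt).
    rewrite lie_entry => nz.
    have /existsP[q] : [exists q, x p q * y q a - y p q * x q a != 0].
      apply: contraNT nz; rewrite negb_exists => /forallP z.
      by apply/eqP/big1 => q _; apply/eqP; rewrite -[_ == _]negbK.
    have [/eqP->|/termE H _] := boolP (x p q * y q a == 0); last exact: H.
    by rewrite sub0r oppr_eq0 => /termE H; apply: H.
  have /mem_form zJ := form_lie_lie xJ yJ.
  have z0 p a : -1 <= c a -> lie x y p a = 0.
    move=> a1; apply/eqP; apply: contraTT isT => nz.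
    have [_ /(_ a1)[_ [pa nalt]]] := zE p a nz.
    have := zJ p a; rewrite pa rev_ordK kap_rev (negPf nalt) mul1r -pa mulrC.
    move=> /eqP; rewrite -addr_eq0 -mulr2n mulrn_eq0 mulf_eq0 (negPf nz).
    by rewrite (negPf (kap_neq0 a)).
  apply/matrixP => p a; rewrite [RHS]mxE; apply/eqP; apply: contraTT isT => nz.
  have [pa _] := zE p a nz.
  have [/(z0 p)/eqP|a1] := boolP (-1 <= c a); first by rewrite (negPf nz).
  have := zJ p a; rewrite (z0 (rev_ord a)) ?c_rev; last by lia.
  by rewrite mulr0 oppr0 => /eqP;
    rewrite mulf_eq0 (negPf nz) (negPf (kap_neq0 p)).
- by rewrite dim_coord_space // dim_degree_one.
Qed.

(** Leading positions of an abelian subspace commute: for leading positions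
    [(p, q)] and [(q, a)] the entry [(p, a)] of the bracket is the product of the
    two leading coefficients, all other terms being killed by the order; the
    entry [(b, rev_ord b')] plays the same part for [(b, q)] and
    [(b', rev_ord q)]. *)
Lemma positions_of_half_abelian : has_half_abelian (form_lie J) (weight_mx F c)
  ->
  exists S : {set 'I_n * 'I_n}, [/\ S \subset E,
    commuting_positions alt S & (#|E| <= 2 * #|S|)%N].
Proof.
case=> U [/subvP Ug Uab]; rewrite dim_degree_one => dimU.
have [x /Ug/g1_eq0//|S [SE dimS SP]] :=
  @leading_positions _ _ E (position_key c) U.
exists S; split=> //; last by rewrite -dimU leq_pmul2l.
have lead p a : (p, a) \in S -> exists2 x, x \in U & [/\ x \in form_lie J,
    forall q b, x q b != 0 -> c q = c b + 1, x p a != 0 &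
    forall q b, (q, b) \in E -> x q b != 0 ->
      (position_key c (q, b) <= position_key c (p, a))%N].
  move=> /SP[x xU [nz x0]]; exists x => //.
  have /mem_g1[xJ xc] := Ug x xU; split=> // q b qE; rewrite leqNgt.
  by apply: contra => lt; rewrite x0.
have SEP p a : (p, a) \in S -> 0 <= c a /\ c p = c a + 1.
  by move=> /(subsetP SE); rewrite mem_positions => /andP[? /eqP].
clear dimS dimU SP; split=> [p q a pqS qaS|b b' q bS b'S].
  have [[_ pq] [a0 qa]] := (SEP _ _ pqS, SEP _ _ qaS).
  have [x xU [xJ xc xnz xlead]] := lead p q pqS.
  have [y yU [yJ yc ynz ylead]] := lead q a qaS.
  have := Uab x y xU yU => /(congr1 (fun A : 'M_n => A p a)).
  clear U Ug Uab SE lead xU yU.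
  have y0 q' : y p q' = 0.
    apply/eqP; apply: contraTT isT => nz; have Eq' := yc _ _ nz.
    have pE : (p, q') \in E by rewrite mem_positions; clear - Eq' pq qa a0; lia.
    have := ylead p q' pE nz; rewrite leqNgt position_key_degree //.
    by clear - Eq' pq qa a0; lia.
  rewrite lie_entry mxE (bigD1 q) //= big1 => [|q' q'q]; rewrite y0 mul0r subr0.
    by rewrite addr0 => /eqP; rewrite mulf_eq0 (negPf xnz) (negPf ynz).
  apply/eqP; apply: contraNT q'q; rewrite mulf_eq0 negb_or.
  move=> /andP[nzx nzy]; have [Epq' Eq'a] := (xc _ _ nzx, yc _ _ nzy).
  have pE : (p, q') \in E by rewrite mem_positions; clear - Epq' Eq'a pq a0 qa;
    lia.
  have qE : (q', a) \in E by rewrite mem_positions; clear - Eq'a a0; lia.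
  have := xlead p q' pE nzx; rewrite leqNgt => xk.
  have := ylead q' a qE nzy; rewrite leqNgt => yk.
  have qq' : c q = c q' by clear - Eq'a qa; lia.
  rewrite -val_eqE /=; case: (ltngtP q' q) => // lt.
    by rewrite (@position_key_col _ c p q q') in xk.
  by rewrite (@position_key_row _ c q a q' a) in yk.
have [[q0 bq] [rq0 b'q]] := (SEP _ _ bS, SEP _ _ b'S).
rewrite c_rev in rq0 b'q; have q0' : c q = 0 by clear - q0 rq0; lia.
suff /andP[/eqP-> ->] : (b == b') && ~~ alt by [].
apply: contraTT isT; rewrite negb_and negbK => nb.
have [x xU [/mem_form xJ xc xnz xlead]] := lead b q bS.
have [y yU [/mem_form yJ yc ynz ylead]] := lead b' (rev_ord q) b'S.
have brk := Uab x y xU yU; clear U Ug Uab SE lead xU yU.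
pose G q' := x b q' * y b' (rev_ord q') / kap q'.
pose H q' := y b q' * x b' (rev_ord q') / kap q'.
have sumGH : \sum_q' G q' = \sum_q' H q'.
  have := brk => /(congr1 (fun A : 'M_n => A b (rev_ord b'))).
  rewrite lie_entry mxE.
  have fromJ z q' : (forall p a,
    z p a * kap p = - (kap a * z (rev_ord a) (rev_ord p))) ->
      z q' (rev_ord b') = - kap (rev_ord b') * (z b' (rev_ord q') / kap q').
    move=> zJ; apply: (mulIf (kap_neq0 q')); rewrite zJ rev_ordK.
    by field; rewrite kap_neq0.
  under eq_bigr => q' _ do rewrite (fromJ x q' xJ) (fromJ y q' yJ).
  have -> : \sum_i (x b i * (- kap (rev_ord b') * (y b' (rev_ord i) / kap i)) -
       y b i * (- kap (rev_ord b') * (x b' (rev_ord i) / kap i))) =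
       - kap (rev_ord b') * (\sum_i G i - \sum_i H i).
    by rewrite -sumrB mulr_sumr; apply: eq_bigr => i _; rewrite /G /H; ring.
  by move/eqP; rewrite mulf_eq0 oppr_eq0 (negPf (kap_neq0 _)) subr_eq0 => /eqP.
have Gq : \sum_q' G q' = G q.
  rewrite (bigD1 q) //= big1 ?addr0 // => q' q'q; apply/eqP.
  apply: contraNT q'q; rewrite /G !mulf_eq0 !negb_or => /andP[/andP[nzx nzy] _].
  have [Eb Eb'] := (xc _ _ nzx, yc _ _ nzy); rewrite c_rev in Eb'.
  have q'0 : c q' = c q by clear - Eb Eb' bq b'q q0'; lia.
  have bE : (b, q') \in E by rewrite mem_positions q'0 -bq q0' !eqxx.
  have b'E : (b', rev_ord q') \in E.
    by rewrite mem_positions c_rev q'0 -b'q q0' !eqxx.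
  have := xlead _ _ bE nzx; rewrite leqNgt => xk.
  have := ylead _ _ b'E nzy; rewrite leqNgt => yk.
  rewrite -val_eqE /=; case: (ltngtP q' q) => // lt.
    by rewrite position_key_col in xk.
  rewrite position_key_col ?c_rev ?q'0 //= in yk; have := ltn_ord q'.
  by clear - lt; lia.
have G0 : G q != 0.
  by rewrite /G !mulf_neq0 ?invr_eq0.
move: sumGH; rewrite Gq; have [bb'|bb'] := eqVneq b b'; last first.
  rewrite big1 => [/eqP|q' _]; first by rewrite (negPf G0).
  rewrite /H; have [lt|lt|/val_inj/eqP] := ltngtP b b';
    last by rewrite (negPf bb').
    have -> : x b' (rev_ord q') = 0; last by rewrite mulr0 mul0r.
    apply/eqP; apply: contraTT isT => nz; have Eq' := xc _ _ nz.
    have q'0 : c (rev_ord q') = c q by clear - Eq' b'q q0'; lia.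
    have b'E : (b', rev_ord q') \in E by rewrite mem_positions Eq' q'0 q0'
      !eqxx.
    by have := xlead _ _ b'E nz; rewrite leqNgt position_key_row.
  have -> : y b q' = 0; last by rewrite !mul0r.
  apply/eqP; apply: contraTT isT => nz; have Eq' := yc _ _ nz.
  have q'0 : c q' = c q by clear - Eq' bq; lia.
  have bE : (b, q') \in E by rewrite mem_positions Eq' q'0 q0' !eqxx.
  by have := ylead _ _ bE nz;
    rewrite leqNgt position_key_row // c_rev q'0 q0' oppr0.
(* For a skew form the two sums reinforce each other instead of cancelling. *)
move: nb; rewrite bb' eqxx /= => altT.
have -> : \sum_q' H q' = - \sum_q' G q'.
  rewrite (reindex_inj rev_ord_inj) -sumrN; apply: eq_bigr => q' _.
  rewrite /H /G rev_ordK kap_rev altT bb' /= expr1 mulN1r invrN mulrN mulrC.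
  by rewrite [_ * y _ _]mulrC mulrC.
by rewrite Gq => /eqP; rewrite -addr_eq0 -mulr2n mulrn_eq0 (negPf G0).
Qed.

End HalfAbelianCriterion.

(** * Ranks of powers and of skew matrices *)

Section MatrixPower.
Variable F : fieldType.

(** Written through right multiplication, whose iterates on row vectors are the
    operators of the [sl_2]-module used below. *)
Definition mxpow n (A : 'M[F]_n) k : 'M[F]_n := iter k (mulmxr A) 1%:M.

Lemma mxpow0 n (A : 'M[F]_n) : mxpow A 0 = 1%:M. Proof. by []. Qed.

Lemma mxpowSr n (A : 'M[F]_n) k : mxpow A k.+1 = mxpow A k *m A.
Proof. by []. Qed.

Lemma mxpowS n (A : 'M[F]_n) k : mxpow A k.+1 = A *m mxpow A k.
Proof.
elim: k => [|k IHk]; first by rewrite mxpowSr mxpow0 mul1mx mulmx1.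
by rewrite mxpowSr {1}IHk -mulmxA -mxpowSr.
Qed.

Lemma iter_mulmxr m n (A : 'M[F]_n) (u : 'M[F]_(m, n)) k :
  iter k (mulmxr A) u = u *m mxpow A k.
Proof.
elim: k => [|k IHk]; first by rewrite mxpow0 mulmx1.
by rewrite iterS IHk mxpowSr mulmxA.
Qed.

Lemma rank_mxpow_drop n (A : 'M[F]_n) k :
  (\rank (mxpow A k) = \rank (mxpow A k.+1) + \rank (mxpow A k :&: kermx A))%N.
Proof. by rewrite mxpowSr; apply/esym/mxrank_mul_ker. Qed.

Lemma mul_mxdiag m (p_ : 'I_m -> nat) (A B : forall i, 'M[F]_(p_ i)) :
  \mxdiag_i A i *m \mxdiag_i B i = \mxdiag_i (A i *m B i).
Proof.
rewrite {2}/mxdiag mul_mxdiag_mxblock; apply: eq_mxblock => i j.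
by case: eqVneq => [ij|_]; [case: _ / ij;
  rewrite !conform_mx_id|rewrite mulmx0].
Qed.

Lemma mxpow_mxdiag m (p_ : 'I_m -> nat) (A : forall i, 'M[F]_(p_ i)) k :
  mxpow (\mxdiag_i A i) k = \mxdiag_i mxpow (A i) k.
Proof.
elim: k => [|k IHk]; first by rewrite mxpow0 -mxdiagZ.
by rewrite mxpowSr IHk mul_mxdiag.
Qed.

Lemma mxpow_jordan p k :
  mxpow (jordan_block F p) k = \matrix_(i, j) ((i + k)%N == j :> nat)%:R.
Proof.
elim: k => [|k IHk]; first by apply/matrixP => i j; rewrite !mxE addn0.
rewrite mxpowSr IHk; apply/matrixP => i j; rewrite !mxE.
have [ikp|ikp] := ltnP (i + k)%N p.
  rewrite (bigD1 (Ordinal ikp)) //= big1 => [|l li];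
    first by rewrite !mxE eqxx mul1r addr0 addnS.
  rewrite !mxE; have /negPf-> : (i + k != l)%N by rewrite eq_sym.
  by rewrite mul0r.
rewrite big1 => [|l _].
  by rewrite (_ : _ == _ = false) //; have := ltn_ord j; lia.
by rewrite !mxE (_ : _ == _ = false) ?mul0r //; have := ltn_ord l; lia.
Qed.

(** The [k]-th power [N] of a block is a shift, so [N N^T] and [N] have the same
    rank as a partial identity. *)
Lemma rank_mxpow_jordan p k : \rank (mxpow (jordan_block F p) k) = (p - k)%N.
Proof.
set N := mxpow _ k.
have NN : N *m N^T = pid_mx (p - k).
  rewrite /N mxpow_jordan; apply/matrixP => i j; rewrite !mxE.
  have [ikp|ikp] := ltnP (i + k)%N p.
    rewrite (bigD1 (Ordinal ikp)) //= big1 => [|l li].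
      rewrite !mxE eqxx mul1r addr0 eqn_add2r eq_sym ltn_subRL addnC ikp andbT.
      by [].
    rewrite !mxE; have /negPf-> : (i + k != l)%N by rewrite eq_sym.
    by rewrite mul0r.
  rewrite big1 => [|l _]; first by rewrite ltn_subRL addnC ltnNge ikp andbF.
  by rewrite !mxE (_ : _ == _ = false) ?mul0r //; have := ltn_ord l; lia.
have N_pid : pid_mx (p - k) *m N = N.
  rewrite /N mxpow_jordan; apply/matrixP => i j; rewrite !mxE.
  rewrite (bigD1 i) //= big1 => [|l li]; last first.
    by rewrite !mxE eq_sym -val_eqE in li *; rewrite (negPf li) mul0r.
  rewrite !mxE eqxx ltn_subRL addnC /= addr0.
  by case: eqP => [ij|_]; rewrite ?mulr0 // ij ltn_ord mulr1.
apply/eqP; rewrite eqn_leq; apply/andP; split.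
  by rewrite -{1}N_pid (leq_trans (mxrankM_maxl _ _)) // rank_pid_mx ?leq_subr.
by rewrite -(@rank_pid_mx F p p (p - k)) ?leq_subr // -NN mxrankM_maxl.
Qed.

Lemma rank_mxpow_partition n (e : 'M[F]_n) s k : jordan_partition e s ->
  \rank (mxpow e k) = (\sum_(p <- s) (p - k))%N.
Proof.
case=> _ _ [P [Pfree Pfull Pe]].
have Pek : P *m mxpow e k = mxpow (jordan_nilp F s) k *m P.
  elim: k => [|k IHk]; first by rewrite !mxpow0 mulmx1 mul1mx.
  by rewrite mxpowSr mulmxA IHk -mulmxA Pe mulmxA -mxpowSr.
rewrite -(eqmxMfull (mxpow e k) Pfull).
rewrite Pek mxrankMfree // mxpow_mxdiag rank_mxdiag.
rewrite (big_nth 0%N) big_mkord; apply: eq_bigr => i _.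
exact: rank_mxpow_jordan.
Qed.

Lemma count_partition (s : seq nat) k :
  (\sum_(p <- s) (p - k) = \sum_(p <- s) (p - k.+1) + count (leq k.+1) s)%N.
Proof.
elim: s => [|p s IHs]; first by rewrite !big_nil.
by rewrite !big_cons IHs /=; case: (ltnP k p); lia.
Qed.

End MatrixPower.

Section SkewRank.
Variable F : numFieldType.

Lemma skew_unit_even r (G : 'M[F]_r) : G^T = - G -> G \in unitmx -> ~~ odd r.
Proof.
move=> Gskew; rewrite unitmxE unitfE => detG.
have := det_tr G; rewrite Gskew -scaleN1r detZ => /eqP.
rewrite -subr_eq0 -{2}[\det G]mul1r -mulrBl mulf_eq0 (negPf detG) orbF.
rewrite -signr_odd; case: (odd r) => //; rewrite expr1 -opprD oppr_eq0.
by rewrite -mulr2n pnatr_eq0.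
Qed.

(** Factoring [A = R^T G R] through its row space gives an invertible skew [G]. *)
Lemma skew_rank_even n (A : 'M[F]_n) : A^T = - A -> ~~ odd (\rank A).
Proof.
move=> Askew.
have [R [Q AQR]] : exists R : 'M[F]_(\rank A, n), exists Q, A *m Q *m R = A.
  by exists (row_base A), (pinvmx (row_base A));
    rewrite mulmxKpV // eq_row_base.
have RQA : R^T *m Q^T *m A = A.
  have := congr1 trmx AQR; rewrite !trmx_mul Askew !mulmxN mulmxA.
  by move/oppr_inj.
pose G := Q^T *m A *m Q.
have AG : A = R^T *m G *m R by rewrite /G !mulmxA RQA AQR.
apply: (@skew_unit_even _ G).
  by rewrite /G !trmx_mul trmxK Askew mulNmx mulmxN mulmxA.
rewrite -row_free_unit /row_free eqn_leq rank_leq_row /=.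
rewrite {1}AG (leq_trans (mxrankM_maxl _ _)) //.
exact: mxrankM_maxr.
Qed.

End SkewRank.

(** * Weights and Jordan blocks *)

Section Sl2Weights.
Variables (F : numFieldType) (n : nat) (e h f : 'M[F]_n).
Hypothesis lie_ef : lie e f = h.
Hypothesis lie_he : lie h e = 2 *: e.
Hypothesis lie_hf : lie h f = - 2 *: f.

(* Right multiplication by [f], [h], [e] makes row vectors an sl_2-module in
   which [f] raises the weights. *)
Lemma row_comm_ef m (v : 'M[F]_(m, n)) :
  mulmxr f (mulmxr e v) - mulmxr e (mulmxr f v) = mulmxr h v.
Proof. by rewrite /= -!mulmxA -mulmxBr -lie_ef. Qed.

Lemma row_comm_hf m (v : 'M[F]_(m, n)) :
  mulmxr h (mulmxr f v) = mulmxr f (mulmxr h v) + 2 *: mulmxr f v.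
Proof.
rewrite /= -!mulmxA scalemxAr -mulmxDr; congr (_ *m _).
by have := lie_hf; rewrite /lie scaleNr => /eqP; rewrite subr_eq addrC
  -subr_eq opprK eq_sym => /eqP.
Qed.

Lemma row_comm_he m (v : 'M[F]_(m, n)) :
  mulmxr h (mulmxr e v) = mulmxr e (mulmxr h v) - 2 *: mulmxr e v.
Proof.
rewrite /= -!mulmxA scalemxAr -mulmxBr; congr (_ *m _).
by have := lie_he; rewrite /lie => <-; rewrite opprB addrC subrK.
Qed.

Section Integrality.
Variables (P : 'M[F]_n) (d : 'I_n -> F).
Hypothesis Pu : P \in unitmx.
Hypothesis Ph : forall i, row i P *m h = d i *: row i P.

(** Weights of eigenvectors are among the finitely many [d j]; hence long strings
    of eigenvectors with distinct weights vanish, which makes [e] and [f]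
    nilpotent. *)
Lemma row_weight (v : 'rV[F]_n) a : v *m h = a *: v -> v != 0 -> exists j,
  a = d j.
Proof.
move=> vh v0; pose u := v *m invmx P.
have vE : v = u *m P by rewrite mulmxKV.
have Phd : P *m h = diag_mx (\row_j d j) *m P.
  by apply/row_matrixP => i;
    rewrite !row_mul Ph row_diag_mx mxE -scalemxAl -rowE.
have ud : u *m diag_mx (\row_j d j) = a *: u.
  apply: (can_inj (mulmxK Pu)); rewrite -mulmxA -Phd mulmxA -vE vh.
  by rewrite -scalemxAl -vE.
have [j uj] : exists j, u 0 j != 0.
  apply/existsP; apply: contraNT v0; rewrite negb_exists => /forallP z.
  rewrite vE; suff -> : u = 0 by rewrite mul0mx.
  by apply/rowP => j; rewrite [RHS]mxE; apply/eqP; rewrite -[_ == _]negbK.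
exists j; apply: (mulIf uj); have := congr1 (fun w : 'rV_n => w 0 j) ud.
by rewrite mul_mx_diag !mxE => <-; rewrite mulrC.
Qed.

Let pigeonhole (g : nat -> F) : injective g -> (forall k, (k <= n)%N ->
  exists j, g k = d j) -> False.
Proof.
move=> ginj gd; suff: (n.+1 <= n)%N by rewrite ltnn.
suff : (size (map g (iota 0 n.+1)) <= size (map d (enum 'I_n)))%N.
  rewrite [X in (X <= _)%N]size_map [X in (_ <= X)%N]size_map size_iota.
  by rewrite -cardE card_ord.
apply: uniq_leq_size.
  by rewrite map_inj_uniq ?iota_uniq.
move=> _ /mapP[k + ->]; rewrite mem_iota add0n ltnS => /= kn.
have [j ->] := gd k kn; by rewrite map_f // mem_enum.
Qed.

Lemma raise_nilpotent (u : 'rV[F]_n) : iter n.+1 (mulmxr f) u = 0.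
Proof.
suff z : P *m mxpow f n.+1 = 0.
  by rewrite iter_mulmxr -(mulmxKV Pu u) -[_ *m P *m _]mulmxA z mulmx0.
apply/row_matrixP => i; rewrite row_mul row0 -iter_mulmxr; apply/eqP.
apply: contraT => nz; exfalso.
pose g k := d i + k.*2%:R.
apply: (@pigeonhole g) => [k l /addrI /eqP|k kn].
  by rewrite eqr_nat => /eqP/double_inj.
apply: (@row_weight (iter k (mulmxr f) (row i P))).
  by have := @weight_raise _ _ (mulmxr f) (mulmxr h) (@row_comm_hf 1) _ _ k (Ph
    i).
apply: contraNneq nz => z; rewrite -(subnK (leqW kn)) iterD z iter_mulmxr.
by rewrite mul0mx.
Qed.

Lemma lower_nilpotent (u : 'rV[F]_n) : iter n.+1 (mulmxr e) u = 0.
Proof.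
suff z : P *m mxpow e n.+1 = 0.
  by rewrite iter_mulmxr -(mulmxKV Pu u) -[_ *m P *m _]mulmxA z mulmx0.
apply/row_matrixP => i; rewrite row_mul row0 -iter_mulmxr; apply/eqP.
apply: contraT => nz; exfalso.
pose g k := d i - k.*2%:R.
apply: (@pigeonhole g) => [k l /addrI/oppr_inj/eqP|k kn].
  by rewrite eqr_nat => /eqP/double_inj.
apply: (@row_weight (iter k (mulmxr e) (row i P))).
  by have := @weight_lower _ _ (mulmxr e) (mulmxr h) (@row_comm_he 1) _ _ k (Ph
    i).
apply: contraNneq nz => z; rewrite -(subnK (leqW kn)) iterD z iter_mulmxr.
by rewrite mul0mx.
Qed.

Lemma sl2_weights_int i : exists z : int, d i = z%:~R.
Proof.
apply: (@weight_int _ _ (mulmxr f) (mulmxr e) (mulmxr h) (@row_comm_ef 1)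
  (@row_comm_hf 1) (@row_comm_he 1) (row i P) (d i) n.+1 n.+1 (Ph i) _
  raise_nilpotent lower_nilpotent).
apply/eqP => r0; have := row_free_unit P; rewrite Pu => /row_freeP[B PB].
have := congr1 (row i) PB; rewrite row_mul r0 mul0mx => /rowP/(_ i)/eqP.
by rewrite !mxE eqxx eq_sym oner_eq0.
Qed.

End Integrality.

End Sl2Weights.

Section WeightMultiplicities.
Variables (F : numFieldType) (n : nat) (c : 'I_n -> int).

Definition weight_mult (j : int) : nat := #|[set i | c i == j]|.

Definition weights_below (j : int) : nat := #|[set i | c i <= j]|.

Lemma weights_below_split j : weights_below j = (weight_mult j + weights_below
  (j - 1))%N.
Proof.
rewrite /weights_below /weight_mult -cardsUI [X in (_ + X)%N](_ : _ = 0%N).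
  by rewrite addn0; apply: eq_card => i; rewrite !inE; lia.
by apply/eqP; rewrite cards_eq0; apply/eqP/setP => i; rewrite !inE; lia.
Qed.

Definition proj_below (j : int) : 'M[F]_n := diag_mx (\row_i (c i <= j)%R%:R).

Lemma rank_proj_below j : \rank (proj_below j) = weights_below j.
Proof.
pose S := [set i | c i <= j]; pose B := rowsub (fun k : 'I_#|S| =>
  enum_val k) (1%:M : 'M[F]_n).
have BBt : B *m B^T = 1%:M.
  apply/matrixP => k l; rewrite !mxE (bigD1 (enum_val k)) //= big1 => [|i ik].
    by rewrite !mxE eqxx mul1r addr0 (inj_eq enum_val_inj) eq_sym.
  by rewrite !mxE eq_sym (negPf ik) mul0r.
have BtB : B^T *m B = proj_below j.
  apply/matrixP => a b; rewrite !mxE.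
  have [aj|aj] := boolP (c a <= j).
    have aS : a \in S by rewrite inE.
    rewrite (bigD1 (enum_rank_in aS a)) //= big1 => [|k ka].
      by rewrite !mxE enum_rankK_in // eqxx mul1r addr0 mulr1n.
    rewrite !mxE; have /negPf-> : enum_val k != a; last by rewrite mul0r.
    apply: contra ka => /eqP ka; apply/eqP/enum_val_inj.
    by rewrite enum_rankK_in.
  rewrite mul0rn big1 // => k _; rewrite !mxE.
  have /negPf-> : enum_val k != a; last by rewrite mul0r.
  by apply: contraNneq aj => <-; have := enum_valP k; rewrite inE.
have rB : \rank B = #|S|.
  by apply/eqP; rewrite -/(row_free _); apply/row_freeP; exists B^T.
rewrite /weights_below -rB; apply/eqP; rewrite eqn_leq -{1}BtB mxrankM_maxr /=.
by rewrite -[B in X in (X <= _)%N]mul1mx -BBt -mulmxA BtB mxrankM_maxr.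
Qed.

End WeightMultiplicities.

Section PartitionWeights.
Variables (F : numFieldType) (n : nat) (c : 'I_n -> int) (e f : 'M[F]_n).
Let h := weight_mx F c.
Hypothesis lie_ef : lie e f = h.
Hypothesis lie_he : lie h e = 2 *: e.
Hypothesis lie_hf : lie h f = - 2 *: f.
Hypothesis c_rev : forall i, c (rev_ord i) = - c i.

Let e_weight i j : e i j != 0 -> c i = c j + 2.
Proof.
move=> nz; have := congr1 (fun A : 'M_n => A i j) lie_he.
rewrite lie_weight_mx [RHS]mxE => /(mulIf nz)/eqP.
by rewrite -[2]/(2%:~R) eqr_int subr_eq addrC => /eqP.
Qed.

(* The scalar by which [f^k e^k] acts, on the right, on the part of [ker e] of
   weight [c i]. *)
Let rising k i : F := \prod_(j < k) (- j.+1%:R * ((c i)%:~R + j%:R)).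

Let raise_lower m (M : 'M[F]_(m, n)) k : M *m e = 0 ->
  M *m mxpow f k *m mxpow e k = M *m diag_mx (\row_i rising k i) /\
  M *m diag_mx (\row_i rising k i) *m e = 0.
Proof.
elim: k M => [|k IHk] M Me.
  have -> : diag_mx (\row_i rising 0 i) = 1%:M.
    by apply/matrixP => i j; rewrite !mxE /rising big_ord0.
  by rewrite !mxpow0 !mulmx1.
pose M' := M *m h + k%:R *: M.
have M'e : M' *m e = 0.
  have := row_comm_he lie_he M; rewrite /= Me mul0mx scaler0 subr0 => Mhe.
  by rewrite mulmxDl -scalemxAl Me scaler0 addr0 -Mhe.
have ME : M *m diag_mx (\row_i rising k.+1 i) =
    - k.+1%:R *: (M' *m diag_mx (\row_i rising k i)).
  have M'E i j : M' i j = M i j * ((c j)%:~R + k%:R).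
    by rewrite /M' /h /weight_mx mul_mx_diag !mxE; ring.
  apply/matrixP => i j; rewrite [in RHS]mxE !mul_mx_diag 2![in LHS]mxE.
  by rewrite [in RHS]mxE M'E mxE /rising big_ord_recr /=; ring.
have [IH1 IH2] := IHk M' M'e; rewrite ME; split; last first.
  by rewrite -scalemxAl IH2 scaler0.
have Mfe : M *m mxpow f k.+1 *m e = - k.+1%:R *: (M' *m mxpow f k).
  rewrite -!iter_mulmxr;
    apply: (@lower_raise _ _ (mulmxr f) (mulmxr e) (mulmxr h)).
  - exact: row_comm_ef.
  - exact: row_comm_hf.
  - exact: Me.
by rewrite (mxpowS e) mulmxA Mfe -scalemxAl IH1.
Qed.

Let rising_neq0 k i : c i <= - k%:Z -> rising k i != 0.
Proof.
move=> ck; apply/prodf_neq0 => j _; rewrite mulf_neq0 ?oppr_eq0 ?pnatr_eq0 //.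
rewrite -[j%:R]/(j%:Z%:~R) -rmorphD /= intr_eq0.
by have := ltn_ord j; lia.
Qed.

Let below k := weights_below c (- k%:Z).

(** [e^k f^k] acts on the vectors of [ker e] of weight at most [-k] by nonzero
    scalars, so all of these vectors lie in the image of [e^k]. *)
Let rank_ker_bound k : (below k <= \rank (mxpow e k :&: kermx e) + below
  k.+2)%N.
Proof.
pose D := proj_below F c (- k%:Z); pose K := (D :&: kermx e)%MS.
pose D2 := proj_below F c (- k.+2%:Z).
have DeD : D *m e = D *m e *m D2.
  apply/matrixP => i j;
    rewrite /D /D2 /proj_below mul_mx_diag !mul_diag_mx !mxE.
  have [->|/e_weight eij] := eqVneq (e i j) 0; first by rewrite mulr0 mul0r.
  have [ci|ci] := boolP (c i <= - k%:Z); last by rewrite !mul0r.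
  have -> : c j <= - k.+2%:Z by clear - eij ci; lia.
  by rewrite -[true%:R]/(1 : F) mulr1.
have rK : (below k <= \rank K + below k.+2)%N.
  rewrite /below -!(rank_proj_below F) -/D -/D2 -(mxrank_mul_ker D e) addnC
    leq_add2l.
  by rewrite DeD mxrankM_maxr.
apply: leq_trans rK _; rewrite leq_add2r.
have Ke : K *m e = 0 by apply/sub_kermxP/capmxSr.
have [Kfe Kqe] := raise_lower k Ke.
pose q' := \row_i (if c i <= - k%:Z then rising k i else 1).
have KD : K *m diag_mx (\row_i rising k i) = K *m diag_mx q'.
  have /submxP[A ->] : (K <= D)%MS by apply: capmxSl.
  rewrite -!mulmxA; congr (_ *m _); apply/matrixP => i j.
  rewrite !mul_mx_diag /D /proj_below !mxE.
  have [->|_] := eqVneq i j; last by rewrite !mulr0n !mul0r.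
  by case: ifP => _ //; rewrite -[false%:R]/(0 : F) mul0rn !mul0r.
have q'u : diag_mx q' \in unitmx.
  rewrite unitmxE det_diag unitfE; apply/prodf_neq0 => i _; rewrite mxE.
  by case: ifP => [/rising_neq0//|_]; rewrite oner_eq0.
have -> : \rank K = \rank (K *m diag_mx q').
  by rewrite mxrankMfree // row_free_unit.
apply: mxrankS; rewrite -KD sub_capmx; apply/andP; split.
  by rewrite -Kfe submxMl.
by apply/sub_kermxP.
Qed.

Let below0 : (below 0 + below 1)%N = n.
Proof.
have -> : below 1 = #|~: [set i | c i <= 0]|.
  rewrite /below /weights_below -(card_imset _ rev_ord_inj); apply: eq_card =>
    i.
  rewrite !inE; apply/imsetP/idP => [[j]|ci]; first by rewrite inE => cj ->;
    rewrite c_rev; lia.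
  by exists (rev_ord i); rewrite ?rev_ordK // inE c_rev; lia.
by rewrite /below /weights_below oppr0 cardsC card_ord.
Qed.

Let big_weight : exists N : nat, forall i, - (N%:Z) < c i.
Proof.
exists (\max_i `|c i|%N).+1 => i.
by have := leq_bigmax (F := fun i => `|c i|%N) i; lia.
Qed.

(* The lower bounds of [rank_ker_bound] for [dim (im e^k :&: ker e)], summed over
   all [k], already add up to [n], and so do the dimensions, by telescoping the
   ranks of the powers of [e]. *)
Let rank_ker_eq k : below k = (\rank (mxpow e k :&: kermx e) + below k.+2)%N.
Proof.
have [N0 N0c] := big_weight; pose N := maxn N0 k.+1.
have belowN l : (N <= l)%N -> below l = 0%N.
  move=> Nl; apply/eqP; rewrite cards_eq0; apply/eqP/setP => i; rewrite !inE.
  by have := N0c i; rewrite /N in Nl; lia.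
pose a l := \rank (mxpow e l :&: kermx e).
have sum_a M : (\sum_(l < M) a l + \rank (mxpow e M) = n)%N.
  elim: M => [|M IHM]; first by rewrite big_ord0 mxpow0 mxrank1.
  by move: IHM (rank_mxpow_drop e M); rewrite big_ord_recr /= /a; lia.
have sum_b M : (below 0 + below 1 = \sum_(l < M) (below l - below l.+2) + (below
  M + below M.+1))%N.
  elim: M => [|M IHM]; first by rewrite big_ord0.
  rewrite big_ord_recr /= IHM.
  have : (below M.+2 <= below M)%N.
    by apply: subset_leq_card; apply/subsetP => i; rewrite !inE; lia.
  by move: (\sum_(_ < _) _)%N (below M) (below M.+1) (below M.+2) => *; lia.
have := sum_b N; rewrite below0 (belowN N) // (belowN N.+1) // !addn0 => sumE.
have le_ba l : (below l - below l.+2 <= a l)%N.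
  by have := rank_ker_bound l; rewrite /a; lia.
have kN : (k < N)%N by rewrite leq_maxr.
have le_sum : (\sum_(l < N | l != Ordinal kN) (below l - below l.+2) <=
    \sum_(l < N | l != Ordinal kN) a l)%N by apply: leq_sum.
move: (etrans (sum_a N) sumE);
  rewrite (bigD1 (Ordinal kN)) //= [in RHS](bigD1 (Ordinal kN)) //=.
have := rank_ker_bound k; have := le_ba k; rewrite /a.
have : (below k.+2 <= below k)%N.
  by apply: subset_leq_card; apply/subsetP => i; rewrite !inE; lia.
move: (\sum_(_ < _ | _) a _)%N le_sum => A; move: (\sum_(_ < _ | _) _)%N => B.
move: (below k) (below k.+2) (\rank _) (\rank _) => *; lia.
Qed.

Lemma weight_mult_opp j : weight_mult c (- j) = weight_mult c j.
Proof.
rewrite /weight_mult -(card_imset _ rev_ord_inj); apply: eq_card => i.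
rewrite !inE; apply/imsetP/eqP => [[l]|ci].
  by rewrite inE => /eqP cl ->; rewrite c_rev cl opprK.
by exists (rev_ord i); rewrite ?rev_ordK // inE c_rev ci.
Qed.

Let below_split k : below k = (weight_mult c k%:Z + below k.+1)%N.
Proof.
rewrite /below weights_below_split weight_mult_opp.
by congr (_ + weights_below _ _)%N; lia.
Qed.

(** The number of parts larger than [k] is [rank e^k - rank e^(k+1)], that is
    [dim (im e^k :&: ker e)], known from the weights. *)
Lemma weight_mult_count s k : jordan_partition e s ->
  weight_mult c k%:Z = (weight_mult c k.+2%:Z + count_mem k.+1 s)%N.
Proof.
move=> hs; have count_ge l : below l = (count (leq l.+1) s + below l.+2)%N.
  rewrite rank_ker_eq; congr (_ + _)%N; apply: (@addnI (\rank (mxpow e l.+1))).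
  by rewrite -rank_mxpow_drop !(rank_mxpow_partition _ hs) count_partition.
have := count_ge k; have := count_ge k.+1.
have -> : count (leq k.+1) s = (count_mem k.+1 s + count (leq k.+2) s)%N.
  elim: (s) => //= p t ->; rewrite eq_sym; lia.
rewrite (below_split k) (below_split k.+1) (below_split k.+2); lia.
Qed.

Let rank_mxpow_weights k : \rank (mxpow e k) = (below k + below k.+1)%N.
Proof.
elim: k => [|k IHk]; first by rewrite mxpow0 mxrank1 below0.
have := rank_mxpow_drop e k; rewrite IHk (rank_ker_eq k); lia.
Qed.

(** [J e^k] is skew when [alt + k] is odd, and then its rank
    [dim V_k + 2 dim V_(>k)] is even. *)
Lemma weight_mult_even (J : 'M[F]_n) (alt : bool) k : J \in unitmx ->
  J^T = (-1) ^+ alt *: J -> e \in form_lie J -> odd (alt + k) ->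
  ~~ odd (weight_mult c k%:Z).
Proof.
move=> Ju Jsym /form_lieP Je altk.
have Jek : (J *m mxpow e k)^T = - (J *m mxpow e k).
  have ek : (mxpow e k)^T *m J = (-1) ^+ k *: (J *m mxpow e k).
    elim: {altk} k => [|k IHk];
      first by rewrite mxpow0 trmx1 mul1mx mulmx1 scale1r.
    rewrite {1}mxpowSr trmx_mul -mulmxA IHk -scalemxAr mulmxA Je mulNmx -mulmxA.
    by rewrite -mxpowS exprS mulN1r scaleNr scalerN.
  rewrite trmx_mul Jsym -scalemxAr ek scalerA -exprD -signr_odd altk.
  by rewrite expr1 scaleN1r.
have := skew_rank_even Jek.
rewrite (eqmxMfull _ (_ : row_full J)) ?row_full_unit // rank_mxpow_weights.
by rewrite (below_split k); lia.
Qed.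

End PartitionWeights.

(** * Weight vectors and simple roots *)

Section LieAlgebra.
Variables (F : numFieldType) (n : nat).
Implicit Types (x y z : 'M[F]_n) (W : {vspace 'M[F]_n}).

Lemma lie_jacobi x y z : lie x (lie y z) = lie (lie x y) z + lie y (lie x z).
Proof.
rewrite /lie !(mulmxBl, mulmxBr) !mulmxA !opprB.
apply/matrixP => i j; rewrite !mxE; ring.
Qed.

Lemma lieDr x y z : lie x (y + z) = lie x y + lie x z.
Proof. by rewrite -!adE linearD. Qed.

Lemma lieZr a x y : lie x (a *: y) = a *: lie x y.
Proof. by rewrite -!adE linearZ. Qed.

Lemma lie0r x : lie x 0 = 0. Proof. by rewrite -adE linear0. Qed.

Lemma lieN x y : lie y x = - lie x y.
Proof. by rewrite /lie opprB. Qed.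

Lemma lieZl a x y : lie (a *: x) y = a *: lie x y.
Proof. by rewrite lieN lieZr -scalerN -lieN. Qed.

Lemma lieDl x y z : lie (x + y) z = lie x z + lie y z.
Proof. by rewrite lieN lieDr opprD -!lieN. Qed.

Lemma lie0l x : lie 0 x = 0. Proof. by rewrite lieN lie0r oppr0. Qed.

Lemma lie_sumr x (zs : seq 'M[F]_n) : lie x (\sum_(z <- zs) z) = \sum_(z <- zs)
  lie x z.
Proof. by apply: (big_morph (lie x)) => [y z|]; rewrite ?lieDr ?lie0r. Qed.

Lemma lie_suml x (zs : seq 'M[F]_n) : lie (\sum_(z <- zs) z) x = \sum_(z <- zs)
  lie z x.
Proof. by rewrite lieN lie_sumr -sumrN; apply: eq_bigr => z _;
  rewrite -lieN. Qed.

(** Applying [ad y - b] removes the component of weight [b] and rescales the other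
    ones, whence the induction on the number of components. *)
Lemma eigencomponents_stable W y (L : seq F) (z : F -> 'M[F]_n) : uniq L ->
  {in W, forall x, lie y x \in W} -> (forall a, lie y (z a) = a *: z a) ->
  \sum_(a <- L) z a \in W -> forall a, a \in L -> z a \in W.
Proof.
move=> uL Wy; elim: L z uL => [//|b L IHL] z /= /andP[bL uL] zy.
rewrite big_cons => sumW.
have zW a : a \in L -> z a \in W.
  move=> aL; have ab : a - b != 0 by rewrite subr_eq0; apply: contraNneq bL =>
    <-.
  have -> : z a = (a - b)^-1 *: ((a - b) *: z a) by rewrite scalerA mulVf
    ?scale1r.
  apply: memvZ; apply: (IHL (fun a => (a - b) *: z a) uL _ _ a aL) => [c|].
    by rewrite lieZr zy !scalerA mulrC.
  have -> : \sum_(c <- L) (c - b) *: z c =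
      lie y (z b + \sum_(c <- L) z c) - b *: (z b + \sum_(c <- L) z c).
    rewrite lieDr zy scalerDr opprD addrACA subrr add0r.
    rewrite (big_morph (lie y) (lieDr y) (lie0r y)) scaler_sumr -sumrB.
    by apply: eq_bigr => c _; rewrite zy scalerBl.
  by rewrite rpredB ?memvZ // Wy.
move=> a; rewrite inE => /predU1P[->|/zW//].
have -> : z b = z b + \sum_(c <- L) z c - \sum_(c <- L) z c by rewrite addrK.
by rewrite rpredB // big_seq rpred_sum.
Qed.

Lemma eigen_decomposition W y x : diagonalizable y ->
  {in W, forall x, lie y x \in W} -> x \in W ->
  exists zs : seq 'M[F]_n, x = \sum_(z <- zs) z /\
    forall z, z \in zs -> z \in W /\ exists a, lie y z = a *: z.
Proof.
case=> P Pu /diagonalizable_forPex[d /(simmxLR Pu) yE] Wy xW.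
have yE' : conj_end P y = diag_mx d.
  by rewrite yE conj_endE mxpoly.conjVmx // !mulmxA mulmxV // mul1mx mulmxK.
pose x' := conj_end P x.
pose z (a : F) := conj_end (invmx P)
  (\matrix_(i, j) if d 0 i - d 0 j == a then x' i j else 0).
have zy a : lie y (z a) = a *: z a.
  rewrite -[y](conj_endK Pu) yE' /z -conj_end_lie ?unitmx_inv // -linearZ /=.
  congr (conj_end _ _); apply/matrixP => i j.
  rewrite /lie mul_diag_mx mul_mx_diag !mxE.
  by case: eqP => [<-|_]; [ring | rewrite mulr0 mul0r subr0 mulr0].
pose L := undup [seq d 0 ij.1 - d 0 ij.2 | ij <- enum [set: 'I_n * 'I_n]].
have xE : x = \sum_(a <- L) z a.
  rewrite -[x](conj_endK Pu) -/x' /z -linear_sum /=; congr (conj_end _ _).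
  apply/matrixP => i j; rewrite summxE.
  have ijL : d 0 i - d 0 j \in L.
    by rewrite mem_undup; apply/mapP; exists (i, j); rewrite ?mem_enum ?inE.
  rewrite (bigD1_seq _ ijL) ?undup_uniq //= mxE eqxx big1 ?addr0 // => a ne.
  by rewrite mxE eq_sym (negPf ne).
exists [seq z a | a <- L]; split; first by rewrite big_map.
move=> _ /mapP[a aL ->]; split; last by exists a.
by apply: (eigencomponents_stable (undup_uniq _) Wy zy _ aL); rewrite -xE.
Qed.

(** The subspace is kept general because the induction splits it into the
    eigenspaces of the first matrix, which the other ones preserve. *)
Lemma weight_decomposition (ys : seq 'M[F]_n) W x :
  {in ys, forall y, diagonalizable y} -> {in ys &, forall y y', lie y y' = 0} ->
  {in ys & W, forall y x, lie y x \in W} -> x \in W ->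
  exists zs : seq 'M[F]_n, x = \sum_(z <- zs) z /\
    forall z, z \in zs -> z \in W /\ forall y, y \in ys -> exists a,
      lie y z = a *: z.
Proof.
elim: ys W x => [|y ys IHys] W x ydiag ycomm Wys xW.
  by exists [:: x]; rewrite big_seq1; split=> // z; rewrite inE => /eqP->.
have [||zs [xE zsP]] := @eigen_decomposition W y x _ _ xW.
- by apply: ydiag; rewrite mem_head.
- by move=> u uW; apply: Wys; rewrite ?mem_head.
have {}zsP z : z \in zs -> exists us : seq 'M[F]_n, z = \sum_(u <- us) u /\
    forall u, u \in us -> u \in W /\ forall y', y' \in y :: ys -> exists a,
      lie y' u = a *: u.
  move=> /zsP[zW [a yz]].
  pose Wa := (W :&: lker (ad y - a *: \1%VF))%VS.
  have memWa u : (u \in Wa) = (u \in W) && (lie y u == a *: u).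
    by rewrite memv_cap memv_ker add_lfunE opp_lfunE scale_lfunE id_lfunE adE
      subr_eq0.
  have [||||us [zE usP]] := IHys Wa z.
  - by move=> y' y'ys; apply: ydiag; rewrite inE y'ys orbT.
  - by move=> y1 y2 y1ys y2ys; apply: ycomm; rewrite inE ?y1ys ?y2ys orbT.
  - move=> y' u y'ys; rewrite !memWa => /andP[uW /eqP yu].
    rewrite Wys ?inE ?y'ys ?orbT //= lie_jacobi (ycomm y y') ?inE ?eqxx ?y'ys
      ?orbT //.
    by rewrite yu lieZr lie0l add0r.
  - by rewrite memWa zW yz eqxx.
  exists us; split=> // u /usP[]; rewrite memWa => /andP[uW /eqP yu] uys.
  by split=> // y'; rewrite inE => /predU1P[->|/uys//]; exists a.
rewrite xE; elim: zs zsP {xE} => [|z zs IHzs] zsP.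
  by exists [::]; rewrite !big_nil.
have [us [zE usP]] := zsP z (mem_head _ _).
have [u zzs|vs [vsE vsP]] := IHzs; first by apply: zsP; rewrite inE zzs orbT.
exists (us ++ vs); rewrite big_cons big_cat /= zE vsE; split=> // u.
by rewrite mem_cat => /orP[/usP|/vsP].
Qed.

End LieAlgebra.

Section Roots.
Variables (F : numFieldType) (n : nat) (g t : {vspace 'M[F]_n}).
Implicit Types x y z : 'M[F]_n.

(** If [z] is a common eigenvector of [t], any nonzero entry of [z] reads off its
    weight, and this expression is visibly linear. *)
Definition eigenform z i j (y : subvs_of t) : F^o :=
  lie (vsval y) z i j / z i j.

Fact eigenform_is_linear z i j : linear (eigenform z i j).
Proof.
move=> a x y; rewrite /eigenform linearP /= lieDl lieZl !mxE mulrDl.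
by rewrite -mulrA.
Qed.

HB.instance Definition _ z i j :=
  GRing.isLinear.Build F (subvs_of t) F^o _ (eigenform z i j)
    (eigenform_is_linear z i j).

Lemma weight_form z : z != 0 ->
  (forall y, y \in (vbasis t : seq _) -> exists a, lie y z = a *: z) ->
  exists gamma : dual t, forall y : subvs_of t,
    lie (vsval y) z = (gamma y : F) *: z.
Proof.
move=> z0 zy; have [i [j zij]] : exists i j, z i j != 0.
  have [/existsP[i /existsP[j]]|] := boolP [exists i, exists j, z i j != 0].
    by exists i, j.
  rewrite negb_exists => /forallP no; case/negP: z0; apply/eqP/matrixP => i j.
  by have := no i; rewrite negb_exists => /forallP/(_ j); rewrite negbK mxE =>
    /eqP.
exists (linfun (eigenform z i j)) => y; rewrite lfunE /= /eigenform.
suff [a ->] : exists a, lie (vsval y) z = a *: z by rewrite !mxE mulfK.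
rewrite (coord_vbasis (valP y)).
elim/big_ind: _ => [|x1 x2 [a1 xa1] [a2 xa2]|k _].
- by exists 0; rewrite lie0l scale0r.
- by exists (a1 + a2); rewrite lieDl xa1 xa2 scalerDl.
- have [|a za] := zy (vbasis t)`_k; first by rewrite mem_nth ?size_tuple.
  by exists (coord (vbasis t) k (val y) * a); rewrite lieZl za scalerA.
Qed.

Variables (m : nat) (Delta : m.-tuple (dual t)) (w : 'I_m -> F) (h : 'M[F]_n).
Hypothesis g_lie : {in g &, forall x y, lie x y \in g}.
Hypothesis gt_cartan : cartan g t.
Hypothesis ht : h \in t.
Hypothesis gt_base : root_base g Delta.
Hypothesis w_ge0 : forall i, 0 <= w i.
Hypothesis w_label : forall i, tnth Delta i (vsproj t h) = w i.

Let tg y : y \in t -> y \in g.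
Proof. by case: gt_cartan => /subvP tg _ _; apply: tg. Qed.

Let t_comm : {in t &, forall x y, lie x y = 0}.
Proof.
case: gt_cartan => _ _ tP x y xt yt.
by have [H _] := tP x (tg xt); apply: H.
Qed.

Lemma label_root_vector i : exists x, [/\ x \in g, x != 0,
  lie h x = w i *: x & forall y : subvs_of t,
    lie (vsval y) x = (tnth Delta i y : F) *: x].
Proof.
have [_ /(_ i)[_ [x [xg x0 xy]]] _] := gt_base.
exists x; split=> //; have := xy (vsproj t h); rewrite vsprojK // => ->.
by congr (_ *: _); apply: w_label.
Qed.

(** The simple roots span the dual of the Cartan subalgebra. *)
Lemma simple_roots_separate z : z \in t ->
  (forall i, tnth Delta i (vsproj t z) = 0) -> z = 0.
Proof.
move=> zt Dz; rewrite -(vsprojK zt).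
have all0 (phi : dual t) : phi (vsproj t z) = 0.
  have [bD _ _] := gt_base; rewrite (coord_basis bD (memvf phi)).
  rewrite sum_lfunE big1 // => i _; rewrite scale_lfunE.
  by rewrite -tnth_nth Dz scaler0.
suff -> : vsproj t z = 0 by [].
rewrite (coord_vbasis (memvf (vsproj t z))) big1 // => k _.
have := all0 (linfun (coord (vbasis fullv) k : subvs_of t -> F^o)).
by rewrite lfunE /= => ->; rewrite scale0r.
Qed.

Variables (e f : 'M[F]_n).
Hypothesis ehf : sl2_triple g e h f.
Hypothesis e_nilp : lie_nilpotent g e.

(** A vector of positive weight killed by [f] would be a lowest weight vector. *)
Lemma lie_lower_neq0 x a : x \in g -> x != 0 -> lie h x = a *: x -> 0 < a ->
  lie f x != 0.
Proof.
move=> xg x0 hx a0; apply/eqP => fx0.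
have [_ ef he hf] := ehf; have [_ [N eN]] := e_nilp.
have comm_ef v : ad e (ad f v) - ad f (ad e v) = ad h v.
  by rewrite !adE lie_jacobi ef addrK.
have comm_he v : ad h (ad e v) = ad e (ad h v) + 2 *: ad e v.
  by rewrite !adE lie_jacobi he lieZl addrC.
have [||k ak] := @lowest_weight F _ (ad e) (ad f) (ad h) comm_ef comm_he x a N _
  _ x0 (eN x xg).
- by rewrite -[LHS]/(ad f x) adE.
- by rewrite -[LHS]/(ad h x) adE.
by move: a0; rewrite ak oppr_gt0 ltrn0.
Qed.

Let label_natcomb (c : 'I_m -> nat) :
  0 <= (\sum_i tnth Delta i *+ c i : dual t) (vsproj t h) :> F.
Proof.
rewrite sum_lfunE; apply: sumr_ge0 => i _.
by rewrite -scaler_nat scale_lfunE w_label mulr_ge0 ?ler0n.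
Qed.

(** Labels are at most [2]: [f] moves a root vector of a simple root [alpha] with
    larger label to weight vectors [(alpha + gamma)] with [gamma] a weight of [f];
    as [(alpha + gamma)(h)] is positive and [gamma(h) = -2], this would write
    [alpha] as a sum of two positive roots. *)
Lemma label_le2 i : ~ (2 < w i).
Proof.
move=> w2; have [x [xg x0 hx xy]] := label_root_vector i.
have w0 : 0 < w i by apply: lt_trans w2.
have fx0 := lie_lower_neq0 xg x0 hx w0.
have [[eg hg fg] ef he hf] := ehf.
have [_ tdiag _] := gt_cartan.
pose W := grading g h (- 2).
have memW z : (z \in W) = (z \in g) && (lie h z == - 2 *: z).
  by rewrite mem_grading rmorphN.
have [||||zs [fE zsP]] := @weight_decomposition F n (vbasis t) W f.
- by move=> y yt; apply/tdiag/vbasis_mem.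
- by move=> y y' yt y't; apply: t_comm; apply: vbasis_mem.
- move=> y z /vbasis_mem yt; rewrite !memW => /andP[zg /eqP hz].
  by rewrite g_lie ?(tg yt) //= lie_jacobi (t_comm ht yt) lie0l add0r hz lieZr.
- by rewrite memW fg hf eqxx.
have [z zzs zx0] : exists2 z, z \in zs & lie z x != 0.
  apply/hasP; apply: contraNT fx0 => /hasPn no; rewrite fE lie_suml.
  by rewrite big_seq big1 // => z /no; rewrite negbK => /eqP.
have [zW zy] := zsP z zzs; move: zW; rewrite memW => /andP[zg /eqP hz].
have z0 : z != 0 by apply: contraNneq zx0 => ->; rewrite lie0l.
have [gamma gammaP] := weight_form z0 zy.
pose beta : dual t := gamma + tnth Delta i.
have betaP (y : subvs_of t) : lie (vsval y) (lie z x) = (beta y : F) *: lie z x.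
  by rewrite lie_jacobi gammaP xy lieZl lieZr -scalerDl add_lfunE.
have gh : gamma (vsproj t h) = - 2 :> F.
  have := gammaP (vsproj t h); rewrite vsprojK // hz => /eqP.
  by rewrite eq_sym -subr_eq0 -scalerBl scaler_eq0 (negPf z0) orbF subr_eq0 =>
    /eqP.
have bh : beta (vsproj t h) = w i - 2 :> F by rewrite add_lfunE gh w_label
  addrC.
have w2' : 0 < w i - 2 by rewrite subr_gt0.
have [basisD _ posD] := gt_base.
have gamma_root : is_root g gamma.
  split; last by exists z.
  apply: contraTneq isT => gamma0; have /eqP := gh.
  by rewrite gamma0 zero_lfunE eq_sym oppr_eq0 pnatr_eq0.
have beta_root : is_root g beta.
  split; last by exists (lie z x); split=> //; apply: g_lie.
  apply: contraTneq isT => beta0; have /eqP := bh.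
  by rewrite beta0 zero_lfunE => /eqP b0; move: w2'; rewrite -b0 ltxx.
have [c [gammaE|gammaE]] := posD gamma gamma_root.
  by have := label_natcomb c; rewrite -gammaE gh oppr_ge0 lern0.
have [c' [betaE|betaE]] := posD beta beta_root; last first.
  have := label_natcomb c'.
  have -> : (\sum_j tnth Delta j *+ c' j : dual t) = - beta by rewrite betaE
    opprK.
  by rewrite opp_lfunE bh oppr_ge0 => /(lt_le_trans w2'); rewrite ltxx.
have sumE : \sum_j ((c j + c' j)%:R - (j == i)%:R) *: Delta`_j = 0.
  have -> : \sum_j ((c j + c' j)%:R - (j == i)%:R) *: Delta`_j =
      \sum_j tnth Delta j *+ c j + \sum_j tnth Delta j *+ c' j - tnth Delta i.
    rewrite -big_split /= [X in _ - X](_ : _ = \sum_j (j == i)%:R *: tnth Delta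
      j).
      rewrite -sumrB; apply: eq_bigr => j _.
      by rewrite scalerBl natrD scalerDl !scaler_nat (tnth_nth 0).
    rewrite (bigD1 i) //= eqxx scale1r big1 ?addr0 // => j /negPf->.
    by rewrite scale0r.
  by rewrite -betaE -[\sum_j _ *+ c j]opprK -gammaE /beta addrA addNr add0r
    subrr.
have /freeP/(_ _ sumE) coef := basis_free basisD.
have cE j : (c j + c' j)%N = (j == i).
  by apply/eqP; rewrite -(eqr_nat F) -subr_eq0 coef.
have [ci|ci] := posnP (c i).
  move: gh; rewrite gammaE big1 => [|j _].
    by rewrite oppr0 zero_lfunE => /eqP; rewrite eq_sym oppr_eq0 pnatr_eq0.
  by have := cE j; case: eqVneq => [->|_]; [rewrite ci mulr0n | case: (c j)].
move: bh; rewrite betaE big1 => [|j _].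
  by rewrite zero_lfunE => b0; move: w2'; rewrite -b0 ltxx.
suff -> : c' j = 0%N by rewrite mulr0n.
by have := cE j; case: eqVneq => [->|_] /=; move: ci; clear; lia.
Qed.

End Roots.

(** * Weights of a strictly odd nilpotent *)

Section NoGap.
Variables (F : numFieldType) (n : nat) (J e h f P : 'M[F]_n) (c : 'I_n -> int).
Hypothesis ehf : sl2_triple (form_lie J) e h f.
Hypothesis e_nilp : lie_nilpotent (form_lie J) e.
Hypothesis Pu : P \in unitmx.
Hypothesis hE : conj_end P h = weight_mx F c.
Hypothesis Janti : antidiagonal (conj_form P J).
Hypothesis c_rev : forall i, c (rev_ord i) = - c i.

Let conj_back x : conj_end P (conj_end (invmx P) x) = x.
Proof. by rewrite -{1}(invmxK P) conj_endK ?unitmx_inv. Qed.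

Let weight_mx_form (s : 'I_n -> int) : (forall i, s (rev_ord i) = - s i) ->
  conj_end (invmx P) (weight_mx F s) \in form_lie J.
Proof.
move=> s_rev; rewrite -(conj_formK J Pu); apply: conj_form_lie;
  rewrite ?unitmx_inv //.
apply/form_lieP; move: (conj_form P J) Janti => A Aanti; apply/matrixP => i j.
rewrite /weight_mx tr_diag_mx mul_diag_mx mul_mx_diag !mxE.
have [->|] := eqVneq (A i j) 0; first by rewrite mulr0 mul0r oppr0.
by rewrite Aanti => /eqP->; rewrite s_rev rmorphN; ring.
Qed.

(** Simple root vectors have degree [0] or [1], so when the weight [j] does not
    occur the sign of the weights beyond [j] is an element of the Cartan
    subalgebra on which every simple root vanishes. *)
Lemma strictly_odd_no_gap : strictly_odd (form_lie J) h ->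
  exists mu : nat, [/\ (0 < mu)%N, forall i, c i <= mu%:Z &
    forall j : nat, (j <= mu)%N -> (0 < weight_mult c j)%N].
Proof.
case=> m [w [[t [Delta [tcart ht tbase wP]]] [not_even not2]]].
have w_ge0 i : 0 <= w i by have [] := wP i.
have w_label i : tnth Delta i (vsproj t h) = w i by have [] := wP i.
have g_lie : {in form_lie J &, forall x y, lie x y \in form_lie J}.
  exact: form_lie_lie.
have root_entry i : exists x p a, [/\ w i = (c p - c a)%:~R,
  conj_end P x p a != 0 &
    forall y : subvs_of t, lie (vsval y) x = (tnth Delta i y : F) *: x].
  have [x [xg x0 hx xy]] := label_root_vector ht tbase w_label i.
  have : conj_end P x != 0.
    by apply: contraNneq x0 => x'0; rewrite -(conj_endK Pu x) x'0 linear0.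
  have [/existsP[p /existsP[a nz]] _|] := boolP [exists p, exists a,
    conj_end P x p a != 0].
    exists x, p, a; split=> //.
    have := congr1 (fun A => conj_end P A p a) hx.
    by rewrite conj_end_lie // hE lie_weight_mx linearZ mxE => /(mulIf nz).
  rewrite negb_exists => /forallP no /negP[]; apply/eqP/matrixP => p a.
  by have := no p; rewrite negb_exists => /forallP/(_ a); rewrite negbK mxE =>
    /eqP.
have label01 i p a : w i = (c p - c a)%:~R -> c p - c a = 0 \/ c p - c a = 1.
  move=> wE; have := w_ge0 i; have := not2 i.
  have := label_le2 g_lie tcart ht tbase w_ge0 w_label ehf e_nilp (i := i).
  rewrite wE -[2]/(2%:~R) ltr_int ler0z => le2 /eqP; rewrite eqr_int => ne2 ge0.
  by lia.
pose mu := \max_(i | 0 <= c i) `|c i|%N.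
have cmu i : c i <= mu%:Z.
  have [ci|ci] := boolP (0 <= c i); last by lia.
  have := @leq_bigmax_cond _ (fun i => 0 <= c i) (fun i => `|c i|%N) i ci;
    rewrite -/mu; lia.
have mu0 : (0 < mu)%N.
  rewrite lt0n; apply/eqP => mu0; apply: not_even => i.
  have [x [p [a [-> _ _]]]] := root_entry i.
  have := cmu p; have := cmu a; have := cmu (rev_ord p); have :=
    cmu (rev_ord a).
  rewrite mu0 !c_rev => *; have -> : c p - c a = 0 by lia.
  by move/eqP; rewrite eq_sym oner_eq0.
have [itop /eqP ctop] : exists i, c i == mu%:Z.
  apply/existsP; apply: contraLR mu0; rewrite negb_exists => /forallP no.
  have : (mu <= mu.-1)%N.
    by apply/bigmax_leqP => i ci; have := cmu i; have := no i; lia.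
  lia.
have no_gap (j : nat) : (j < mu)%N -> (0 < weight_mult c j)%N.
  move=> jmu; rewrite lt0n; apply/eqP => nj.
  have cj i : c i != j%:Z.
    apply: contraTneq isT => ci; have /eqP := nj; rewrite cards_eq0.
    by move=> /eqP/setP/(_ i); rewrite !inE ci eqxx.
  have cj' i : c i != - j%:Z by rewrite -(inj_eq oppr_inj) -c_rev opprK cj.
  pose s i : int := if j%:Z < c i then 1 else if c i < - j%:Z then -1 else 0.
  have s_rev i : s (rev_ord i) = - s i by rewrite /s c_rev; do ?case: ifP => ?;
    lia.
  pose z := conj_end (invmx P) (weight_mx F s).
  have zE : conj_end P z = weight_mx F s by rewrite /z conj_back.
  have zg : z \in form_lie J by apply: weight_mx_form.
  have zt : z \in t.
    have [/subvP tg _ tP] := tcart; apply/(tP z zg) => y yt.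
    have hy : lie h y = 0 by have [H _] := tP h (tg h ht); apply: H.
    rewrite -(conj_endK Pu (lie z y)) conj_end_lie // zE.
    suff -> : lie (weight_mx F s) (conj_end P y) = 0 by rewrite linear0.
    apply/matrixP => p a; rewrite lie_weight_mx mxE.
    have := congr1 (fun A => conj_end P A p a) hy.
    rewrite conj_end_lie // hE linear0 lie_weight_mx mxE => /eqP.
    rewrite mulf_eq0 => /orP[|/eqP->]; last by rewrite mulr0.
    rewrite intr_eq0 subr_eq0 => /eqP cpa.
    by rewrite /s cpa subrr mul0r.
  have z0 : z = 0.
    apply: (simple_roots_separate tbase zt) => i.
    have [x [p [a [wE nz xy]]]] := root_entry i.
    have := xy (vsproj t z); rewrite vsprojK // => /(congr1 (fun A =>
      conj_end P A p a)).
    rewrite conj_end_lie // zE lie_weight_mx linearZ mxE => /(mulIf nz) <-.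
    have := label01 i p a wE; have := cj a; have := cj' p.
    suff H : c p != - j%:Z -> c a != j%:Z -> c p - c a = 0 \/ c p - c a = 1 ->
      s p = s a.
      by move=> *; rewrite H // subrr.
    by rewrite /s; clear; do ?case: ifP => ?; lia.
  have s0 i : s i = 0.
    have := congr1 (fun A : 'M_n => A i i) zE;
      rewrite z0 linear0 !mxE eqxx mulr1n.
    by move/esym/eqP; rewrite intr_eq0 => /eqP.
  by have := s0 itop; rewrite /s ctop ltz_nat jmu.
exists mu; split=> // j; rewrite leq_eqVlt => /predU1P[->|/no_gap//].
by apply/card_gt0P; exists itop; rewrite inE ctop.
Qed.

End NoGap.

(** * The extremal inequality *)

Section AbelSummation.
Variable R : realFieldType.

Lemma abel_summation (p v : nat -> R) m :
  \sum_(j < m.+1) p j * v j =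
  \sum_(k < m) (\sum_(j < k.+1) v j) * (p k - p k.+1) + (\sum_(j < m.+1) v j) *
    p m.
Proof.
elim: m => [|m IHm]; first by rewrite big_ord0 !big_ord1 add0r mulrC.
rewrite big_ord_recr /= IHm [in RHS]big_ord_recr /= [\sum_(j < m.+2) v
  j]big_ord_recr /=.
by ring.
Qed.

(** By Abel summation the weighted sum is a sum of nonpositive terms, each of which
    must vanish. *)
Lemma weighted_sum_eq0 (p v : nat -> R) m :
  (forall j, (j <= m)%N -> 0 < p j) -> (forall j, (j < m)%N -> p j.+1 <= p j) ->
  (forall k, (k <= m)%N -> \sum_(j < k.+1) v j <= 0) ->
  0 <= \sum_(j < m.+1) p j * v j ->
  \sum_(j < m.+1) v j = 0 /\
  forall k, (k < m)%N -> \sum_(j < k.+1) v j = 0 \/ p k = p k.+1.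
Proof.
move=> p0 p_le T_le; rewrite abel_summation => sum0.
have last_le : (\sum_(j < m.+1) v j) * p m <= 0 by rewrite mulr_le0_ge0 ?T_le //
  ltW ?p0.
have term_le (k : 'I_m) : (\sum_(j < k.+1) v j) * (p k - p k.+1) <= 0.
  by rewrite mulr_le0_ge0 ?T_le ?subr_ge0 ?p_le // ltnW.
have sum_le : \sum_(k < m) (\sum_(j < k.+1) v j) * (p k - p k.+1) <= 0.
  by apply: sumr_le0 => k _.
have last0 : (\sum_(j < m.+1) v j) * p m = 0 by lra.
have terms0 : \sum_(k < m) - ((\sum_(j < k.+1) v j) * (p k - p k.+1)) = 0.
  by rewrite sumrN; lra.
split=> [|k km].
  by move/eqP: last0; rewrite mulf_eq0 (gt_eqF (p0 m _)) // orbF => /eqP.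
have := terms0; move=> /eqP; rewrite psumr_eq0 => [|j _];
  last by rewrite oppr_ge0.
move=> /allP/(_ (Ordinal km)); rewrite mem_index_enum => /(_ isT) /=.
rewrite oppr_eq0 mulf_eq0 subr_eq0 => /orP[/eqP->|/eqP->]; by [left|right].
Qed.

(** The bounds add up to a convex combination of [1 - x] and [z], which can reach
    [1] only if it gives no weight to [1 - x]. *)
Lemma convex_step (x y z a b : R) : 0 < x -> 0 <= y -> y <= 1 -> z <= 1 ->
  0 <= a ->
  a <= (1 - x) * y -> b <= (1 - y) * z -> a + b = 1 -> a = 0 /\ 0 < z.
Proof.
move=> x0 y0 y1 z1 a0 ay bz ab.
have y_eq0 : y = 0.
  apply/eqP; rewrite eq_le y0 andbT leNgt; apply/negP => ypos.
  have : (1 - x) * y < y by rewrite mulrBl mul1r ltrBlDr ltrDl mulr_gt0.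
  have : (1 - y) * z <= 1 - y by rewrite ler_piMr // subr_ge0.
  by lra.
by move: ay bz; rewrite y_eq0 mulr0 subr0 mul1r => *; split; lra.
Qed.

End AbelSummation.

(* Partial sums of a sequence in which neighbours compensate are compared two steps
   at a time. *)
Section PairedSums.
Variables (R : realFieldType) (v : nat -> R).
Hypothesis v0 : v 0 <= 0.
Hypothesis v01 : v 0 + v 1 <= 0.

Let T k := \sum_(j < k.+1) v j.

Let TSS k : T k.+2 = T k + (v k.+1 + v k.+2).
Proof. by rewrite /T !big_ord_recr /= addrA. Qed.

Lemma paired_sum_le0 m : (forall j, (0 < j)%N -> (j < m)%N ->
  v j + v j.+1 <= 0) ->
  forall k, (k <= m)%N -> T k <= 0.
Proof.
move=> pair k; have [l] := ubnP k; elim: l k => // l IHl [|[|k]] kl km.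
- by rewrite /T big_ord1.
- by rewrite /T !big_ord_recr big_ord0 /= add0r.
- have Tk : T k <= 0 by apply: IHl; lia.
  by have := pair k.+1 isT km; rewrite TSS; lra.
Qed.

Lemma paired_sum_eq0 m : (forall j, (0 < j)%N -> (j < m)%N ->
  v j + v j.+1 <= 0) ->
  T m = 0 -> forall k, (k <= m)%N -> odd k = odd m -> T k = 0.
Proof.
move=> pair Tm k km okm; have Tle := paired_sum_le0 pair.
have [d dE] : exists d, m = (k + d.*2)%N by exists (m - k)./2; lia.
elim: d k dE {km okm} => [|d IHd] k dE; first by rewrite -Tm dE addn0.
have Tk : T k <= 0 by apply: Tle; lia.
have vk : v k.+1 + v k.+2 <= 0 by apply: pair => //; lia.
have := IHd k.+2; rewrite TSS => Tk2.
have : T k + (v k.+1 + v k.+2) = 0 by apply: Tk2; lia.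
by lra.
Qed.

End PairedSums.

(** The numerical core: [N j] is the dimension of [V_j], [s j] the number of chosen
    positions from level [j] to level [j+1], and [i j] the number of indices of
    level [j] at which a chosen position ends. *)
Section LevelCount.
Variables (alt : bool) (m : nat) (N i s : nat -> nat).
Let mu := m.+1.
Hypothesis N_gt0 : forall j, (j <= mu)%N -> (0 < N j)%N.
Hypothesis N_le : forall j, (N j.+2 <= N j)%N.
Hypothesis i_le : forall j, (i j <= N j)%N.
Hypothesis s_le : forall j, (0 < j)%N -> (s j <= (N j - i j) * i j.+1)%N.
Hypothesis s0_le : (s 0 <= N 0 * i 1)%N.
Hypothesis s0_half : (2 * s 0 <= N 0 * i 1)%N \/ ~~ alt /\ i 1 = 1%N.
Hypothesis N1_even : ~~ alt -> ~~ odd (N 1).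
Hypothesis total : (\sum_(j < mu) N j * N j.+1 <= 2 * \sum_(j < mu) s j)%N.

Let p j : rat := (N j * N j.+1)%:R.
Let x j : rat := (i j)%:R / (N j)%:R.
Let u j : rat := (s j)%:R / p j.
Let v j : rat := u j - 2^-1.

Let NR j : (j <= mu)%N -> 0 < (N j)%:R :> rat.
Proof. by rewrite ltr0n => /N_gt0. Qed.

Let p_gt0 j : (j <= m)%N -> 0 < p j.
Proof. by move=> jm; rewrite /p ltr0n muln_gt0 !N_gt0 //; rewrite /mu; lia. Qed.

Let p_le j : (j < m)%N -> p j.+1 <= p j.
Proof. by move=> _; rewrite /p ler_nat mulnC leq_mul2r N_le orbT. Qed.

Let x_ge0 j : 0 <= x j.
Proof. by rewrite divr_ge0. Qed.

Let x_le1 j : (j <= mu)%N -> x j <= 1.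
Proof. by move=> jm; rewrite ler_pdivrMr ?NR // mul1r ler_nat i_le. Qed.

Let u_ge0 j : 0 <= u j.
Proof. by rewrite divr_ge0. Qed.

Let u_le j : (0 < j)%N -> (j <= m)%N -> u j <= (1 - x j) * x j.+1.
Proof.
move=> j0 jm; rewrite ler_pdivrMr ?p_gt0 //.
have -> : (1 - x j) * x j.+1 * p j = ((N j)%:R - (i j)%:R) * (i j.+1)%:R.
  have n1 : (N j)%:R != 0 :> rat by rewrite gt_eqF // NR // /mu; lia.
  have n2 : (N j.+1)%:R != 0 :> rat by rewrite gt_eqF // NR // /mu; lia.
  by rewrite /x /p natrM; field; rewrite n1 n2.
by rewrite -natrB // -natrM ler_nat s_le.
Qed.

Let N1_ge2 : ~~ alt -> (1 < N 1)%N.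
Proof. by move=> /N1_even; have : (0 < N 1)%N := N_gt0 (ltn0Sn m);
  case: (N 1) => [|[]]. Qed.

Let u0_x1 : u 0 <= x 1.
Proof.
rewrite ler_pdivrMr ?p_gt0 //.
have -> : x 1 * p 0 = (N 0)%:R * (i 1)%:R.
  have n1 : (N 1)%:R != 0 :> rat by rewrite gt_eqF // NR.
  by rewrite /x /p natrM; field.
by rewrite -natrM ler_nat.
Qed.

Let u0_half : u 0 <= 2^-1.
Proof.
rewrite ler_pdivrMr ?p_gt0 // mulrC ler_pdivlMr // -natrM ler_nat mulnC.
have i1 := i_le 1; case: s0_half => [le|[na i1E]].
  by rewrite (leq_trans le) // leq_mul2l i1 orbT.
have := s0_le; rewrite i1E muln1 => le;
  rewrite mulnC (leq_trans (leq_mul le (leqnn 2))) //.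
by rewrite leq_mul2l N1_ge2 // orbT.
Qed.

Let v_pair j : (0 < j)%N -> (j < m)%N -> v j + v j.+1 <= 0.
Proof.
move=> j0 jm; have uj := u_le j0 (ltnW jm); have uj' := u_le (ltn0Sn j) jm.
have xj := x_ge0 j; have xj1 := x_ge0 j.+1.
have xj1' : x j.+1 <= 1 := x_le1 (leqW jm).
have xj2 : x j.+2 <= 1 := @x_le1 j.+2 jm.
have : (1 - x j) * x j.+1 <= x j.+1 by rewrite ler_piMl // lerBlDr lerDl.
have : (1 - x j.+1) * x j.+2 <= 1 - x j.+1 by rewrite ler_piMr // subr_ge0.
rewrite /v; lra.
Qed.

Let v0_le0 : v 0 <= 0. Proof. by rewrite subr_le0. Qed.

Let v01_le0 : (0 < m)%N -> v 0 + v 1 <= 0.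
Proof.
move=> m0; have u1 := u_le (ltn0Sn 0) m0; have x1 := x_ge0 1.
have x1' : x 1 <= 1 by apply: x_le1.
have x2 : x 2 <= 1 by apply: x_le1.
have : (1 - x 1) * x 2 <= 1 - x 1 by rewrite ler_piMr // subr_ge0.
by move: u0_x1; rewrite /v; lra.
Qed.

Let T k := \sum_(j < k.+1) v j.

Let partial_sums : (forall k, (k <= m)%N -> odd k = odd m -> T k = 0) /\
  forall k, (k < m)%N -> T k = 0 \/ N k = N k.+2.
Proof.
have T_le k : (k <= m)%N -> T k <= 0.
  case: (posnP m) => [m0|m0 km];
    last exact: paired_sum_le0 v0_le0 (v01_le0 m0) m v_pair k km.
  by rewrite m0 leqn0 => /eqP->; rewrite /T big_ord1.
have sum_ge0 : 0 <= \sum_(j < m.+1) p j * v j.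
  have -> : \sum_(j < m.+1) p j * v j =
      (\sum_(j < mu) s j)%:R - 2^-1 * (\sum_(j < mu) N j * N j.+1)%:R.
    rewrite !natr_sum mulr_sumr -sumrB; apply: eq_bigr => j _.
    have pj : p j != 0 by rewrite gt_eqF // p_gt0 // -ltnS.
    rewrite /v /u -/(p j); field.
    by move: pj; rewrite /p natrM mulf_eq0 negb_or andbC.
  rewrite subr_ge0 mulrC ler_pdivrMr // -natrM ler_nat mulnC; exact: total.
have [Tm TP] := weighted_sum_eq0 p_gt0 p_le T_le sum_ge0.
split=> [k km okm|k km].
  case: (posnP m) => [m0|m0]; first by move: km; rewrite m0 leqn0 => /eqP->;
    rewrite -m0.
  exact: paired_sum_eq0 v0_le0 (v01_le0 m0) m v_pair Tm k km okm.
case: (TP k km) => [Tk|/eqP pk]; [by left | right; move: pk].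
rewrite /p eqr_nat mulnC eqn_mul2l => /orP[/eqP N0|/eqP//].
by have := @N_gt0 k.+1 (leqW km); rewrite N0.
Qed.

(* Once an index of level [j] is entered, equality propagates upwards in steps of
   two: nothing is chosen from level [j] to level [j+1], and level [j+2] is entered
   again. *)
Let chain j : (0 < j)%N -> (j <= m)%N -> odd j = ~~ odd m -> 0 < x j ->
  forall k, (j <= k)%N -> (k < m)%N -> odd k = odd j -> u k = 0.
Proof.
move=> j0 jm oj xj k jk km ok.
suff [_ ->] : 0 < x k /\ u k = 0 by [].
have [d dE] : exists d, k = (j + d.*2)%N by exists (k - j)./2; move: jk ok;
  clear; lia.
have stepP l : (0 < l)%N -> (l < m)%N -> odd l = ~~ odd m -> 0 < x l ->
    u l = 0 /\ 0 < x l.+2.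
  move=> l0 lm ol xl.
  have vv : v l + v l.+1 = 0.
    have Tl1 := partial_sums.1 l.+1 lm.
    have Tl' := partial_sums.1 l.-1.
    have : T l.+1 = T l.-1 + (v l + v l.+1).
      by rewrite /T (prednK l0) !big_ord_recr /= -addrA.
    by rewrite Tl1 /= ?ol ?negbK // Tl' ?add0r //; move: l0 lm ol; clear; lia.
  apply: (convex_step xl (x_ge0 l.+1) _ _ (u_ge0 l) (u_le l0 (ltnW lm)) (u_le
    (ltn0Sn l) lm)).
  - exact: x_le1 (leqW lm).
  - exact: (@x_le1 l.+2 lm).
  - by move: vv; rewrite /v; lra.
have xk : 0 < x k.
  rewrite dE; elim: d {jk} k dE km ok => [|d IHd] k dE km ok;
    first by rewrite addn0.
  have [||||_] := stepP (j + d.*2)%N.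
  - by move: j0; clear; lia.
  - by move: dE km; clear; lia.
  - by rewrite oddD odd_double addbF.
  - by apply: (IHd _ erefl); move: dE km; clear;
      rewrite ?oddD ?odd_double ?addbF; lia.
  by rewrite doubleS !addnS.
by split=> //; have [||||->] := stepP k; rewrite ?ok //; move: j0 jk; clear;
  lia.
Qed.

(** The alternative [N 1 = 2] appears when a single index of level [1] receives all
    positions of level [0], so that half of them are chosen. *)
Lemma level_count_even : ~~ odd mu ->
  (forall k, ~~ odd k -> (0 < k)%N -> (k.+2 <= mu)%N -> N k = N k.+2) /\
  (N 0 = N 2 \/ ~~ alt /\ N 1 = 2%N).
Proof.
rewrite /mu /= negbK => om.
have m0 : (0 < m)%N by case: (m) om.
have u01 : u 0 + u 1 = 1.
  have := partial_sums.1 1%N m0 (esym om).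
  by rewrite /T !big_ord_recr big_ord0 /= /v; lra.
have u1 := u_le (ltn0Sn 0) m0.
have x1 : x 1 <= 1 by apply: x_le1.
have x2 : 0 < x 2.
  rewrite lt0r x_ge0 andbT; apply: contraTneq isT => x20.
  by move: u1 u0_half; rewrite x20 mulr0; lra.
have x2' : x 2 <= 1 by apply: x_le1.
split=> [k ok k0 km|].
  have [Tk|//] := partial_sums.2 k km.
  have uk : u k = 0 by apply: (chain (j := 2)) => //; move: ok om km k0 m0;
    clear; lia.
  have := Tk; rewrite /T big_ord_recr /=.
  have : T k.-1 = 0 by apply: partial_sums.1; move: ok om km k0; clear; lia.
  by rewrite /T (prednK k0) => ->; rewrite add0r /v uk sub0r => /eqP;
    rewrite oppr_eq0 invr_eq0 pnatr_eq0.
have [T0|] := partial_sums.2 0%N m0; last by left.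
right; have u0 : u 0 = 2^-1 by move: T0; rewrite /T big_ord1 /v; lra.
have x1_half : x 1 <= 2^-1.
  have : (1 - x 1) * x 2 <= 1 - x 1 by rewrite ler_piMr // subr_ge0.
  by lra.
have p0 : p 0 != 0 by rewrite gt_eqF // p_gt0.
have s0E : (2 * s 0 = N 0 * N 1)%N.
  apply/eqP; rewrite -(eqr_nat rat) natrM -/(p 0).
  have : (s 0)%:R = u 0 * p 0 by rewrite /u divfK.
  by move=> ->; rewrite u0; apply/eqP; field.
have i1_half : (2 * i 1 <= N 1)%N.
  move: x1_half; rewrite ler_pdivrMr ?NR // mulrC ler_pdivlMr //.
  by rewrite -natrM ler_nat mulnC.
have N00 : (0 < N 0)%N by apply: N_gt0.
have N10 : (0 < N 1)%N by apply: N_gt0.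
case: s0_half => [|[na i1E]]; first by rewrite s0E leq_pmul2l //;
  move: i1_half N10; clear; lia.
split=> //; have : (N 0 * N 1 <= 2 * N 0)%N.
  by rewrite -s0E leq_mul2l -[N 0]muln1 -i1E s0_le.
by rewrite mulnC leq_pmul2r //; move: i1_half; rewrite i1E; clear; lia.
Qed.

Hypothesis s0_odd : ~~ alt -> odd (N 0) -> (1 < i 1)%N ->
  (2 * s 0 + i 1 <= N 0 * i 1 + 2)%N.

Lemma level_count_odd : odd mu ->
  (forall k, odd k -> (k.+2 <= mu)%N -> N k = N k.+2) /\
  (~~ alt -> odd (N 0) -> N 1 = 2%N).
Proof.
rewrite /mu /= => om; have T0 := partial_sums.1 0%N.
have u0 : u 0 = 2^-1.
  by have := T0 isT (esym (negbTE om)); rewrite /T big_ord1 /v; lra.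
have s0E : (2 * s 0 = N 0 * N 1)%N.
  apply/eqP; rewrite -(eqr_nat rat) natrM -/(p 0).
  have p0 : p 0 != 0 by rewrite gt_eqF // p_gt0.
  have : (s 0)%:R = u 0 * p 0 by rewrite /u divfK.
  by move=> ->; rewrite u0; apply/eqP; field.
split=> [k ok km|na oN0].
  have [Tk|//] := partial_sums.2 k km.
  have uk : u k = 0.
    have x1 : 0 < x 1 by apply: lt_le_trans u0_x1; rewrite u0.
    by apply: (chain (j := 1)) => //; move: ok om km; clear; lia.
  have := Tk; rewrite /T big_ord_recr /=.
  have : T k.-1 = 0 by apply: partial_sums.1; move: ok om km; clear; lia.
  have k0 : (0 < k)%N by case: (k) ok.
  by rewrite /T (prednK k0) => ->; rewrite add0r /v uk sub0r => /eqP;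
    rewrite oppr_eq0 invr_eq0 pnatr_eq0.
have N1 := N1_ge2 na; have even1 := N1_even na.
have N00 : (0 < N 0)%N by apply: N_gt0.
case: (ltnP 1 (i 1)) => i1.
  have := s0_odd na oN0 i1; rewrite s0E => le.
  have := i_le 1; rewrite leq_eqVlt => /predU1P[i1E|lt].
    by move: le i1; rewrite i1E leq_add2l => le1 lt1; apply/eqP;
      rewrite eqn_leq le1.
  have : (N 0 * (i 1).+1 <= N 0 * N 1)%N by rewrite leq_mul2l lt orbT.
  by rewrite mulnS; move: le i1 N00; clear; lia.
have : (N 0 * N 1 <= 2 * N 0)%N.
  by rewrite -s0E leq_mul2l (leq_trans s0_le) // -{2}[N 0]muln1 leq_mul2l i1
    orbT.
by move: N1 even1 N00; rewrite mulnC leq_mul2r; clear; lia.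
Qed.

End LevelCount.

(** * Counting positions *)

Section PositionCounts.
Variables (n : nat) (c : 'I_n -> int) (alt : bool) (m : nat).
Let mu := m.+1.
Hypothesis c_rev : forall i, c (rev_ord i) = - c i.
Hypothesis c_le : forall i, c i <= mu%:Z.

Let N (j : nat) := weight_mult c j.
Let V (j : nat) := [set i | c i == j%:Z].
Let E := positions c.
Let level (A : {set 'I_n * 'I_n}) (j : nat) := [set pa in A | c pa.2 == j%:Z].

(* The start of a position of degree one lies at a level below the top [mu]. *)
Let card_levels (A : {set 'I_n * 'I_n}) : A \subset E ->
  #|A| = (\sum_(j < mu) #|level A j|)%N.
Proof.
move=> /subsetP AE; rewrite -sum1_card.
rewrite (partition_big (fun pa => inord `|c pa.2|%N : 'I_mu) xpredT) //=.
apply: eq_bigr => j _; rewrite sum1_card; apply: eq_card => -[p a].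
rewrite inE [LHS]/= unfold_in /=; have [paA|//] := boolP ((p, a) \in A).
have := AE _ paA; rewrite mem_positions => /andP[a0 /eqP pa] /=.
have a_lt : (`|c a| < mu)%N by have := c_le p; lia.
apply/eqP/eqP => [<-|aj]; first by rewrite inordK //; lia.
by apply: val_inj; rewrite /= inordK //; lia.
Qed.

Let levelE j : level E j = setX (V j.+1) (V j).
Proof. by apply/setP => -[p a]; rewrite !inE /=; lia. Qed.

Lemma card_positions : #|E| = (\sum_(j < mu) N j * N j.+1)%N.
Proof.
by rewrite card_levels //; apply: eq_bigr => j _; rewrite levelE cardsX mulnC.
Qed.

Lemma rev_ord_fixed (q : 'I_n) : rev_ord q = q -> odd n.
Proof. by move/(congr1 val) => /=; have := ltn_ord q; lia. Qed.

Lemma odd_weight_mult0 : odd (N 0) = odd n.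
Proof.
have -> : n = (N 0 + #|[set i | (0 < c i)%R]|.*2)%N.
  rewrite -{1}(card_ord n) -(cardsC (V 0)); congr (_ + _)%N.
  have -> : ~: V 0 = [set i | 0 < c i] :|: @rev_ord n @: [set i | 0 < c i].
    apply/setP => i; rewrite !inE; apply/idP/orP => [ci|[|/imsetP[j]]];
      last 2 first.
    - by lia.
    - by rewrite inE => cj ->; rewrite c_rev; lia.
    have [ci'|ci'] := boolP (0 < c i); [by left|right].
    by apply/imsetP; exists (rev_ord i); rewrite ?rev_ordK // inE c_rev; lia.
  rewrite cardsU [X in (_ - X)%N](_ : _ = 0%N); last first.
    apply/eqP; rewrite cards_eq0; apply/eqP/setP => i; rewrite !inE.
    apply/negP => /andP[ci /imsetP[j]]; rewrite inE => cj ij.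
    by move: ci; rewrite ij c_rev; lia.
  by rewrite subn0 (card_imset _ rev_ord_inj) addnn.
by rewrite oddD odd_double addbF.
Qed.

Section UpperBound.
Variable S : {set 'I_n * 'I_n}.
Hypothesis SE : S \subset E.
Hypothesis Scomm : commuting_positions alt S.

Let I (j : nat) := [set q in V j | [exists a, (q, a) \in S]].

Lemma card_heads_le j : (#|I j| <= N j)%N.
Proof. by apply: subset_leq_card; apply/subsetP => q; rewrite !inE =>
  /andP[]. Qed.

Let level_sub j : level S j \subset setX (I j.+1) (V j).
Proof.
apply/subsetP => -[p a]; rewrite !inE /= => /andP[paS /eqP aj].
have /(subsetP SE) := paS; rewrite mem_positions aj => /andP[_ /eqP ->].
rewrite eqxx andbT; apply/andP; split; first by lia.
by apply/existsP; exists a.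
Qed.

(** An index at which a chosen position ends starts no chosen position. *)
Lemma card_level_le j : (#|level S j| <= (N j - #|I j|) * #|I j.+1|)%N.
Proof.
have -> : (N j - #|I j|)%N = #|V j :\: I j|.
  rewrite cardsD (setIidPr _) //; apply/subsetP => q.
  by rewrite !inE => /andP[].
rewrite mulnC -cardsX; apply: subset_leq_card; apply/subsetP => -[p a] paS.
have := subsetP (level_sub j) _ paS; rewrite !in_setX => /andP[-> aV] /=.
rewrite inE aV andbT inE aV /=; apply/negP => /existsP[b abS].
by move: paS; rewrite inE => /andP[paS _]; apply: (Scomm.1 p a b).
Qed.

Lemma card_level0_le : (#|level S 0| <= N 0 * #|I 1|)%N.
Proof. by rewrite mulnC -cardsX subset_leq_card ?level_sub. Qed.

Let D q := [set b in I 1 | (b, q) \in S].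

Let card_level0 : #|level S 0| = (\sum_(q in V 0) #|D q|)%N.
Proof.
rewrite -sum1_card (partition_big (fun pa => pa.2) (mem (V 0))) /=; last first.
  by move=> [p a] /(subsetP (level_sub 0)); rewrite in_setX => /andP[].
apply: eq_bigr => q qV; rewrite sum1_card -(card_imset (D q) (f := fun b => (b,
  q))).
  apply: eq_card => -[p a]; rewrite unfold_in /=; apply/andP/imsetP.
    move=> [paS /eqP/= <-]; exists p => //; rewrite inE.
    have := subsetP (level_sub 0) _ paS; rewrite in_setX => /andP[-> _].
    by move: paS; rewrite inE => /andP[].
  move=> [b]; rewrite inE => /andP[_ bS] [-> ->]; split=> //.
  by move: qV; rewrite !inE bS /= => ->.
by move=> b b' [].
Qed.

(* If both [q] and its mirror image start chosen positions, all of these end at one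
   and the same index. *)
Let D_pair q : alt \/ #|I 1| != 1%N -> (#|D q| + #|D (rev_ord q)| <= #|I 1|)%N.
Proof.
move=> notone.
have DI r : (#|D r| <= #|I 1|)%N.
  by apply: subset_leq_card; apply/subsetP => b; rewrite !inE => /andP[].
have [->|/set0Pn[b bD]] := eqVneq (D q) set0; first by rewrite cards0 add0n.
have [->|/set0Pn[b' b'D]] := eqVneq (D (rev_ord q)) set0;
  first by rewrite cards0 addn0.
have commD x y : x \in D q -> y \in D (rev_ord q) -> x = y /\ ~~ alt.
  by rewrite !inE => /andP[_ xS] /andP[_ yS]; apply: (Scomm.2 x y q).
have [_ nalt] := commD _ _ bD b'D.
have Dq1 : #|D q| = 1%N.
  apply/eqP/cards1P; exists b'; apply/setP => x; rewrite in_set1.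
  by apply/idP/eqP => [xD|->]; [have [] := commD _ _ xD b'D | have [<-] :=
    commD _ _ bD b'D].
have Dr1 : #|D (rev_ord q)| = 1%N.
  apply/eqP/cards1P; exists b; apply/setP => x; rewrite in_set1.
  by apply/idP/eqP => [xD|->]; [have [-> ] := commD _ _ bD xD | have [->] :=
    commD _ _ bD b'D].
rewrite Dq1 Dr1; have := DI q; rewrite Dq1.
by case: notone => [aT|]; [rewrite aT in nalt | move=> *; lia].
Qed.

Let twice_level0 : (2 * #|level S 0| = \sum_(q in V 0) (#|D q| + #|D (rev_ord
  q)|))%N.
Proof.
rewrite big_split /= mul2n -addnn {1}card_level0; congr (_ + _)%N.
rewrite card_level0 (reindex_inj rev_ord_inj) /=.
by apply: eq_bigl => q; rewrite !inE c_rev; lia.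
Qed.

Lemma card_level0_half : (2 * #|level S 0| <= N 0 * #|I 1|)%N \/ ~~ alt /\
  #|I 1| = 1%N.
Proof.
have [one|notone] := boolP (~~ alt && (#|I 1| == 1%N)).
  by right; move: one => /andP[-> /eqP].
left; rewrite twice_level0 /N /weight_mult -/(V 0) -sum_nat_const.
apply: leq_sum => q _; apply: D_pair; move: notone; rewrite negb_and negbK.
by case/orP; [left|right].
Qed.

(** In odd dimension the middle index is its own mirror image, and at most one
    chosen position starts there. *)
Lemma card_level0_odd : odd (N 0) -> (1 < #|I 1|)%N ->
  (2 * #|level S 0| + #|I 1| <= N 0 * #|I 1| + 2)%N.
Proof.
rewrite odd_weight_mult0 => on i1.
have n2 : (n./2 < n)%N by lia.
pose q0 := Ordinal n2.
have q0rev : rev_ord q0 = q0 by apply: val_inj => /=; lia.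
have q0V : q0 \in V 0.
  by rewrite inE; have := c_rev q0; rewrite q0rev; lia.
rewrite twice_level0 (bigD1 q0) //= q0rev.
have D1 : (#|D q0| <= 1)%N.
  rewrite leqNgt; apply/negP => /card_gt1P[x [y []]]; rewrite !inE =>
    /andP[_ xS] /andP[_ yS].
  by have [] := Scomm.2 x y q0 xS; rewrite ?q0rev // => ->; rewrite eqxx.
have : (\sum_(q in V 0 | q != q0) (#|D q| + #|D (rev_ord q)|) <=
    \sum_(q in V 0 | q != q0) #|I 1|)%N.
  by apply: leq_sum => q _; apply: D_pair; right; lia.
have : (\sum_(q in V 0 | q != q0) #|I 1| + #|I 1| = N 0 * #|I 1|)%N.
  by rewrite /N /weight_mult -/(V 0) -sum_nat_const [in RHS](bigD1 q0) //=
    addnC.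
move=> <- le; by rewrite [X in (_ <= X)%N]addnAC leq_add2r addnC leq_add //
  (leq_add D1 D1).
Qed.

Lemma card_levels_of_half : (#|E| <= 2 * #|S|)%N ->
  (\sum_(j < mu) N j * N j.+1 <= 2 * \sum_(j < mu) #|level S j|)%N.
Proof. by rewrite card_positions card_levels. Qed.

End UpperBound.

Hypothesis N_gt0 : forall j, (j <= mu)%N -> (0 < N j)%N.
Hypothesis N0_even : alt -> ~~ odd (N 0).

(** The condition on the partition in terms of weight multiplicities: every second
    size below the largest part is absent, with the exception [N 1 = 2] when the
    largest part is odd; when it is even, odd dimension forces [N 1 = 2]. *)
Definition weights_half_cond : Prop :=
  (odd mu -> (forall k, odd k -> (k.+2 <= mu)%N -> N k = N k.+2) /\
     (odd (N 0) -> N 1 = 2%N)) /\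
  (~~ odd mu -> (forall k, ~~ odd k -> (0 < k)%N -> (k.+2 <= mu)%N ->
    N k = N k.+2) /\
     (N 0 = N 2 \/ ~~ alt /\ N 1 = 2%N)).

Let restr (Q : rel 'I_n) := [set pa in E | Q pa.1 pa.2].

Let restrE (Q : rel 'I_n) : restr Q \subset E.
Proof. by apply/subsetP => pa; rewrite inE => /andP[]. Qed.

Let level_restr (Q : rel 'I_n) j (A B : {set 'I_n}) :
  (forall p a, c p = j.+1%:Z -> c a = j%:Z -> Q p a = (p \in A) && (a \in B)) ->
  #|level (restr Q) j| = (#|V j.+1 :&: A| * #|V j :&: B|)%N.
Proof.
move=> QE; rewrite -cardsX; apply: eq_card => -[p a]; rewrite !inE /=.
have [/eqP ca|] := boolP (c a == j%:Z); last by rewrite !andbF.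
rewrite ca !andbT; have [/eqP cp|cp] := boolP (c p == j.+1%:Z).
  have -> : c p == j%:Z + 1 by rewrite cp; apply/eqP; lia.
  by rewrite QE.
by rewrite (_ : (c p == j%:Z + 1) = false) //; apply/negP => /eqP cp'; lia.
Qed.

Let level_restr1 (Q : rel 'I_n) j :
  (forall p a, c p = j.+1%:Z -> c a = j%:Z -> Q p a) ->
    #|level (restr Q) j| = (N j * N j.+1)%N.
Proof.
move=> QE; rewrite (@level_restr Q j setT setT) => [|p a cp ca];
  last by rewrite QE ?inE.
by rewrite !setIT mulnC.
Qed.

Let level_restr0 (Q : rel 'I_n) j :
  (forall p a, c p = j.+1%:Z -> c a = j%:Z -> Q p a = false) ->
    #|level (restr Q) j| = 0%N.
Proof.
move=> QE; rewrite (@level_restr Q j set0 set0) => [|p a cp ca];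
  last by rewrite QE ?inE.
by rewrite !setI0 cards0 muln0.
Qed.

Let sum_pairs_odd d (F : nat -> nat) :
  (\sum_(j < d.*2.+1) F j = F 0 + \sum_(l < d) (F l.*2.+1 + F l.*2.+2))%N.
Proof.
elim: d => [|d IHd]; first by rewrite big_ord1 big_ord0 addn0.
by rewrite doubleS 2!big_ord_recr /= IHd [in RHS]big_ord_recr /= !addnA.
Qed.

Let sum_pairs_even d (F : nat -> nat) :
  (\sum_(j < d.*2) F j = \sum_(l < d) (F l.*2 + F l.*2.+1))%N.
Proof.
elim: d => [|d IHd]; first by rewrite !big_ord0.
by rewrite doubleS 2!big_ord_recr /= IHd [in RHS]big_ord_recr /= !addnA.
Qed.

Let half_odd (Q : rel 'I_n) : odd mu ->
  (2 * #|level (restr Q) 0| = N 0 * N 1)%N ->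
  (forall k, odd k -> (k.+2 <= mu)%N -> N k = N k.+2) ->
  (forall j p a, odd j -> c p = j.+1%:Z -> c a = j%:Z -> Q p a = false) ->
  (forall j p a, (0 < j)%N -> ~~ odd j -> c p = j.+1%:Z -> c a = j%:Z ->
    Q p a) ->
  (2 * #|restr Q| = #|E|)%N.
Proof.
move=> om half0 NN Qodd Qeven; rewrite card_positions card_levels ?restrE //.
have -> : mu = (m./2).*2.+1 by move: om; rewrite /mu /=; lia.
rewrite (sum_pairs_odd _ (fun j => #|level (restr Q) j|)).
rewrite (sum_pairs_odd _ (fun j => N j * N j.+1)%N) mulnDr half0;
  congr (_ + _)%N.
rewrite big_distrr; apply: eq_bigr => l _ /=.
have l2 : (l.*2.+3 <= mu)%N.
  by have := ltn_ord l; move: om; rewrite /mu /=; lia.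
rewrite level_restr0 => [|p a]; last by apply: Qodd => /=; rewrite odd_double.
rewrite level_restr1 => [|p a]; last by apply: Qeven => //=;
  rewrite negbK odd_double.
rewrite (NN l.*2.+1) //= ?odd_double // add0n mul2n -addnn.
by rewrite mulnC.
Qed.

Let half_even (Q : rel 'I_n) : ~~ odd mu ->
  (2 * (#|level (restr Q) 0| + #|level (restr Q) 1|) = N 0 * N 1 + N 1 * N 2)%N
    ->
  (forall k, ~~ odd k -> (0 < k)%N -> (k.+2 <= mu)%N -> N k = N k.+2) ->
  (forall j p a, (1 < j)%N -> ~~ odd j -> c p = j.+1%:Z -> c a = j%:Z ->
    Q p a = false) ->
  (forall j p a, (1 < j)%N -> odd j -> c p = j.+1%:Z -> c a = j%:Z -> Q p a) ->
  (2 * #|restr Q| = #|E|)%N.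
Proof.
move=> om half0 NN Qeven Qodd; rewrite card_positions card_levels ?restrE //.
have [d dE] : exists d, mu = d.+1.*2.
  by exists (m./2); move: om; rewrite /mu /=; lia.
rewrite dE (sum_pairs_even _ (fun j => #|level (restr Q) j|)).
rewrite (sum_pairs_even _ (fun j =>
  N j * N j.+1)%N) big_distrr !big_ord_recl /= half0.
congr (_ + _)%N; apply: eq_bigr => l _; rewrite /bump /= add1n doubleS.
have l2 : (l.*2.+4 <= mu)%N by have := ltn_ord l; rewrite dE; lia.
rewrite level_restr0 => [|p a]; last by apply: Qeven => //=;
  rewrite !negbK odd_double.
rewrite level_restr1 => [|p a]; last by apply: Qodd => //=;
  rewrite negbK odd_double.
by rewrite (NN l.*2.+2) //= ?negbK ?odd_double // add0n mul2n -addnn mulnC.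
Qed.

(** Take all positions starting at every second level, so that they never compose.
    From level [0], when it is among these, take the positions starting in one
    half of [V_0], or else those ending at one fixed index [b0] of level [1]. In
    the exceptional case take the positions starting at the odd levels, except at
    [b0], and add those from level [0] that end at [b0]. *)
Lemma half_positions_of_weights : weights_half_cond ->
  exists S : {set 'I_n * 'I_n}, [/\ S \subset E, commuting_positions alt S &
    (2 * #|S| = #|E|)%N].
Proof.
have restrP (Q : rel 'I_n) p a : (p, a) \in restr Q -> [/\ 0 <= c a,
  c p = c a + 1 & Q p a].
  by rewrite inE mem_positions /= => /andP[/andP[? /eqP ?] ?].
have zigzag0 (Q : rel 'I_n) b b' q : (b, q) \in restr Q -> (b',
  rev_ord q) \in restr Q ->
    [/\ c q = 0, c (rev_ord q) = 0, Q b q & Q b' (rev_ord q)].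
  by move=> /restrP[q0 _ Qbq] /restrP[]; rewrite c_rev => rq0 _ Qb'q; split=>
    //; lia.
have [b0 cb0] : exists b0, c b0 = 1.
  have := N_gt0 (j := 1); rewrite ltnS => /(_ isT)/card_gt0P[b0].
  by rewrite inE => /eqP; exists b0.
have N0E : N 0 = #|V 0| by [].
have card_b0 : #|V 1 :&: [set b0]| = 1%N.
  by rewrite (setIidPr _) ?cards1 // sub1set inE cb0.
case=> Hodd Heven; have [om|om] := boolP (odd mu).
  have [NN N1] := Hodd om; have [oN0|oN0] := boolP (odd (N 0)).
    have nalt : ~~ alt by apply/negP => /N0_even; rewrite oN0.
    pose Q (p a : 'I_n) := ~~ odd `|c a|%N && ((c a == 0) ==> (p == b0)).
    exists (restr Q); split=> //.
      split=> [p q a /restrP[_ _ /andP[oq _]] /restrP[_ cq /andP[oa _]]|b b' q].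
        by move: oq oa; rewrite cq; lia.
      move=> bS b'S; have [q0 rq0 /andP[_ Qb] /andP[_ Qb']] :=
        zigzag0 _ _ _ _ bS b'S.
      by move: Qb Qb'; rewrite q0 rq0 eqxx => /eqP-> /eqP->.
    apply: half_odd => //.
    + rewrite (@level_restr Q 0 [set b0] setT) => [|p a cp ca].
        by rewrite setIT card_b0 mul1n N1 // mulnC.
      by rewrite /Q ca /= !inE andbT.
    + by move=> j p a oj _ ca; rewrite /Q ca /= oj.
    + by move=> j p a j0 oj _ ca; rewrite /Q ca /= oj; apply/implyP => /eqP;
        lia.
  pose Q (p a : 'I_n) := ~~ odd `|c a|%N && ((c a == 0) ==> (a < rev_ord a)%N).
  exists (restr Q); split=> //.
    split=> [p q a /restrP[_ _ /andP[oq _]] /restrP[_ cq /andP[oa _]]|b b' q].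
      by move: oq oa; rewrite cq; lia.
    move=> bS b'S; have [q0 rq0 /andP[_ Qb] /andP[_ Qb']] :=
      zigzag0 _ _ _ _ bS b'S.
    by move: Qb Qb'; rewrite q0 rq0 eqxx rev_ordK => /= lt /(ltn_trans lt);
      rewrite ltnn.
  apply: half_odd => //.
  + pose L := [set a : 'I_n | (a < rev_ord a)%N].
    rewrite (@level_restr Q 0 setT L) => [|p a cp ca];
      last by rewrite /Q ca /= !inE.
    rewrite setIT mulnCA mulnC; congr (_ * _)%N; rewrite mul2n -addnn N0E.
    rewrite -(cardsID L (V 0)); congr (_ + _)%N.
    rewrite -(card_imset _ rev_ord_inj); apply: eq_card => q; rewrite !inE.
    apply/imsetP/andP => [[a]|[ql /eqP q0]].
      rewrite !inE => /andP[/eqP a0 al] ->;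
        rewrite c_rev a0 oppr0 eqxx rev_ordK.
      by rewrite -leqNgt ltnW.
    exists (rev_ord q); rewrite ?rev_ordK // !inE c_rev q0 oppr0 eqxx rev_ordK
      /=.
    rewrite ltn_neqAle leqNgt ql andbT; apply/eqP => rq.
    have /rev_ord_fixed on : rev_ord q = q by apply: val_inj.
    have := odd_weight_mult0; rewrite on.
    by move=> oN; rewrite oN in oN0.
  + by move=> j p a oj _ ca; rewrite /Q ca /= oj.
  + by move=> j p a j0 oj _ ca; rewrite /Q ca /= oj; apply/implyP => /eqP; lia.
have [NN N02] := Heven om; have [N02E|N02ne] := eqVneq (N 0) (N 2).
  pose Q (p a : 'I_n) := odd `|c a|%N.
  exists (restr Q); split=> //.
    split=> [p q a /restrP[_ _ oq] /restrP[a0 cq oa]|b b' q].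
      by move: oq oa; rewrite /Q cq; lia.
    by move=> bS b'S; have [q0 _ + _] := zigzag0 _ _ _ _ bS b'S; rewrite /Q q0.
  apply: half_even => //.
  + rewrite level_restr0 => [|p a _ ca]; last by rewrite /Q ca.
    rewrite level_restr1 => [|p a _ ca]; last by rewrite /Q ca.
    by rewrite N02E add0n mul2n -addnn mulnC.
  + by move=> j p a _ oj _ ca; rewrite /Q ca /=; apply/negbTE.
  + by move=> j p a _ oj _ ca; rewrite /Q ca.
have [nalt N1] : ~~ alt /\ N 1 = 2%N.
  by case: N02 => // N02E; rewrite N02E eqxx in N02ne.
pose Q (p a : 'I_n) := if c a == 0 then p == b0 else
  odd `|c a|%N && ((c a == 1) ==> (a != b0)).
exists (restr Q); split=> //.
  split=> [p q a /restrP[_ _ Qpq] /restrP[a0 cq Qqa]|b b' q].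
    move: Qpq Qqa; rewrite /Q; have [ca|ca] := eqVneq (c a) 0.
      by rewrite cq ca /= => Qpq /eqP qb; move: Qpq; rewrite qb eqxx.
    rewrite cq (_ : (c a + 1 == 0) = false); last by apply/negP => /eqP; lia.
    by move=> /andP[o1 _] /andP[o2 _]; move: o1 o2 a0; clear; lia.
  move=> bS b'S; have [q0 rq0] := zigzag0 _ _ _ _ bS b'S.
  by rewrite /Q q0 rq0 eqxx => /eqP-> /eqP->.
apply: half_even => //.
+ rewrite (@level_restr Q 0 [set b0] setT) => [|p a _ ca]; last first.
    by rewrite /Q ca /= !inE andbT.
  rewrite (@level_restr Q 1 setT (~: [set b0])) => [|p a _ ca]; last first.
    by rewrite /Q ca /= !inE.
  rewrite !setIT card_b0 mul1n N1 -setDE.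
  have -> : #|V 1 :\: [set b0]| = 1%N.
    by rewrite cardsD card_b0 -[#|V 1|]/(N 1) N1.
  by rewrite muln1 mulnDr [(N 0 * 2)%N]mulnC.
+ move=> j p a j1 oj _ ca;
    rewrite /Q ca /= (negPf oj) (_ : (j%:Z == 0) = false) //.
  by apply/negP => /eqP; lia.
+ move=> j p a j1 oj _ ca; rewrite /Q ca /= oj (_ : (j%:Z == 0) = false).
    by apply/implyP => /eqP; lia.
  by apply/negP => /eqP; lia.
Qed.

Hypothesis N_le : forall j, (N j.+2 <= N j)%N.
Hypothesis N1_even : ~~ alt -> ~~ odd (N 1).

Lemma weights_of_half_positions (S : {set 'I_n * 'I_n}) : S \subset E ->
  commuting_positions alt S -> (#|E| <= 2 * #|S|)%N -> weights_half_cond.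
Proof.
move=> SE Scomm half; split=> mu_odd.
- have [] := @level_count_odd alt m N
    (fun j => #|[set q in V j | [exists a, (q, a) \in S]]|) (fun j =>
      #|level S j|)
    N_gt0 N_le (card_heads_le S) (fun j _ => card_level_le SE Scomm j)
    (card_level0_le SE) (card_level0_half SE Scomm)
    N1_even (card_levels_of_half SE half) (fun _ =>
      card_level0_odd SE Scomm) mu_odd.
  move=> H1 H2; split=> // oN0; apply: H2 => //.
  by apply/negP => /N0_even; rewrite oN0.
- exact: (@level_count_even alt m N
    (fun j => #|[set q in V j | [exists a, (q, a) \in S]]|) (fun j =>
      #|level S j|)
    N_gt0 N_le (card_heads_le S) (fun j _ => card_level_le SE Scomm j)
    (card_level0_le SE) (card_level0_half SE Scomm)
    N1_even (card_levels_of_half SE half) mu_odd).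
Qed.

End PositionCounts.

(** * Partitions *)

Section HalfPartitions.
Local Open Scope nat_scope.
Variables (T : classical_type) (s : seq nat).
Let C x := count_mem x s.

Lemma count_odd_parts b nu k x :
  count_mem x (odd_parts b nu k) = if odd x && (x < 2 * k) then b * nu x else 0.
Proof.
elim: k => [|k IHk]; first by rewrite muln0 ltn0 andbF.
rewrite /odd_parts -[in LHS](addn1 k) iotaD map_cat flatten_cat count_cat
  -/(odd_parts b nu k) IHk.
rewrite /= cats0 count_nseq /=.
have -> : 2 * (1 + k) - 1 = k.*2.+1 by lia.
have [<-|ne] := eqVneq k.*2.+1 x; last first.
  rewrite mul0n addn0; congr (if _ then _ else _).
  by move: ne; case: (boolP (odd x)) => //= ox ne; lia.
rewrite mul1n (_ : (k.*2.+1 < 2 * k) = false) ?andbF ?add0n; last by lia.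
by have -> : odd k.*2.+1 && (k.*2.+1 < 2 * k.+1) by lia.
Qed.

Lemma count_even_parts b nu k x :
  count_mem x (even_parts b nu k) =
  if [&& ~~ odd x, 0 < x & x <= 2 * k] then b * nu x else 0.
Proof.
elim: k => [|k IHk]; first by rewrite muln0 leqn0 lt0n; case: eqP;
  rewrite ?andbF.
rewrite /even_parts -[in LHS](addn1 k) iotaD map_cat flatten_cat count_cat
  -/(even_parts b nu k) IHk.
rewrite /= cats0 count_nseq /=.
have -> : 2 * (1 + k) = k.+1.*2 by lia.
have [<-|ne] := eqVneq k.+1.*2 x; last first.
  rewrite mul0n addn0; congr (if _ then _ else _).
  by move: ne; case: (boolP (odd x)) => //= ox ne; lia.
rewrite mul1n (_ : [&& _, _ & k.+1.*2 <= 2 * k] = false); last by lia.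
by rewrite add0n; case: ifP => // /negP[]; lia.
Qed.

Lemma perm_eq_count (t : seq nat) : perm_eq s t <-> forall x,
  C x = count_mem x t.
Proof.
by split=> [/permP st x|st]; [apply: st | apply/allP => x _ /=; rewrite -st].
Qed.

Lemma mem_count x : (x \in s) = (0 < C x).
Proof. by rewrite -has_count has_pred1. Qed.

Lemma largest_eq M : M \in s -> (forall x, x \in s -> x <= M) -> largest s = M.
Proof.
move=> Ms sM; apply/eqP; rewrite eqn_leq; apply/andP; split.
  by rewrite /largest big_seq; apply/bigmax_leqP_seq => x xs _; apply: sM.
exact: (@leq_bigmax_seq _ s xpredT (fun x => x) M Ms isT).
Qed.

Lemma half_list_cond : half_list T s -> half_cond_even T s \/ half_cond_odd T s.
Proof.
case=> k [nu [m [k1 H]]].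
have even_case b nu' m' : m' != 0 -> (T = TypeB -> m' = 2) ->
    perm_eq s (odd_parts b nu' k ++ nseq m' (2 * k)) -> half_cond_even T s.
  move=> m0 mB /perm_eq_count st.
  have CE x : C x = (if odd x &&
    (x < 2 * k) then b * nu' x else 0) + (2 * k == x) * m'.
    by rewrite st count_cat count_odd_parts count_nseq.
  have ME : largest s = 2 * k.
    apply: largest_eq => [|x]; rewrite mem_count CE; last by case: ifP;
      case: eqP; lia.
    by rewrite eqxx mul1n; lia.
  split; rewrite ?ME; first by lia.
    by move=> p; rewrite mem_count CE => + ep; rewrite (negPf ep) /=; case: eqP.
  by move=> TB; rewrite -/(C _) CE eqxx mul1n mB // (_ : odd _ && _ = false) //;
    lia.
have odd_case b nu' m' : m' != 0 ->
    perm_eq s (even_parts b nu' k ++ nseq m' (2 * k + 1)) -> half_cond_odd T s.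
  move=> m0 /perm_eq_count st.
  have CE x : C x = (if [&& ~~ odd x,
    0 < x & x <= 2 * k] then b * nu' x else 0) +
      (2 * k + 1 == x) * m'.
    by rewrite st count_cat count_even_parts count_nseq.
  have ME : largest s = 2 * k + 1.
    apply: largest_eq => [|x]; rewrite mem_count CE; last by case: ifP;
      case: eqP; lia.
    by rewrite eqxx mul1n; lia.
  split; rewrite ?ME; first by lia.
  left=> p; rewrite mem_count CE => + op; rewrite op /=; case: eqP => //.
have mixed_case m' : m' != 0 -> T <> TypeC ->
    perm_eq s (nseq (nu 1) 1 ++ nseq 2 (2 * k) ++ nseq m' (2 * k + 1)) ->
      half_cond_odd T s.
  move=> m0 TC /perm_eq_count st.
  have CE x : C x = (1 == x) * nu 1 + ((2 * k == x) * 2 + (2 * k + 1 == x) *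
    m').
    by rewrite st !count_cat !count_nseq.
  have ME : largest s = 2 * k + 1.
    apply: largest_eq => [|x]; rewrite mem_count CE; last by do !case: eqP; lia.
    by rewrite eqxx mul1n; lia.
  split; rewrite ?ME; first by lia.
  right; split=> //; first by rewrite -/(C _) CE; do !case: eqP; lia.
  by move=> p; rewrite mem_count CE !inE; do !case: eqP; lia.
have m_neq0 x : x * m != 0 -> m != 0 by rewrite muln_eq0 negb_or => /andP[].
case: (T) H even_case odd_case mixed_case =>
  /= [H|H|H] even_case odd_case mixed_case.
- case: H => [[/m_neq0 m0 st]|[m0 st]|[_ _ st]|[//]].
  + by right; apply: (odd_case _ _ _ _ st).
  + by right; apply: (mixed_case _ _ _ st).
  + by left; apply: (even_case 1 nu 2 _ _ st).
- case: H => [[/m_neq0 m0 st]|[/m_neq0 m0 st]].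
  + by left; apply: (even_case _ _ _ _ _ st).
  + by right; apply: (odd_case _ _ _ _ st); rewrite muln_eq0.
- case: H => [[/m_neq0 m0 st]|[m0 st]|[//]|[_ /m_neq0 m0 st]].
  + by right; apply: (odd_case _ _ _ _ st).
  + by right; apply: (mixed_case _ _ _ st).
  + by left; apply: (even_case _ _ _ _ _ st); rewrite ?muln_eq0.
Qed.

Hypothesis s_pos : 0 \notin s.
Hypothesis s_top : 1 < largest s.
Hypothesis s_top1 : (largest s).-1 \in s.
Hypothesis s_even : forall x, 0 < x ->
  odd x = (if T is TypeC then true else false) ->
  ~~ odd (C x).

Let largest_mem : largest s \in s.
Proof.
rewrite /largest; move: s_top; rewrite /largest.
elim: (s) => [|p t IHt]; rewrite ?big_nil ?big_cons // inE.
case: (leqP (\max_(q <- t) q) p) => le lt; first by rewrite eqxx.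
by rewrite IHt ?orbT.
Qed.

Let largest_ge x : x \in s -> x <= largest s.
Proof. by move=> xs; exact: (@leq_bigmax_seq _ s xpredT (fun x =>
  x) x xs isT). Qed.

Let C_gt x : largest s < x -> C x = 0.
Proof.
by move=> lt; apply/eqP; rewrite -leqn0 leqNgt -mem_count; apply/negP =>
  /largest_ge; lia.
Qed.

Let C0 : C 0 = 0.
Proof. by apply/eqP; rewrite -leqn0 leqNgt -mem_count. Qed.

Lemma half_cond_list : half_cond_even T s \/ half_cond_odd T s -> half_list T s.
Proof.
have CM : 0 < C (largest s) by rewrite -mem_count largest_mem.
have CM1 : 0 < C (largest s).-1 by rewrite -mem_count s_top1.
have M_gt1 := s_top; set M := largest s in CM CM1 M_gt1 *.
case=> [[]|[]]; rewrite -/M.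
- move=> eM evenM TB; pose k := M./2; have ME : M = 2 * k by rewrite /k; lia.
  have M1 : M.-1 = 2 * k - 1 by lia.
  have noeven x : ~~ odd x -> x != M -> C x = 0.
    move=> ex xM; apply/eqP; rewrite -leqn0 leqNgt -mem_count; apply/negP => xs.
    by rewrite (evenM x xs ex) eqxx in xM.
  have st1 : perm_eq s (odd_parts 1 C k ++ nseq (C M) (2 * k)).
    apply/perm_eq_count => x;
      rewrite count_cat count_odd_parts count_nseq /= -ME mul1n.
    have [ox|ex] := boolP (odd x).
      have /negPf-> : M != x by apply: contraTneq ox => <-.
      rewrite mul0n addn0 /=; case: ltnP => // le.
      by apply: C_gt; rewrite -/M ltn_neqAle le andbT; apply: contraTneq ox =>
        <-.
    rewrite /= add0n; have [<-|/negPf xM] := eqVneq M x; first by rewrite mul1n.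
    by rewrite mul0n noeven // eq_sym xM.
  have st2 : T = TypeC ->
      perm_eq s (odd_parts 2 (fun x => (C x)./2) k ++ nseq (C M) (2 * k)).
    move=> TC; apply/perm_eq_count => x; have /perm_eq_count -> := st1.
    rewrite !count_cat !count_odd_parts; congr (_ + _); case: ifP =>
      // /andP[ox _].
    have x0 : 0 < x by case: (x) ox.
    by have := s_even x0; rewrite TC ox => /(_ erefl); lia.
  case: (T) TB s_even st2 => TB even st2; exists k.
  + exists C, 0; split; first by lia.
    by apply: Or43; split=> //;
      [rewrite -M1 -lt0n | rewrite -[X in nseq X _](TB erefl)].
  + exists (fun x => (C x)./2), (C M); split; first by lia.
    left; split; last exact: st2.
    have := even M.-1; rewrite (_ : odd M.-1); last by lia.
    rewrite -M1 => ev; have := ev _ erefl; rewrite muln_eq0; lia.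
  + exists C, (C M)./2; split; first by lia.
    apply: Or44; split=> //; last first.
      rewrite (_ : 2 * (C M)./2 = C M) //; have := even M; rewrite (negPf eM);
        lia.
    have := even M; rewrite (negPf eM) -M1 muln_eq0; lia.
- move=> oM cond; pose k := M./2; have ME : M = 2 * k + 1 by rewrite /k; lia.
  have M1 : M.-1 = 2 * k by lia.
  case: cond => [oddM|[TC C2 mixed]].
    have noodd x : odd x -> x != M -> C x = 0.
      move=> ox xM; apply/eqP; rewrite -leqn0 leqNgt -mem_count; apply/negP =>
        xs.
      by rewrite (oddM x xs ox) eqxx in xM.
    have st1 : perm_eq s (even_parts 1 C k ++ nseq (C M) (2 * k + 1)).
      apply/perm_eq_count => x;
        rewrite count_cat count_even_parts count_nseq /= -ME mul1n.
      have [ox|ex] := boolP (odd x).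
        rewrite /= add0n; have [<-|/negPf xM] := eqVneq M x;
          first by rewrite mul1n.
        by rewrite mul0n noodd // eq_sym xM.
      have /negPf-> : M != x by apply: contraNneq ex => <-.
      rewrite mul0n addn0 /=; have [x0|x0] := posnP x; first by rewrite x0 C0.
      by case: leqP => //= lt; apply: C_gt; rewrite -/M; lia.
    have st2 : T <> TypeC ->
        perm_eq s (even_parts 2 (fun x =>
          (C x)./2) k ++ nseq (C M) (2 * k + 1)).
      move=> TC; apply/perm_eq_count => x; have /perm_eq_count -> := st1.
      rewrite !count_cat !count_even_parts; congr (_ + _); case: ifP =>
        // /and3P[ex x0 _].
      by have := s_even x0; case: (T) TC => // _; rewrite (negPf ex) =>
        /(_ erefl); lia.
    have nz : T <> TypeC -> (C (2 * k))./2 * C M != 0.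
      move=> TC; have := s_even (x := 2 * k); rewrite muln_eq0 -M1.
      by case: (T) TC => // _; rewrite (_ : odd M.-1 = false); lia.
    exists k; case: (T) s_even st2 nz => even st2 nz.
    + exists (fun x => (C x)./2), (C M); split; first by lia.
      by apply: Or41; split; [apply: nz | apply: st2].
    + exists C, (C M)./2; split; first by lia.
      right; have CME : 2 * (C M)./2 = C M by have := even M; rewrite oM; lia.
      by split; [rewrite -M1 muln_eq0; lia | rewrite CME].
    + exists (fun x => (C x)./2), (C M); split; first by lia.
      by apply: Or41; split; [apply: nz | apply: st2].
  have [n1M n1M1 nM1M] : [/\ (1 == M) = false,
    (1 == M.-1) = false & (M.-1 == M) = false].
    by clear - M_gt1 oM; split; apply/eqP; lia.
  have st : perm_eq s (nseq (C 1) 1 ++ nseq 2 (2 * k) ++ nseq (C M) (2 * k +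
    1)).
    apply/perm_eq_count => x; rewrite !count_cat !count_nseq /= -ME -M1.
    have [xs|xs] := boolP (x \in s); last first.
      have Cx : C x = 0 by apply/eqP; rewrite -leqn0 leqNgt -mem_count.
      have -> : (M.-1 == x) = false by apply: contraNF xs => /eqP<-.
      have -> : (M == x) = false by apply: contraNF xs => /eqP<-.
      by rewrite Cx; case: eqP => // x1; rewrite x1 Cx.
    have := mixed x xs; rewrite !inE => /or3P[] /eqP ->.
    - by rewrite eqxx n1M nM1M !mul0n !add0n mul1n.
    - by rewrite eqxx n1M1 [M == _]eq_sym nM1M !mul0n addn0 mul1n [LHS]C2.
    - by rewrite eqxx [M == _]eq_sym [M.-1 == _]eq_sym n1M n1M1 !mul0n !addn0
        mul1n.
  exists k, C, (C M); split; first by lia.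
  by case: (T) TC => // _; apply: Or42; split; rewrite -?lt0n.
Qed.

End HalfPartitions.

Definition is_typeC T := if T is TypeC then true else false.

Section WeightsOfPartition.
Variables (n : nat) (c : 'I_n -> int) (m : nat) (s : seq nat).
Let mu := m.+1.
Let N (j : nat) := weight_mult c j.
Let C x := count_mem x s.
Hypothesis c_le : forall i, c i <= mu%:Z.
Hypothesis N_gt0 : forall j, (j <= mu)%N -> (0 < N j)%N.
Hypothesis N_count : forall k, N k = (N k.+2 + C k.+1)%N.

Let N_eq0 j : (mu < j)%N -> N j = 0%N.
Proof.
move=> lt; apply/eqP; rewrite cards_eq0; apply/eqP/setP => i; rewrite !inE.
by apply/negP => /eqP ci; have := c_le i; lia.
Qed.

Let CM : C mu.+1 = N mu.
Proof. by rewrite (N_count mu) (N_eq0 (j := mu.+2)). Qed.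

Let Cmu : C mu = N m.
Proof. by rewrite (N_count m) (N_eq0 (j := m.+2)). Qed.

Lemma largest_part : largest s = mu.+1.
Proof.
apply: largest_eq => [|[|x] xs //]; first by rewrite mem_count -/(C _) CM N_gt0.
rewrite leqNgt; apply: contraL xs => lt.
by rewrite mem_count -/(C _) lt0n negbK; have := N_count x; rewrite N_eq0 //;
  lia.
Qed.

Lemma previous_part_mem : (largest s).-1 \in s.
Proof. by rewrite largest_part mem_count -/(C _) Cmu N_gt0. Qed.

Variable T : classical_type.
Let alt := is_typeC T.
Hypothesis N0_odd : odd (N 0) <-> T = TypeB.
Hypothesis s_pos : 0%N \notin s.

Let chain_le k d : (N (k + d.*2) <= N k)%N.
Proof.
elim: d => [|d IHd]; first by rewrite addn0.
by apply: leq_trans IHd; rewrite doubleS !addnS (N_count (k + d.*2)) leq_addr.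
Qed.

Let chain_eq k d : (forall l, (l < d)%N -> N (k + l.*2) = N (k + l.*2).+2) ->
  N k = N (k + d.*2).
Proof.
elim: d => [|d IHd] step; first by rewrite addn0.
by rewrite doubleS !addnS -step // IHd // => l ld; apply: step; apply: ltnW.
Qed.

Let absent k : N k = N k.+2 <-> k.+1 \notin s.
Proof. by rewrite mem_count -/(C _) (N_count k); split; lia. Qed.

Lemma half_cond_of_weights : (forall k, odd (alt + k) -> ~~ odd (N k)) ->
  weights_half_cond c alt m -> half_cond_even T s \/ half_cond_odd T s.
Proof.
move=> N_even [Hodd Heven]; rewrite /half_cond_even /half_cond_odd largest_part.
have le_mu x : x.+1 \in s -> (x <= mu)%N.
  move=> xs; rewrite leqNgt; apply: contraL xs => lt.
  by apply/absent; rewrite !N_eq0 // ltnW // ltnW.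
have [om|om] := boolP (odd mu).
  have [NN N1] := Hodd om; left; split; first by rewrite oddS om.
    move=> [|k] ks; first by rewrite (negPf s_pos) in ks.
    rewrite oddS negbK => ok; congr _.+1; apply/eqP; apply: contraLR ks => kmu.
    have [le|lt] := leqP k mu; last by apply: contraL lt => /le_mu;
      rewrite leqNgt.
    by apply/absent/NN => //; move: ok om kmu le; rewrite /mu /=; clear; lia.
  move=> TB; rewrite -/(C _) CM -(N1 (N0_odd.2 TB)); apply/esym.
  have -> : mu = (1 + (m./2).*2)%N by move: om; rewrite /mu /=; clear; lia.
  apply: chain_eq => l lm; apply: NN; first by rewrite oddD odd_double.
  by move: om lm; rewrite /mu /=; clear; lia.
have [NN N02] := Heven om; right; split; first exact: om.
case: N02 => [N02|[nalt N1]]; [left|right].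
  move=> [|k] ks; first by rewrite (negPf s_pos) in ks.
  rewrite oddS => ok; congr _.+1; apply/eqP; apply: contraLR ks => kmu.
  have [le|lt] := leqP k mu; last by apply: contraL lt => /le_mu;
    rewrite leqNgt.
  apply/absent; have [->//|k0] := posnP k.
  by apply: NN => //; move: ok om kmu le; rewrite /mu /=; clear; lia.
have mE : m = (1 + (m./2).*2)%N by move: om; rewrite /mu /=; clear; lia.
have Nm : N m = 2%N.
  have le : (N m <= 2)%N by rewrite mE -N1 chain_le.
  have := N_even m; rewrite (negPf nalt) add0n {1}mE oddD odd_double =>
    /(_ isT).
  by have := N_gt0 (leqnSn m); move: le; clear; lia.
split.
- by move=> TC; move: nalt; rewrite /alt TC.
- by rewrite /= -/(C _) Cmu.
move=> [|k] ks; first by rewrite (negPf s_pos) in ks.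
rewrite !inE /=; have [->|k0] := posnP k; first by rewrite orbT.
apply: contraLR ks; rewrite !negb_or => /and3P[kM kmu _].
have [le|lt] := leqP k mu; last by apply: contraL lt => /le_mu; rewrite leqNgt.
apply/absent; have [ok|ok] := boolP (odd k); last first.
  by apply: NN => //; move: ok om kM le; rewrite /mu /=; clear; lia.
have [d [dE dm]] : exists d, k = (1 + d.*2)%N /\ (d < m./2)%N.
  by exists k./2; move: ok om kmu le; rewrite /mu /=; clear; lia.
(* [N k.+2 <= N k] are squeezed between [N m] and [N 1], both equal to [2]. *)
have le1 : (N k <= 2)%N by rewrite dE -N1 chain_le.
have le2 : (2 <= N k.+2)%N.
  have -> : k.+2 = (1 + d.+1.*2)%N by rewrite dE doubleS !addnS.
  rewrite -Nm {1}mE (_ : (m./2).*2 = d.+1.*2 + (m./2 - d.+1).*2)%N;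
    last by move: dm; clear; lia.
  by rewrite addnA chain_le.
by rewrite (N_count k); have := N_count k; move: le1 le2; clear; lia.
Qed.

Lemma weights_of_half_cond : half_cond_even T s \/ half_cond_odd T s ->
  weights_half_cond c alt m.
Proof.
rewrite /half_cond_even /half_cond_odd largest_part.
case=> [[eM evenM TB]|[oM cond]]; split=> om.
- have NN k : odd k -> (k.+2 <= mu)%N -> N k = N k.+2.
    move=> ok km; apply/absent/negP => ks.
    by have := evenM _ ks; rewrite /= negbK ok => /(_ isT) [kE]; move: km;
      rewrite kE; clear; lia.
  split=> // /N0_odd /TB; rewrite -/(C _) CM => <-.
  rewrite (_ : mu = 1 + (m./2).*2)%N; last by move: om; rewrite /mu /=; clear;
    lia.
  apply: chain_eq => l lm; apply: NN; first by rewrite oddD odd_double.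
  by move: om lm; rewrite /mu /=; clear; lia.
- by move: eM om; rewrite /= negbK /mu /=; case: odd.
- by move: oM om; rewrite /mu /=; case: odd.
case: cond => [oddM|[TC C2 mixed]].
  have NN k : ~~ odd k -> (k.+2 <= mu)%N -> N k = N k.+2.
    move=> ok km; apply/absent/negP => ks.
    by have := oddM _ ks; rewrite /= ok => /(_ isT) [kE]; move: km; rewrite kE;
      clear; lia.
  split=> [k ok _|]; first exact: NN.
  by left; apply: NN => //; move: om; rewrite /mu /=; clear; lia.
split=> [k ok k0 km|].
  apply/absent/negP => /mixed; rewrite !inE /= => /or3P[] /eqP[];
    last by move: k0; clear; lia.
    by move: km; clear; lia.
  by move: km ok om; rewrite /mu /=; clear; lia.
right; split; first by rewrite /alt; case: (T) TC.
rewrite -C2 /= -/(C _) Cmu {1}(_ : m = 1 + (m./2).*2)%N; last by move: om;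
  rewrite /mu /=; clear; lia.
apply: chain_eq => l lm; apply/absent/negP => /mixed; rewrite !inE =>
  /or3P[] /eqP.
- by move: lm om; rewrite /mu /=; clear; lia.
- by move: lm om; rewrite /mu /=; clear; lia.
- by rewrite add1n.
Qed.

End WeightsOfPartition.

(** * The classification *)

Section NormalForm.
Variables (F : numClosedFieldType) (n : nat) (J e h f : 'M[F]_n) (alt : bool).
Hypothesis Ju : J \in unitmx.
Hypothesis Jsym : J^T = (-1) ^+ alt *: J.
Hypothesis ehf : sl2_triple (form_lie J) e h f.
Hypothesis h_diag : diagonalizable h.

(** The form pairs eigenvectors of opposite weights only, so a hyperbolic basis can
    be made of eigenvectors; their weights are integers by [sl_2]-theory. *)
Lemma sl2_normal_form : exists (P : 'M[F]_n) (c : 'I_n -> int),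
  [/\ P \in unitmx, conj_end P h = weight_mx F c, antidiagonal (conj_form P J) &
      forall i, c (rev_ord i) = - c i].
Proof.
have [[eJ hJ fJ] ef he hf] := ehf.
have [P0 P0u /diagonalizable_forPex[d /(simmxLR P0u) hE]] := h_diag.
have P0h i : row i P0 *m h = d 0 i *: row i P0.
  by rewrite hE mxpoly.conjVmx // !mulmxA -row_mul mulmxV // row1 -rowE
    row_diag_mx
    -scalemxAl -rowE.
pose K := invmx J; pose eps : F := (-1) ^+ alt.
have Ku : K \in unitmx by rewrite unitmx_inv.
have eps2 : eps * eps = 1 by rewrite -expr2 sqrr_sign.
have Ksym : K^T = eps *: K.
  by rewrite /K trmx_inv Jsym invmxZ ?invr_sign // -Jsym unitmx_tr.
have Kh : h *m K = - (K *m h^T).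
  have /form_lieP := hJ; move/(congr1 (fun A => K *m A *m K)).
  by rewrite mulmxN mulNmx !mulmxA mulVmx // mul1mx mulmxK // => ->;
    rewrite opprK.
have [P [c0 [Ph Panti]]] := hyperbolic_eigenbasis Ku eps2 Ksym Kh P0u P0h.
have Pu : P \in unitmx.
  have := antidiagonal_unit Panti; rewrite unitmx_mul => /andP[+ _].
  by rewrite unitmx_mul => /andP[].
have c0_int i := sl2_weights_int ef he hf Pu Ph i.
have [c cE] := fin_all_exists c0_int.
have hP : conj_end P h = weight_mx F c.
  rewrite conj_endE; apply: (can_inj (mulmxK Pu)); rewrite mulmxKV //.
  apply/row_matrixP => i; rewrite !row_mul Ph /weight_mx row_diag_mx !mxE cE.
  by rewrite -scalemxAl -rowE.
exists P, c; split=> //.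
  have -> : conj_form P J = invmx (P *m K *m P^T).
    have Ptu : P^T \in unitmx by rewrite unitmx_tr.
    rewrite /conj_form; apply: (can_inj (mulmxK (antidiagonal_unit Panti))).
    rewrite mulVmx ?antidiagonal_unit // !mulmxA mulmxKV // -[_ *m J *m
      K]mulmxA.
    by rewrite mulmxV // mulmx1 trmx_inv mulVmx.
  exact: antidiagonal_inv.
move=> i; apply/eqP; rewrite -addr_eq0 -(eqr_int F) rmorphD /= addrC -!cE.
have Gi : (P *m K *m P^T) i (rev_ord i) != 0 by rewrite Panti.
rewrite -(mulIr_eq0 _ (mulIf Gi)) mulrDl.
pose G := P *m K *m P^T.
have hG : weight_mx F c *m G = - (G *m weight_mx F c).
  have PhE : P *m h = weight_mx F c *m P by rewrite -hP conj_endE mulmxKV.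
  have hPt : h^T *m P^T = P^T *m weight_mx F c.
    by rewrite -trmx_mul PhE trmx_mul /weight_mx tr_diag_mx.
  rewrite /G !mulmxA -PhE -[P *m h *m K]mulmxA Kh mulmxN mulNmx !mulmxA.
  by rewrite -[_ *m h^T *m _]mulmxA hPt !mulmxA.
have := congr1 (fun A : 'M_n => A i (rev_ord i)) hG.
rewrite /weight_mx mul_diag_mx mul_mx_diag !mxE -!cE -/G => /eqP.
by rewrite -addr_eq0 mulrC [X in _ + X]mulrC.
Qed.

End NormalForm.

Lemma conj_jordan_partition (F : fieldType) n (P e : 'M[F]_n) s : P \in unitmx
  ->
  jordan_partition e s -> jordan_partition (conj_end P e) s.
Proof.
move=> Pu [s_sorted s_pos [Q [Qfree Qfull Qe]]]; split=> //.
have Pfree : row_free (invmx P) by rewrite row_free_unit unitmx_inv.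
have Pfull : row_full (invmx P) by rewrite row_full_unit unitmx_inv.
exists (Q *m invmx P); split.
- by rewrite /row_free mxrankMfree.
- by rewrite /row_full (eqmxMfull _ Qfull) mxrank_unit ?unitmx_inv.
- by rewrite conj_endE !mulmxA mulmxKV // Qe.
Qed.

Section Classification.
Variables (F : numClosedFieldType) (T : classical_type) (r : nat).
Variables (J e h f : 'M[F]_(std_dim T r)) (s : seq nat).
Hypothesis J_form : classical_form T J.
Hypothesis e_nilp : lie_nilpotent (form_lie J) e.
Hypothesis ehf : sl2_triple (form_lie J) e h f.
Hypothesis h_odd : strictly_odd (form_lie J) h.
Hypothesis e_part : jordan_partition e s.

Theorem half_abelian_classification :
  (has_half_abelian (form_lie J) h <->
    half_cond_even T s \/ half_cond_odd T s) /\
  (has_half_abelian (form_lie J) h <-> half_list T s).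
Proof.
have [Ju Jsym0] := J_form; pose alt := is_typeC T.
have Jsym : J^T = (-1) ^+ alt *: J.
  have signE U (A : 'M[F]_(std_dim T r)) :
      (if U is TypeC then - A else A) = (-1) ^+ is_typeC U *: A.
    by case: U => /=; rewrite ?expr0 ?scale1r ?expr1 ?scaleN1r.
  by rewrite Jsym0 signE.
have h_diag : diagonalizable h.
  by have [? [? [[t [Delta [[_ tdiag _] ht _ _]]] _]]] := h_odd; apply: tdiag.
have [P [c [Pu hP Janti c_rev]]] := sl2_normal_form Ju Jsym ehf h_diag.
have [mu [mu_gt0 c_le N_gt0]] :=
  strictly_odd_no_gap ehf e_nilp Pu hP Janti c_rev h_odd.
case: mu mu_gt0 c_le N_gt0 => // m _ c_le N_gt0.
pose J' := conj_form P J; pose e' := conj_end P e; pose f' := conj_end P f.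
have [[eJ hJ fJ] ef he hf] := ehf.
have ef' : lie e' f' = weight_mx F c by rewrite -conj_end_lie // ef.
have he' : lie (weight_mx F c) e' = 2 *: e' by rewrite -hP -conj_end_lie // he
  linearZ.
have hf' : lie (weight_mx F c) f' = - 2 *: f' by rewrite -hP -conj_end_lie // hf
  linearZ.
have J'u : J' \in unitmx by apply: antidiagonal_unit.
have J'sym : J'^T = (-1) ^+ alt *: J'.
  by rewrite /J' /conj_form !trmx_mul trmxK Jsym -scalemxAl -scalemxAr mulmxA.
have e'J : e' \in form_lie J' by apply: conj_form_lie.
have e'_part : jordan_partition e' s by apply: conj_jordan_partition.
have N_count k := weight_mult_count ef' he' hf' c_rev k e'_part.
have N_even k : odd (alt + k) -> ~~ odd (weight_mult c k%:Z).
  exact: (weight_mult_even ef' he' hf' c_rev J'u J'sym e'J).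
have N0_odd : odd (weight_mult c 0%:Z) <-> T = TypeB.
  by rewrite odd_weight_mult0 //; case: (T) => /=; rewrite odd_double.
have s_pos : 0%N \notin s.
  by have [_ /allP s_ge1 _] := e_part; apply/negP => /s_ge1.
have N_le k : (weight_mult c k.+2%:Z <= weight_mult c k%:Z)%N by rewrite
  (N_count k) leq_addr.
have N1_even : ~~ alt -> ~~ odd (weight_mult c 1%:Z).
  by move=> nalt; apply: N_even; rewrite (negPf nalt).
have N0_even : alt -> ~~ odd (weight_mult c 0%:Z).
  by move=> altT; apply: N_even; rewrite altT.
have weights_iff : has_half_abelian (form_lie J) h <->
  weights_half_cond c alt m.
  rewrite (has_half_abelian_conjE _ _ Pu) hP; split.
    move/(positions_of_half_abelian Janti J'sym c_rev) => [S [SE Scomm half]].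
    exact: (weights_of_half_positions c_rev c_le N_gt0 N0_even N_le N1_even SE
      Scomm half).
  move=> wc.
  have [S [SE Scomm half]] :=
    half_positions_of_weights c_rev c_le N_gt0 N0_even wc.
  exact: (half_abelian_of_positions Janti J'sym c_rev SE Scomm half).
have cond_iff : has_half_abelian (form_lie J) h <->
  half_cond_even T s \/ half_cond_odd T s.
  rewrite weights_iff; split.
    exact: (half_cond_of_weights c_le N_gt0 N_count N0_odd s_pos N_even).
  exact: (weights_of_half_cond c_le N_gt0 N_count N0_odd s_pos).
split=> //; rewrite cond_iff; split; last exact: half_list_cond.
have top : largest s = m.+2 := largest_part c_le N_gt0 N_count.
apply: half_cond_list => //.
- by rewrite top.
- exact: previous_part_mem c_le N_gt0 N_count.
- case=> // x _ ox; have NN := N_count x.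
  have oddx : odd (alt + x).
    by move: ox; rewrite /alt; case: (T) => /=; case: (odd x).
  have oddx2 : odd (alt + x.+2) by rewrite !addnS /= negbK.
  by have := N_even _ oddx; have := N_even _ oddx2; rewrite NN oddD;
    do 2!case: odd.
Qed.

End Classification.

Theorem theorem3p3 (R : realType) (T : classical_type) (r : nat)
    (J : 'M[R[i]]_(std_dim T r)) (hJ : classical_form T J)
    (hsimple : simple_lie (form_lie J))
    (e h f : 'M[R[i]]_(std_dim T r))
    (he : lie_nilpotent (form_lie J) e)
    (hefh : sl2_triple (form_lie J) e h f)
    (hodd : strictly_odd (form_lie J) h)
    (s : seq nat) (hs : jordan_partition e s) :
  (has_half_abelian (form_lie J) h <->
     half_cond_even T s \/ half_cond_odd T s) /\
  (has_half_abelian (form_lie J) h <-> half_list T s).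
Proof. exact: half_abelian_classification hJ he hefh hodd hs. Qed.
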